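(* Let $\theta_0\in\mathbb{R}$ and let $(\hat\theta_n)_{n\ge1}$ be real random variables such that for every $n$ $$\hat\theta_n-\theta_0=\sigma_0\,\frac1n\sum_{i=1}^nZ_i+R_n,$$ where $\sigma_0>0$, $Z_1,Z_2,\ldots$ are i.i.d. with mean zero and variance $1$, and $\sqrt m\,\sup_{n\ge m}|R_n|\to0$ in probability as $m\to\infty$. For $\varepsilon>0$ and $a\ge0$ let $Q_\varepsilon(a)$ be the number of $n\ge1$ with $n\ge a/\varepsilon^2$ for which $|\hat\theta_n-\theta_0|\ge\varepsilon$. Then for each $a\ge0$, as $\varepsilon\to0$, $$\varepsilon^2Q_\varepsilon(a)\to_d\sigma_0^2\,Q(a/\sigma_0^2)=\sigma_0^2\,\mu\bigl\{t\ge a/\sigma_0^2:|W(t)/t|\ge1\bigr\},$$ where $W$ is a standard Brownian motion and $\mu$ is Lebesgue measure on the half-line $[0,\infty)$. In particular $\varepsilon^2$ times the total number of $n$ with $|\hat\theta_n-\theta_0|\ge\varepsilon$ converges in distribution to $\sigma_0^2Q(0)=\sigma_0^2\,\mu\{t\ge0:|W(t)/t|\ge1\}$.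
   Context: $\to_d$ denotes convergence in distribution. For $b\ge0$, $Q(b)=\mu\{t\ge b:|W(t)/t|\ge1\}$. *)

(* Defs.v *)
From HB Require Import structures.
From mathcomp Require Import all_boot all_order all_algebra finmap.
From mathcomp Require Import all_classical all_reals all_analysis.
From mathcomp Require Import measurable_realfun.
Set Implicit Arguments.
Unset Strict Implicit.
Unset Printing Implicit Defensive.
Import Order.TTheory GRing.Theory Num.Theory.
Import numFieldNormedType.Exports.
Local Open Scope classical_set_scope.
Local Open Scope ring_scope.

Definition mutually_independent (R : realType) (d : measure_display)
    (T : measurableType d) (P : probability T R) (I : choiceType)
    (X : I -> T -> R) : Prop :=
  forall (J : {fset I}) (B : I -> set R), (forall i, measurable (B i)) ->
  P (\bigcap_(i in [set` J]) (X i @^-1` B i)) =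
    (\prod_(i <- J) P (X i @^-1` B i))%E.

Definition identically_distributed (R : realType) (d : measure_display)
    (T : measurableType d) (P : probability T R) (I : Type)
    (X : I -> T -> R) : Prop :=
  forall (i j : I) (B : set R), measurable B ->
  P (X i @^-1` B) = P (X j @^-1` B).

(* The sequence is extended-real valued because a supremum over infinitely many
   indices may be infinite. *)
Definition cvg_to0_in_probability (R : realType) (d : measure_display)
    (T : measurableType d) (P : probability T R) (X : nat -> T -> \bar R) :
    Prop :=
  forall delta : R, 0 < delta ->
  P [set w | (delta%:E <= `|X m w|)%E] @[m --> \oo] --> 0%E.

(* Counting variables and occupation times may be infinite on a null set; they
   count as real random variables when that is all that happens. *)
Definition ae_real_rv (R : realType) (d : measure_display)
    (T : measurableType d) (P : probability T R) (X : T -> \bar R) : Prop :=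
  measurable_fun [set: T] X /\ {ae P, forall w, X w \is a fin_num}.

(* Convergence in distribution along a filter F, tested against bounded
   continuous functions; the limit may live on another probability space.
   [fine] is the identity on finite values, hence almost surely. *)
Definition cvg_in_distribution (R : realType) (I : Type) (F : set_system I)
    (d : measure_display) (T : measurableType d) (P : probability T R)
    (X : I -> T -> \bar R)
    (d' : measure_display) (T' : measurableType d') (P' : probability T' R)
    (Y : T' -> \bar R) : Prop :=
  [/\ \forall i \near F, ae_real_rv P (X i),
      ae_real_rv P' Y &
      forall f : R -> R, continuous f -> bounded_fun f ->
        ('E_P[fun w => f (fine (X i w))])%E @[i --> F] -->
        ('E_P'[fun w => f (fine (Y w))])%E].

(* Only the times t >= 0 matter: W t is arbitrary for t < 0. The second argument
   of [normal_prob] is the standard deviation. *)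
Definition standard_brownian_motion (R : realType) (d : measure_display)
    (T : measurableType d) (P : probability T R) (W : R -> {RV P >-> R}) :
    Prop :=
  [/\ forall w, W 0 w = 0,
      forall (n : nat) (t : nat -> R), 0 <= t 0%N ->
        {homo t : i j / (i <= j)%N >-> i <= j} ->
        mutually_independent P
          (fun (i : 'I_n) (w : T) => W (t i.+1) w - W (t i) w),
      forall (s t : R), 0 <= s -> s < t ->
        forall B : set R, measurable B ->
        P ((fun w => W t w - W s w) @^-1` B) =
          normal_prob 0 (Num.sqrt (t - s)) B &
      forall w, {within `[0, +oo[, continuous (fun t : R => W t w)}].

Arguments standard_brownian_motion {R d T} P W.

Definition exceedance_time (R : realType) (T : Type) (W : R -> T -> R)
    (b : R) (w : T) : \bar R :=
  lebesgue_measure [set t : R | [/\ 0 <= t, b <= t & 1 <= `|W t w / t|]].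

Definition exceedance_count (R : realType) (T : Type) (theta : nat -> T -> R)
    (theta0 a eps : R) (w : T) : \bar R :=
  counting [set n : nat | [/\ (1 <= n)%N, a / eps ^+ 2 <= n%:R &
                              eps <= `|theta n w - theta0|]].

(* Main.v *)
Require Import Defs.
From HB Require Import structures.
From mathcomp Require Import all_boot all_order all_algebra finmap.
From mathcomp Require Import all_classical all_reals all_analysis.
From mathcomp Require Import measurable_realfun.
From mathcomp Require Import ring lra.
Import Order.TTheory GRing.Theory Num.Theory.
Import numFieldNormedType.Exports.
Local Open Scope classical_set_scope.
Local Open Scope ring_scope.
Set Implicit Arguments.
Unset Strict Implicit.
Unset Printing Implicit Defensive.

(** Dividing by sigma0 reduces to sigma0 = 1. With t = e^2 n, the event counted
    at n reads |e S_n + e n rho_n| >= t, where S is the walk of the Z i and rho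
    the remainder. Outside an event of small probability (Hajek-Renyi inequality
    for S, assumption on the remainder) no n with t beyond a horizon is counted,
    and the remainder displaces the barrier by at most a margin when t is not
    too small. Hence e^2 times the count lies between two occupation sums
    sum_n e^2 g(t, e S_n) with g smooth, up to a small error.

    Lindeberg's method applies directly to such sums: replacing the Z i one at a
    time by the increments of W / e over steps of length e^2 changes the
    expectation of a smooth function of the sum by o(1). After the replacement
    one has Riemann sums, which converge path by path to the integrals of
    g(t, W t); these converge to the Lebesgue measure of {t : |W t| >= t} as the
    smoothing is removed, because {t : |W t| = t} is almost surely null. A
    functional limit theorem for S is not needed.

    Bounded continuous test functions are finally approximated, uniformly on
    compact sets, by combinations of smooth steps. *)

(** The count is a discontinuous functional of the walk, with no a priori bound on its number of
    terms; the aim is to reach a function that is smooth in each summand, uniformly in e. Cutting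
    time to a bounded window leaves O(e^-2) terms of weight e^2, so the derivatives of the
    occupation sum in e Z_k are bounded independently of e. One replacement then costs a constant
    times E cub(e Z), and e^-2 E cub(e Z) tends to 0 with second moments alone.

    A single index k governs the cut after the starting time ([lag]), the displacement of the
    barrier ([margin]) and the [horizon]. For fixed k, e tends to 0; k grows afterwards. The cut is
    forced by the remainder, which from an index m on is controlled at the scale m^(-1/2): this is
    comparable with e only once m is of order e^-2.

    The sandwich survives a test function that is nondecreasing and Lipschitz, hence convergence is
    obtained for steps first. The increments come from one fixed W for all e, which makes the
    Riemann sums converge path by path; Z and W are put on a product space to interpolate between
    them. *)

(** * The quintic smooth step and its second-order Taylor bounds *)

Section smooth_step.
Context {R : realType}.
Implicit Types u v y z : R.

(* The remainder in Lindeberg's method; the square makes second moments enough. *)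
Definition cub u : R := Num.min (u ^+ 2) (`|u| ^+ 3).

(* f1 and f2 stand for f' and f'' / 2. *)
Definition taylor2 (C : R) (f f1 f2 : R -> R) : Prop :=
  [/\ forall y, `|f1 y| <= C, forall y, `|f2 y| <= C,
      forall y z, `|f (y + z) - f y| <= C * `|z| &
      forall y z, `|f (y + z) - f y - f1 y * z - f2 y * z ^+ 2| <= C * cub z].

Definition clamp y : R := Num.max 0 (Num.min 1 y).
(** The quintic 10 u^3 - 15 u^4 + 6 u^5 has derivative 30 u^2 (1 - u)^2 and half second derivative
    30 u (1 - u) (1 - 2 u). Both vanish at 0 and 1, so the clamped function is twice continuously
    differentiable. *)
Definition step y : R :=
  clamp y ^+ 3 * (10 - 15 * clamp y + 6 * clamp y ^+ 2).
Definition step1 y : R := 30 * clamp y ^+ 2 * (1 - clamp y) ^+ 2.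
Definition step2 y : R := 30 * clamp y * (1 - clamp y) * (1 - 2 * clamp y).

Let sqr_norm u : `|u| ^+ 2 = u ^+ 2.
Proof. exact: real_normK (num_real u). Qed.

Lemma cub_ge0 u : 0 <= cub u.
Proof. by rewrite le_min sqr_ge0 exprn_ge0. Qed.

Lemma le_cubM (C x u : R) : 0 <= C ->
  `|x| <= C * u ^+ 2 -> `|x| <= C * `|u| ^+ 3 -> `|x| <= C * cub u.
Proof. by move=> C0 h2 h3; rewrite /cub minr_pMr// le_min h2. Qed.

Lemma cub_le2 u : cub u <= u ^+ 2.
Proof. by rewrite ge_min lexx. Qed.

Lemma cub_le3 u : cub u <= `|u| ^+ 3.
Proof. by rewrite ge_min lexx orbT. Qed.

Lemma clamp_itv y : 0 <= clamp y <= 1.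
Proof. by rewrite /clamp le_max lexx/= ge_max ler01 ge_min lexx. Qed.

Lemma clampE y : [\/ (y <= 0) /\ clamp y = 0, (0 <= y <= 1) /\ clamp y = y |
  (1 <= y) /\ clamp y = 1].
Proof.
rewrite /clamp; case: (leP y 0) => y0.
  by constructor 1; split => //; rewrite min_r ?max_l// (le_trans y0).
case: (leP y 1) => y1; last by constructor 3; rewrite max_r// ltW.
by constructor 2; rewrite (ltW y0) max_r// ltW.
Qed.

Lemma clamp_lip y z : `|clamp (y + z) - clamp y| <= `|z|.
Proof.
case: (clampE y) => -[+ ->]; case: (clampE (y + z)) => -[+ ->];
  case: (ler0P z); move=> *; rewrite ?ler_norml; lra.
Qed.

Let quintic u : R := u ^+ 3 * (10 - 15 * u + 6 * u ^+ 2).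

(** The Taylor expansion of a quintic is exact: after the second order a factor (v - u)^3 comes out,
    and its cofactor is at most 31 = 10 + 15 + 6. *)
Let quintic_taylor u v : 0 <= u <= 1 -> 0 <= v <= 1 ->
  `|quintic v - quintic u - 30 * u ^+ 2 * (1 - u) ^+ 2 * (v - u)
    - 30 * u * (1 - u) * (1 - 2 * u) * (v - u) ^+ 2| <= 31 * `|v - u| ^+ 3.
Proof.
move=> /andP[u0 u1] /andP[v0 v1].
have -> : quintic v - quintic u - 30 * u ^+ 2 * (1 - u) ^+ 2 * (v - u)
    - 30 * u * (1 - u) * (1 - 2 * u) * (v - u) ^+ 2 =
  (v - u) ^+ 3 * (10 - 60 * (u * (1 - u)) + (30 * u - 15) * (v - u)
     + 6 * (v - u) ^+ 2) by rewrite /quintic; ring.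
rewrite normrM normrX mulrC ler_wpM2r ?exprn_ge0//.
have := mulr_ge0 u0 (_ : 0 <= 1 - u); rewrite subr_ge0 => /(_ u1) h1.
have h4 : u * (1 - u) <= 4^-1.
  have := sqr_ge0 (2 * u - 1); lra.
have h2 : `|(30 * u - 15) * (v - u)| <= 15.
  by rewrite -(mulr1 15) normrM ler_pM// ler_norml; lra.
have h3 : (v - u) ^+ 2 <= 1.
  by rewrite -real_normK ?num_real// expr_le1// ler_norml; lra.
have h5 := sqr_ge0 (v - u).
move: h2; rewrite !ler_norml; lra.
Qed.

Lemma step1_le y : `|step1 y| <= 30.
Proof.
rewrite /step1; have /andP[u0 u1] := clamp_itv y; set u := clamp y in u0 u1 *.
rewrite -mulrA -exprMn.
have q0 : 0 <= 1 - u by rewrite subr_ge0.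
have a0 : 0 <= u * (1 - u) by rewrite mulr_ge0//.
have a1 : u * (1 - u) <= 1 by have := sqr_ge0 (2 * u - 1); lra.
rewrite ger0_norm ?mulr_ge0 ?exprn_ge0//.
by rewrite -[leRHS]mulr1 ler_wpM2l// expr_le1.
Qed.

Lemma step2_le y : `|step2 y| <= 30.
Proof.
rewrite /step2; have /andP[u0 u1] := clamp_itv y; set u := clamp y in u0 u1 *.
rewrite -!mulrA normrM ger0_norm// -[leRHS]mulr1 ler_wpM2l//.
rewrite mulrA normrM mulr_ile1// ler_norml.
  by apply/andP; split; have := mulr_ge0 u0 (_ : 0 <= 1 - u);
    rewrite ?subr_ge0 => /(_ u1); have := sqr_ge0 (2 * u - 1); lra.
lra.
Qed.

Lemma step_ge0 y : 0 <= step y.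
Proof.
rewrite /step; have /andP[u0 u1] := clamp_itv y; set u := clamp y in u0 u1 *.
rewrite mulr_ge0// ?exprn_ge0//.
have := sqr_ge0 (2 * u - 2); have := sqr_ge0 u; nra.
Qed.

Let quintic_homo u v : 0 <= u -> u <= v -> v <= 1 -> quintic u <= quintic v.
Proof.
move=> u0 uv v1; rewrite -subr_ge0.
pose d := v - u; pose p := 1 - v.
have [d0 p0] : 0 <= d /\ 0 <= p by rewrite !subr_ge0.
(* Both values are binomial tails in homogeneous form, and the coupling of the
   two binomials makes every coefficient of the difference nonnegative. *)
have -> : quintic v - quintic u =
  d ^+ 5 + 5 * d ^+ 4 * u + 5 * d ^+ 4 * p + 10 * d ^+ 3 * u ^+ 2
   + 20 * d ^+ 3 * u * p + 10 * d ^+ 3 * p ^+ 2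
   + 30 * d ^+ 2 * u ^+ 2 * p + 30 * d ^+ 2 * u * p ^+ 2
   + 30 * d * u ^+ 2 * p ^+ 2.
  by rewrite /quintic /d /p; ring.
by rewrite !addr_ge0// !mulr_ge0// ?exprn_ge0.
Qed.

Lemma step_homo : {homo step : u v / u <= v}.
Proof.
move=> u v uv; apply: quintic_homo; have := clamp_itv u; have := clamp_itv v;
  last by case/andP.
- by move=> _ /andP[].
- move=> _ _; case: (clampE u) => -[+ ->]; case: (clampE v) => -[+ ->]; lra.
Qed.

Lemma step_le0 y : y <= 0 -> step y = 0.
Proof.
move=> y0; rewrite /step.
have -> : clamp y = 0 by case: (clampE y) => -[h ->]; lra.
ring.
Qed.

Lemma step_ge1 y : 1 <= y -> step y = 1.
Proof.
move=> y0; rewrite /step.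
have -> : clamp y = 1 by case: (clampE y) => -[h ->]; lra.
ring.
Qed.

Lemma step_le1 y : step y <= 1.
Proof.
case: (leP y 1) => [y1|/ltW/step_ge1->//].
by rewrite -(step_ge1 (y := 1))// step_homo.
Qed.

Lemma taylor2_step : taylor2 100 step step1 step2.
Proof.
have cubic y z : `|step (y + z) - step y - step1 y * z - step2 y * z ^+ 2|
    <= 100 * `|z| ^+ 3.
  have := quintic_taylor (clamp_itv y) (clamp_itv (y + z)).
  rewrite -/(step1 y) -/(step2 y) -/(step y) -/(step (y + z)).
  set d := _ - clamp y => hq.
  have dz : `|d| <= `|z| by exact: clamp_lip.
  have d3 : `|d| ^+ 3 <= `|z| ^+ 3 by rewrite lerXn2r// ?nnegrE.
  have d2 : `|z ^+ 2 - d ^+ 2| <= `|z| ^+ 2.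
    have : d ^+ 2 <= z ^+ 2 by rewrite -(sqr_norm z) -(sqr_norm d) lerXn2r// ?nnegrE.
    rewrite -normrX (ger0_norm (sqr_ge0 z)) ler_norml; have := sqr_ge0 d; lra.
  suff [e1 e2] : `|step1 y * (z - d)| <= 30 * `|z| ^+ 3 /\ `|step2 y * (z ^+ 2 - d ^+ 2)| <= 30 * `|z| ^+ 3.
    have -> : step (y + z) - step y - step1 y * z - step2 y * z ^+ 2 =
      (step (y + z) - step y - step1 y * d - step2 y * d ^+ 2)
      - step1 y * (z - d) - step2 y * (z ^+ 2 - d ^+ 2) by ring.
    rewrite (le_trans (ler_normB _ _))// (le_trans (lerD (ler_normB _ _) (lexx _)))//.
    have := exprn_ge0 3 (normr_ge0 z).
    by move: hq e1 e2 d3; rewrite /step; set a := `|_|; set b := `|_|; set c := `|_|;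
      lra.
  case: (clampE y) => -[hy ey].
  - by rewrite /step1 /step2 ey expr0n/= !(mulr0,mul0r,normr0,exprn_ge0,mulr_ge0).
  (* If [y + z] leaves [0, 1], it passes an end of the interval that is within |z| of [y]. Then u (1
     - u) <= |z|, which supplies the powers of |z| needed to absorb the error z - d made by
     clamping. *)
  - have key : z = d \/ (`|clamp y| <= `|z| \/ `|1 - clamp y| <= `|z|).
      rewrite /d; case: (clampE (y + z)) => -[hz ez]; rewrite ez ey.
      + right; left; rewrite ler_norml; case: (ler0P z); lra.
      + left; lra.
      + right; right; rewrite ler_norml; case: (ler0P z); lra.
    case: key => [zd|key].
      by rewrite -zd !subrr !mulr0 normr0 mulr_ge0// exprn_ge0.
    have zd : `|z - d| <= `|z|.
      move: dz; rewrite /d; case: (clampE (y + z)) => -[hz ez]; rewrite ez ey;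
      rewrite !ler_norml; case: (ler0P z); lra.
    have := clamp_itv y; rewrite /step1 /step2; set u := clamp y in key *.
    move=> /andP[u0 u1].
    have n0 : `|u| = u by rewrite ger0_norm.
    have n1 : `|1 - u| = 1 - u by rewrite ger0_norm// subr_ge0.
    have m12 : `|1 - 2 * u| <= 1 by rewrite ler_norml; lra.
    rewrite n0 n1 in key.
    have k1 : u * (1 - u) <= `|z|.
      by case: key => k; rewrite -[leRHS]mulr1 // 1?[leLHS]mulrC; nra.
    split.
    - have -> : 30 * u ^+ 2 * (1 - u) ^+ 2 * (z - d) =
        30 * ((u * (1 - u)) ^+ 2 * (z - d)) by ring.
      rewrite normrM ger0_norm// ler_wpM2l// normrM.
      rewrite [leRHS]exprSr ler_pM// normrX lerXn2r// ?nnegrE//.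
      by rewrite normrM n0 n1.
    - have -> : 30 * u * (1 - u) * (1 - 2 * u) * (z ^+ 2 - d ^+ 2) =
        30 * ((u * (1 - u)) * (1 - 2 * u) * (z ^+ 2 - d ^+ 2)) by ring.
      rewrite normrM ger0_norm// ler_wpM2l// normrM.
      rewrite exprS ler_pM// normrM normrM n0 n1 -[leRHS]mulr1 ler_pM// mulr_ge0//.
      by rewrite subr_ge0.
  - by rewrite /step1 /step2 ey subrr expr0n/= !(mulr0,mul0r,normr0,exprn_ge0,mulr_ge0).
have s1 := step1_le; have s2 := step2_le.
have lip y z : `|step (y + z) - step y| <= 100 * `|z|.
  have [z1|z1] := leP 1 `|z|.
    have := step_ge0 (y + z); have := step_le1 (y + z).
    have := step_ge0 y; have := step_le1 y.
    move=> *; rewrite ler_norml; lra.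
  have := quintic_taylor (clamp_itv y) (clamp_itv (y + z)).
  have := clamp_lip y z; have := s1 y; have := s2 y.
  rewrite /step1 /step2 -/(step y) -/(step (y + z)).
  set a := 30 * _ * _ ^+ 2; set b := 30 * _ * _ * _; set d := _ - clamp y.
  set s := step y; set t := step (y + z) => b30 a30 dz h.
  have d1 : `|d| <= 1 by rewrite (le_trans dz)// ltW.
  have -> : t - s = (t - s - a * d - b * d ^+ 2) + a * d + b * d ^+ 2 by ring.
  have h1 : `|t - s - a * d - b * d ^+ 2| <= 31 * `|z|.
    rewrite (le_trans h)// ler_wpM2l// (le_trans _ dz)// exprS -[leRHS]mulr1.
    by rewrite ler_wpM2l// expr_le1.
  have h2 : `|a * d| <= 30 * `|z| by rewrite normrM ler_pM.
  have h3 : `|b * d ^+ 2| <= 30 * `|z|.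
    rewrite normrM ler_pM// normrX (le_trans _ dz)// expr2 -[leRHS]mulr1.
    by rewrite ler_wpM2l.
  rewrite (le_trans (ler_normD _ _))// (le_trans (lerD (ler_normD _ _) (lexx _)))//.
  have := normr_ge0 z; lra.
split => // [y|y|y z].
- by have := s1 y; lra.
- by have := s2 y; lra.
- apply: le_cubM => //.
  (* For |z| <= 1 the cubic bound implies the quadratic one; for |z| >= 1 each of the three terms is
     separately at most a multiple of z^2. *)
  have [z1|z1] := leP 1 `|z|; last first.
    rewrite (le_trans (cubic y z))// ler_wpM2l// -(sqr_norm z) exprSr.
    by rewrite -[leRHS]mulr1 ler_wpM2l// ?sqr_ge0// ltW.
  have h1 : `|step (y + z) - step y| <= 1.
    have := step_ge0 (y + z); have := step_le1 (y + z).
    have := step_ge0 y; have := step_le1 y.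
    by move=> *; rewrite ler_norml; lra.
  have zz : `|z| <= `|z| ^+ 2 by rewrite expr2 -{1}(mulr1 `|z|) ler_wpM2l.
  have h2 : `|step1 y * z| <= 30 * z ^+ 2.
    by rewrite normrM ler_pM// -(sqr_norm z).
  have h3 : `|step2 y * z ^+ 2| <= 30 * z ^+ 2.
    by rewrite normrM ler_pM// ger0_norm// sqr_ge0.
  rewrite -(sqr_norm z) in h2 h3 *.
  rewrite (le_trans (ler_normB _ _))// (le_trans (lerD (ler_normB _ _) (lexx _)))//.
  lra.
Qed.

Lemma measurable_clamp : measurable_fun setT clamp.
Proof. by apply: measurable_maxr => //; exact: measurable_minr. Qed.

Lemma measurable_step : measurable_fun setT step.
Proof.
have mc := measurable_clamp.
by rewrite /step; apply: measurable_funM; [exact: measurable_funX|];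
  apply: measurable_funD; [apply: measurable_funB => //; exact: measurable_funM|];
  apply: measurable_funM => //; exact: measurable_funX.
Qed.

Lemma measurable_step1 : measurable_fun setT step1.
Proof.
have mc := measurable_clamp.
rewrite /step1; apply: measurable_funM.
  by apply: measurable_funM => //; exact: measurable_funX.
by apply: measurable_funX; exact: measurable_funB.
Qed.

Lemma measurable_step2 : measurable_fun setT step2.
Proof.
have mc := measurable_clamp.
rewrite /step2; apply: measurable_funM.
  by apply: measurable_funM; [exact: measurable_funM|exact: measurable_funB].
by apply: measurable_funB => //; exact: measurable_funM.
Qed.

Lemma continuous_step : continuous step.
Proof.
move=> y; apply/cvgrPdist_le => e e0; near=> x.
have [_ _ h _] := taylor2_step.
have := h y (x - y); rewrite [y + _]addrC subrK distrC => /le_trans; apply.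
rewrite -ler_pdivlMl// distrC; near: x; apply: cvgr_dist_le; first exact: cvg_id.
by rewrite mulr_gt0// invr_gt0.
Unshelve. all: by end_near. Qed.

(** The chain rule to second order, for an increment D = a u + b u^2 + r. The three parts of the
    constant come from the remainder of [F] at [D], from the first-order term applied to r, and from
    D^2 - (a u)^2 = (D - a u) (D + a u). *)
Lemma taylor2_comp (C K A a b D u : R) (F F1 F2 : R -> R) : taylor2 C F F1 F2 ->
  0 <= C -> 0 <= K -> `|a| <= K -> `|b| <= K -> `|D| <= K * `|u| ->
  `|D - a * u - b * u ^+ 2| <= K * cub u ->
  `|F (A + D) - F A - (F1 A * a) * u - (F1 A * b + F2 A * a ^+ 2) * u ^+ 2| <=
    C * ((1 + K) ^+ 3 + K + 4 * K ^+ 2) * cub u.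
Proof.
move=> [F1C F2C _ FC] C0 K0 aK bK DK rK.
have u2 : `|u| ^+ 2 = u ^+ 2 by rewrite sqr_norm.
set r := D - a * u - b * u ^+ 2 in rK *.
have -> : F (A + D) - F A - (F1 A * a) * u - (F1 A * b + F2 A * a ^+ 2) * u ^+ 2 =
  (F (A + D) - F A - F1 A * D - F2 A * D ^+ 2) + F1 A * r
  + F2 A * ((D - a * u) * (D + a * u)) by rewrite /r; ring.
have auK : `|a * u| <= K * `|u| by rewrite normrM ler_wpM2r.
have p1 : `|D - a * u| <= 2 * K * u ^+ 2.
  have -> : D - a * u = r + b * u ^+ 2 by rewrite /r; ring.
  rewrite (le_trans (ler_normD _ _))//.
  have : `|b * u ^+ 2| <= K * u ^+ 2 by rewrite normrM (ger0_norm (sqr_ge0 u)) ler_wpM2r ?sqr_ge0.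
  have : K * cub u <= K * u ^+ 2 by rewrite ler_wpM2l ?cub_le2.
  lra.
have p2 : `|D - a * u| <= 2 * K * `|u|.
  by rewrite (le_trans (ler_normB _ _))//; lra.
have p3 : `|D + a * u| <= 2 * K * `|u|.
  by rewrite (le_trans (ler_normD _ _))//; lra.
have q1 : `|(D - a * u) * (D + a * u)| <= 4 * K ^+ 2 * cub u.
  apply: le_cubM; first by rewrite mulr_ge0// sqr_ge0.
  - by rewrite normrM (le_trans (ler_pM _ _ p2 p3))// -u2 le_eqVlt; apply/orP; left; apply/eqP; ring.
  - by rewrite normrM (le_trans (ler_pM _ _ p1 p3))// -u2 le_eqVlt; apply/orP; left; apply/eqP; ring.
have q2 : cub D <= (1 + K) ^+ 3 * cub u.
  rewrite -[leLHS]ger0_norm ?cub_ge0//; apply: le_cubM.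
  - by rewrite exprn_ge0// addr_ge0.
  - rewrite ger0_norm ?cub_ge0// (le_trans (cub_le2 _))//.
    rewrite -u2 -(sqr_norm D) (@le_trans _ _ ((K * `|u|) ^+ 2))//.
      by rewrite lerXn2r// nnegrE// mulr_ge0.
    rewrite exprMn ler_wpM2r ?sqr_ge0// (@le_trans _ _ ((1 + K) ^+ 2))//.
      by rewrite lerXn2r ?nnegrE//; lra.
    by rewrite ler_weXn2l//; lra.
  - rewrite ger0_norm ?cub_ge0// (le_trans (cub_le3 _))//.
    rewrite (@le_trans _ _ ((K * `|u|) ^+ 3))//.
      by rewrite lerXn2r// nnegrE// mulr_ge0.
    by rewrite exprMn ler_wpM2r ?exprn_ge0// lerXn2r// ?nnegrE; lra.
rewrite (le_trans (ler_normD _ _))// (le_trans (lerD (ler_normD _ _) (lexx _)))//.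
have -> : C * ((1 + K) ^+ 3 + K + 4 * K ^+ 2) * cub u =
  C * ((1 + K) ^+ 3 * cub u) + C * (K * cub u) + C * (4 * K ^+ 2 * cub u) by ring.
rewrite !lerD//.
- by rewrite (le_trans (FC _ _))// ler_wpM2l.
- by rewrite normrM ler_pM.
- by rewrite normrM ler_pM.
Qed.
End smooth_step.

(** * Lindeberg's replacement *)

Section independence.
Context {d : measure_display} {T : measurableType d} {R : realType}.
Variables (P : probability T R) (I : choiceType) (X : I -> T -> R).
Hypotheses (mX : forall i, measurable_fun setT (X i))
  (indepX : mutually_independent P X).

Definition cylinders (k : I) : set (set T) :=
  [set A | exists (J : {fset I}) (B : I -> set R),
    [/\ k \notin J, forall i, measurable (B i) &
        A = \bigcap_(i in [set` J]) (X i @^-1` B i)]].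

(** The space [T] under the sigma-algebra generated by all [X i] with i != k. That a random variable
    does not involve [X k] is expressed by its measurability on this type. *)
Definition others (k : I) := g_sigma_algebraType (cylinders k).

HB.instance Definition _ k := Measurable.on (others k).

Let mXB i (B : set R) : measurable B -> measurable (X i @^-1` B).
Proof. by move=> mB; rewrite -[X in measurable X]setTI; exact: mX. Qed.

Let cylinders_measurable k : cylinders k `<=` measurable.
Proof.
move=> A [J [B [_ mB ->]]]; apply: fin_bigcap_measurable => // i _.
exact: mXB.
Qed.

Let cylinders_setI k : setI_closed (cylinders k).
Proof.
move=> _ _ [J [B [kJ mB ->]]] [J' [B' [kJ' mB' ->]]].
exists (J `|` J')%fset, (fun i => (if i \in J then B i else setT) `&`
  (if i \in J' then B' i else setT)); split.
- by rewrite inE negb_or kJ.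
- by move=> i; apply: measurableI; case: ifPn.
- apply/seteqP; split => w /=.
    move=> [h h'] i; rewrite /= inE => ij; split; case: ifPn => // iJ.
    + exact: h.
    + exact: h'.
  move=> h; split=> i /= iJ; have := h i; rewrite /= inE iJ ?orbT => /(_ isT)[].
    by [].
  by move=> _; apply.
Qed.

Lemma others_measurable k (A : set T) :
  measurable (A : set (others k)) -> measurable A.
Proof.
apply: smallest_sub; last exact: cylinders_measurable.
exact: sigma_algebra_measurable.
Qed.

Lemma measurable_fun_others k d' (T' : measurableType d') (a : T -> T') :
  measurable_fun setT (a : others k -> T') -> measurable_fun setT a.
Proof. by move=> ma _ B mB; apply: others_measurable; exact: ma. Qed.

Lemma others_coord k j : j != k -> measurable_fun setT (X j : others k -> R).
Proof.
move=> jk _ B mB; rewrite setTI; apply: sub_sigma_algebra.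
exists [fset j]%fset, (fun=> B); split => //.
  by rewrite inE eq_sym.
apply/seteqP; split => w /=.
  by move=> h i /=; rewrite inE => /eqP ->.
by move=> /(_ j); apply; rewrite /= inE.
Qed.

(** Two finite measures of A, P (A and E) and P E * P A with E an event of [X k], agree on the
    cylinders by mutual independence. Cylinders are stable under intersection, so the measures agree
    on the sigma-algebra they generate. *)
Lemma others_indep k (A : set T) (B : set R) :
  measurable (A : set (others k)) -> measurable B ->
  P (A `&` X k @^-1` B) = (P A * P (X k @^-1` B))%E.
Proof.
move=> mA mB; have mE := mXB k mB; set E := X k @^-1` B.
have p0 : 0 <= fine (P E) by rewrite fine_ge0.
have pE : ((NngNum p0)%:num)%:E = P E by rewrite /= fineK// fin_num_measure.
suff : mrestr P mE A = mscale (NngNum p0) P A.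
  by rewrite /mrestr /mscale pE muleC.
apply: (@g_sigma_algebra_measure_unique _ _ _ (cylinders k) _ (fun=> setT)) => //.
- move=> _; exists fset0, (fun=> setT); split => //.
  by apply/seteqP; split.
- by rewrite bigcup_const.
- move=> _ [J [C [kJ mC ->]]]; rewrite /= /mrestr /mscale pE.
  pose C' i := if i == k then B else C i.
  have JE : \bigcap_(i in [set` J]) (X i @^-1` C i) =
      \bigcap_(i in [set` J]) (X i @^-1` C' i).
    apply: eq_bigcapr => i /= iJ; rewrite /C'; case: eqP => // ik.
    by move: kJ; rewrite -ik iJ.
  have mC' i : measurable (C' i) by rewrite /C'; case: ifP.
  have -> : \bigcap_(i in [set` J]) (X i @^-1` C i) `&` E =
      \bigcap_(i in [set` (k |` J)%fset]) (X i @^-1` C' i).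
    rewrite JE; apply/seteqP; split => w /=.
      move=> [h Ew] i /=; rewrite !inE => /orP[/eqP->|/h//].
      by rewrite /C' eqxx.
    move=> h; split; first by move=> i /= iJ; apply: h; rewrite /= !inE iJ orbT.
    by have := h k; rewrite /C' /= eqxx !inE eqxx => /(_ isT).
  have C'k : C' k = B by rewrite /C' eqxx.
  have e := indepX (k |` J)%fset mC'.
  by rewrite big_fsetU1//= C'k -(indepX J mC') -JE in e.
- by move=> _; rewrite /= /mrestr setTI (le_lt_trans (probability_le1 _ _))// ltry.
Qed.

(** By [others_indep] the joint law of [a] and [X k] is the product of their laws on rectangles,
    hence everywhere; Fubini's theorem then factors the integral. *)
Lemma expectation_others k (a : T -> R) (h : R -> R) :
  measurable_fun setT (a : others k -> R) -> measurable_fun setT h ->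
  P.-integrable setT (EFin \o a) -> P.-integrable setT (EFin \o (h \o X k)) ->
  P.-integrable setT (EFin \o (fun w => a w * h (X k w))) /\
  \int[P]_w (a w * h (X k w)) = (\int[P]_w a w) * (\int[P]_w h (X k w)).
Proof.
move=> ma mh ia ih.
have ma' := measurable_fun_others ma.
have mX' := mX k.
pose ra : {mfun T >-> R} := HB.pack a (isMeasurableFun.Build _ _ _ _ a ma').
pose rk : {mfun T >-> R} := HB.pack (X k) (isMeasurableFun.Build _ _ _ _ (X k) mX').
pose Pa : probability R R := distribution P ra.
pose Pk : probability R R := distribution P rk.
pose pr w := (a w, X k w).
have mpr : measurable_fun setT pr by exact/measurable_fun_pair.
have PakE (A : set (R * R)) : measurable A -> (Pa \x Pk)%E A = pushforward P pr A.
  apply: product_measure_unique => B C mB mC.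
  rewrite /pushforward/= -others_indep//.
  by rewrite -[X in measurable X]setTI; exact: ma.
pose f (z : R * R) : \bar R := (z.1 * h z.2)%:E.
have mf : measurable_fun setT f.
  by apply/measurable_EFinP; apply: measurable_funM => //; exact: measurableT_comp.
have ea : (\int[Pa]_x `|x%:E| = \int[P]_w `|(a w)%:E|)%E.
  by rewrite ge0_integral_distribution//; exact: measurableT_comp.
have ek : (\int[Pk]_x `|(h x)%:E| = \int[P]_w `|(h (X k w))%:E|)%E.
  rewrite ge0_integral_distribution//.
  by apply: measurableT_comp => //; exact/measurable_EFinP.
have iPk : Pk.-integrable setT (EFin \o h).
  apply/integrableP; split; first exact/measurable_EFinP.
  by rewrite ek; case/integrableP: ih.
have iPa : Pa.-integrable setT (fun x => x%:E).
  apply/integrableP; split; first exact: EFin_measurable.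
  by rewrite ea; case/integrableP: ia.
have ifp : (Pa \x Pk)%E.-integrable setT f.
  apply/integrable12ltyP => //.
  have -> : (\int[Pa]_x \int[Pk]_y `|f (x, y)| =
      (\int[Pa]_x `|x%:E|) * (\int[Pk]_y `|(h y)%:E|))%E.
    rewrite -ge0_integralZr//; last 2 first.
    - exact: measurableT_comp.
    - by apply: integral_ge0.
    apply: eq_integral => x _.
    rewrite -ge0_integralZl//; last first.
      by apply: measurableT_comp => //; exact/measurable_EFinP.
    by apply: eq_integral => y _; rewrite /f/= -EFinM normrM.
  by rewrite lte_mul_pinfty ?integral_ge0 ?ge0_fin_numE ?integral_ge0//;
    [case/integrableP: iPa|case/integrableP: iPk].
have ab : P.-integrable setT (f \o pr).
  apply/integrableP; split; first exact: measurableT_comp.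
  rewrite -(@ge0_integral_pushforward _ _ _ _ _ _ mpr P setT (abse \o f))//; last 2 first.
  - exact: measurableT_comp.
  - by move=> z _; exact: abse_ge0.
  case/integrableP: ifp => _; congr (_ < _)%E.
  by apply: eq_measure_integral => A mA _; exact: PakE.
split=> //.
rewrite /Rintegral.
have -> : (\int[P]_w (a w * h (X k w))%:E = \int[Pa \x Pk]_z f z)%E.
  transitivity (\int[pushforward P pr]_z f z)%E.
    by rewrite integral_pushforward.
  by apply: eq_measure_integral => A mA _; exact/esym/PakE.
rewrite -integral12_prod_meas1//.
have -> : (\int[Pa]_x fubini_F Pk f x = \int[Pa]_x (x%:E * \int[Pk]_y (h y)%:E))%E.
  apply: eq_integral => x _; rewrite /fubini_F -integralZl//.
have fk : (\int[Pk]_y (h y)%:E)%E \is a fin_num by exact: integrable_fin_num.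
rewrite -(fineK fk) integralZr// fineM//=; last exact: integrable_fin_num.
congr (fine _ * fine _); last by rewrite integral_distribution//; exact/measurable_EFinP.
by rewrite integral_distribution.
Qed.
End independence.

(** * Taylor expansion of occupation sums in one coordinate *)

Section occupation_sum.
Context {R : realType}.
Implicit Types (x : nat -> R) (k n : nat).

Definition upd x k (z : R) : nat -> R := fun i => if i == k then z else x i.

Definition psum x n := \sum_(i < n) x i.

Lemma psum_upd x k z n :
  psum (upd x k z) n = psum (upd x k 0) n + (if (k < n)%N then z else 0).
Proof.
rewrite /psum; case: ifPn => kn.
  rewrite (bigD1 (Ordinal kn))//= [in RHS](bigD1 (Ordinal kn))//=.
  rewrite /upd eqxx add0r addrC; congr (_ + _); apply: eq_bigr => i.
  by rewrite -val_eqE/= => /negbTE ->.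
rewrite addr0; apply: eq_bigr => i _; rewrite /upd.
by case: eqP => // ik; move: kn; rewrite -ik ltn_ord.
Qed.

Variables (eps : R) (g g1 g2 : nat -> R -> R) (n0 N : nat).

Definition occ x := \sum_(n0 <= n < N) eps ^+ 2 * g n (eps * psum x n).

(** [occ1] and [occ2] are the Taylor coefficients of [occ] in the variable eps * x k, taken at x k =
    0 so that they are functions of the other coordinates. The partial sums with n <= k do not
    contain x k and contribute 0. *)
Definition occ1 x k := \sum_(n0 <= n < N) eps ^+ 2 *
  (if (k < n)%N then g1 n (eps * psum (upd x k 0) n) else 0).

Definition occ2 x k := \sum_(n0 <= n < N) eps ^+ 2 *
  (if (k < n)%N then g2 n (eps * psum (upd x k 0) n) else 0).

Lemma eq_occ x y : (forall i, (i < N)%N -> x i = y i) -> occ x = occ y.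
Proof.
move=> xy; apply: eq_big_nat => n /andP[_ nN]; congr (_ * g _ (_ * _)).
by apply: eq_bigr => i _; apply: xy; exact: ltn_trans nN.
Qed.

Variables (C L : R).
Hypotheses (C0 : 0 <= C) (L0 : 0 <= L) (epsL : eps ^+ 2 * (N - n0)%:R <= L).
Hypothesis gC : forall n, taylor2 C (g n) (g1 n) (g2 n).

(** The total weight eps^2 (N - n0) is at most [L], so a bound on the terms passes to the sum with a
    constant free of eps. *)
Let sum_le (c : nat -> R) (M : R) : 0 <= M -> (forall n, `|c n| <= C * M) ->
  `|\sum_(n0 <= n < N) eps ^+ 2 * c n| <= C * L * M.
Proof.
move=> M0 cM; apply: le_trans (ler_norm_sum _ _ _) _.
apply: (@le_trans _ _ (\sum_(n0 <= n < N) eps ^+ 2 * (C * M))).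
  apply: ler_sum => n _; rewrite normrM ger0_norm ?sqr_ge0//.
  by rewrite ler_wpM2l ?sqr_ge0.
rewrite big_const_nat iter_addr_0 -mulr_natr.
rewrite (_ : _ * _ * _ = (eps ^+ 2 * (N - n0)%:R) * (C * M)); last by ring.
by rewrite (_ : C * L * M = L * (C * M)); [rewrite ler_wpM2r// mulr_ge0|ring].
Qed.

Lemma occ1_le x k : `|occ1 x k| <= C * L.
Proof.
rewrite -[leRHS]mulr1; apply: sum_le => // n; case: ifP => _; rewrite mulr1 ?normr0//.
by have [h _ _ _] := gC n.
Qed.

Lemma occ2_le x k : `|occ2 x k| <= C * L.
Proof.
rewrite -[leRHS]mulr1; apply: sum_le => // n; case: ifP => _; rewrite mulr1 ?normr0//.
by have [_ h _ _] := gC n.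
Qed.

Lemma occ_upd_lip x k z :
  `|occ (upd x k z) - occ (upd x k 0)| <= C * L * `|eps * z|.
Proof.
rewrite /occ -sumrB; under eq_bigr do rewrite -mulrBr.
apply: sum_le => // n; rewrite psum_upd mulrDr.
have [_ _ h _] := gC n; apply: le_trans (h _ _) _; rewrite ler_wpM2l//.
by case: ifP => // _; rewrite mulr0 normr0.
Qed.

Lemma occ_upd_taylor x k z :
  `|occ (upd x k z) - occ (upd x k 0) - occ1 x k * (eps * z)
    - occ2 x k * (eps * z) ^+ 2| <= C * L * cub (eps * z).
Proof.
set u := eps * z.
have -> : occ (upd x k z) - occ (upd x k 0) - occ1 x k * u - occ2 x k * u ^+ 2 =
  \sum_(n0 <= n < N) eps ^+ 2 * (g n (eps * psum (upd x k z) n)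
    - g n (eps * psum (upd x k 0) n)
    - (if (k < n)%N then g1 n (eps * psum (upd x k 0) n) else 0) * u
    - (if (k < n)%N then g2 n (eps * psum (upd x k 0) n) else 0) * u ^+ 2).
  rewrite /occ /occ1 /occ2 -sumrB !mulr_suml -!sumrB.
  by apply: eq_bigr => n _; ring.
apply: sum_le => [|n]; first exact: cub_ge0.
rewrite psum_upd; case: ifP => _; last first.
  by rewrite addr0 !mul0r subrr !subr0 normr0 mulr_ge0// cub_ge0.
by have [_ _ _ h] := gC n; rewrite [eps * (_ + _)]mulrDr; exact: h.
Qed.

Variables (CF : R) (F F1 F2 : R -> R).
Hypotheses (CF0 : 0 <= CF) (FC : taylor2 CF F F1 F2).

(** The Taylor coefficients of F (occ x) in x k, given by [taylor2_comp]. They inherit from [occ1]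
    and [occ2] the independence from x k that factors expectations in Lindeberg's step. *)
Definition lin_coef x k := F1 (occ (upd x k 0)) * occ1 x k * eps.

Definition quad_coef x k := (F1 (occ (upd x k 0)) * occ2 x k
  + F2 (occ (upd x k 0)) * occ1 x k ^+ 2) * eps ^+ 2.

Definition taylor_cst := CF * ((1 + C * L) ^+ 3 + C * L + 4 * (C * L) ^+ 2).

Lemma taylor_cst_ge0 : 0 <= taylor_cst.
Proof. by rewrite /taylor_cst !(mulr_ge0, addr_ge0, exprn_ge0). Qed.

Lemma F_occ_taylor x k z :
  `|F (occ (upd x k z)) - F (occ (upd x k 0)) - lin_coef x k * z
    - quad_coef x k * z ^+ 2| <= taylor_cst * cub (eps * z).
Proof.
have := @taylor2_comp _ CF (C * L) (occ (upd x k 0)) (occ1 x k) (occ2 x k)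
   (occ (upd x k z) - occ (upd x k 0)) (eps * z) F F1 F2 FC CF0 (mulr_ge0 C0 L0)
   (occ1_le _ _) (occ2_le _ _) (occ_upd_lip _ _ _) (occ_upd_taylor _ _ _).
rewrite [X in F X](addrC (occ _)) subrK; congr (`|_| <= _).
rewrite /lin_coef /quad_coef; ring.
Qed.

Lemma lin_coef_le x k : `|lin_coef x k| <= CF * (C * L) * `|eps|.
Proof.
rewrite /lin_coef normrM ler_wpM2r// normrM ler_pM//; last exact: occ1_le.
by have [h _ _ _] := FC.
Qed.

Lemma quad_coef_le x k :
  `|quad_coef x k| <= (CF * (C * L) + CF * (C * L) ^+ 2) * eps ^+ 2.
Proof.
have [h1 h2 _ _] := FC.
rewrite /quad_coef normrM (ger0_norm (sqr_ge0 eps)) ler_wpM2r ?sqr_ge0//.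
rewrite (le_trans (ler_normD _ _))// lerD// normrM ler_pM//; first exact: occ2_le.
by rewrite normrX lerXn2r ?nnegrE ?mulr_ge0// occ1_le.
Qed.

Section measurability.
Context {d : measure_display} {T : measurableType d}.
Variable x : nat -> T -> R.
Hypotheses (mg : forall n, measurable_fun setT (g n))
  (mg1 : forall n, measurable_fun setT (g1 n))
  (mg2 : forall n, measurable_fun setT (g2 n))
  (mF : measurable_fun setT F) (mF1 : measurable_fun setT F1)
  (mF2 : measurable_fun setT F2).

Lemma measurable_psum n : (forall i, measurable_fun setT (x i)) ->
  measurable_fun setT (fun w => psum (x^~ w) n).
Proof. by move=> mx; apply: measurable_sum. Qed.

Lemma measurable_occ : (forall i, measurable_fun setT (x i)) ->
  measurable_fun setT (fun w => occ (x^~ w)).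
Proof.
move=> mx; apply: measurable_sum => n; apply: measurable_funM => //.
apply: measurableT_comp => //; apply: measurable_funM => //.
exact: measurable_psum.
Qed.

Variable k : nat.
Hypothesis mx : forall i, i != k -> measurable_fun setT (x i).

Let mu : forall i, measurable_fun setT (fun w => upd (x^~ w) k 0 i).
Proof.
by move=> i; rewrite /upd; case: eqP => // /eqP; exact: mx.
Qed.

Let mocc : measurable_fun setT (fun w => occ (upd (x^~ w) k 0)).
Proof.
apply: measurable_sum => n; apply: measurable_funM => //.
apply: measurableT_comp => //; apply: measurable_funM => //.
exact: measurable_sum.
Qed.

Let mocc1 : measurable_fun setT (fun w => occ1 (x^~ w) k).
Proof.
apply: measurable_sum => n; apply: measurable_funM => //.
case: (k < n)%N => //; apply: measurableT_comp => //; apply: measurable_funM => //.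
exact: measurable_sum.
Qed.

Let mocc2 : measurable_fun setT (fun w => occ2 (x^~ w) k).
Proof.
apply: measurable_sum => n; apply: measurable_funM => //.
case: (k < n)%N => //; apply: measurableT_comp => //; apply: measurable_funM => //.
exact: measurable_sum.
Qed.

(** Measurability is asked of the coordinates other than [k], so that the domain may be
    [others X k]. *)
Lemma measurable_lin_coef : measurable_fun setT (fun w => lin_coef (x^~ w) k).
Proof.
apply: measurable_funM => //; apply: measurable_funM => //.
exact: measurableT_comp.
Qed.

Lemma measurable_quad_coef : measurable_fun setT (fun w => quad_coef (x^~ w) k).
Proof.
apply: measurable_funM => //; apply: measurable_funD; apply: measurable_funM => //.
- exact: measurableT_comp.
- exact: measurableT_comp.
- exact: measurable_funX.
Qed.

End measurability.
End occupation_sum.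

Section bounded_integrable.
Context {d : measure_display} {T : measurableType d} {R : realType}.
Variable P : probability T R.

Lemma bounded_integrable (f : T -> R) (C : R) : measurable_fun setT f ->
  (forall w, `|f w| <= C) -> P.-integrable setT (EFin \o f).
Proof.
move=> mf fC; apply: measurable_bounded_integrable => //.
  by rewrite (le_lt_trans (probability_le1 _ _))// ltry.
exists C; split; first exact: num_real.
by move=> M CM w _ /=; rewrite (le_trans (fC w))// ltW.
Qed.

Lemma boundedM_integrable (a f : T -> R) (C : R) : measurable_fun setT a ->
  (forall w, `|a w| <= C) -> P.-integrable setT (EFin \o f) ->
  P.-integrable setT (EFin \o (fun w => a w * f w)).
Proof.
move=> ma aC fi; apply: (@integrableMr _ _ _ P setT measurableT a (EFin \o f)) => //.
exists C; split; first exact: num_real.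
by move=> M CM w _ /=; rewrite (le_trans (aC w))// ltW.
Qed.

End bounded_integrable.

(** * Independence on the product of two probability spaces *)

Section product_independence.
Context {R : realType} {d d' : measure_display}
  {T : measurableType d} {T' : measurableType d'}.
Variables (P : probability T R) (P' : probability T' R).
Local Notation PP := (P \x P')%E.

Lemma fst_integrable (f : T -> R) : P.-integrable setT (EFin \o f) ->
  PP.-integrable setT (EFin \o (f \o fst)) /\
  \int[PP]_z f z.1 = \int[P]_w f w.
Proof.
move=> fi; have mf : measurable_fun setT f by apply/measurable_EFinP; exact: measurable_int fi.
have mff : measurable_fun setT (EFin \o (f \o (@fst T T'))).
  by apply/measurable_EFinP; exact: measurableT_comp.
have i1 : PP.-integrable setT (EFin \o (f \o fst)).
  apply/integrable12ltyP => //=.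
  under eq_integral do rewrite integral_cst//= probability_setT mule1.
  by case/integrableP: fi.
split=> //; rewrite /Rintegral; congr fine.
rewrite -(integral12_prod_meas1 i1); apply: eq_integral => w _.
by rewrite /fubini_F /= integral_cst//= probability_setT mule1.
Qed.

Lemma snd_integrable (f : T' -> R) : P'.-integrable setT (EFin \o f) ->
  PP.-integrable setT (EFin \o (f \o snd)) /\
  \int[PP]_z f z.2 = \int[P']_w f w.
Proof.
move=> fi; have mf : measurable_fun setT f by apply/measurable_EFinP; exact: measurable_int fi.
have mff : measurable_fun setT (EFin \o (f \o (@snd T T'))).
  by apply/measurable_EFinP; exact: measurableT_comp.
have i1 : PP.-integrable setT (EFin \o (f \o snd)).
  apply/integrable21ltyP => //=.
  under eq_integral do rewrite integral_cst//= probability_setT mule1.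
  by case/integrableP: fi.
split=> //; rewrite /Rintegral; congr fine.
rewrite -(integral21_prod_meas1 i1); apply: eq_integral => w _.
by rewrite /fubini_G /= integral_cst//= probability_setT mule1.
Qed.

Let integrable_fubini_G' (f : T * T' -> \bar R) : PP.-integrable setT f ->
  P'.-integrable setT (fubini_G P f).
Proof.
move=> fi; have mf := measurable_int _ fi.
apply/integrableP; split; first exact: (measurable_fubini_G fi).
apply: (@le_lt_trans _ _ (\int[P']_y \int[P]_x `|f (x, y)|)%E).
  apply: ge0_le_integral => //.
  - by apply: measurableT_comp => //; exact: (measurable_fubini_G fi).
  - have ma : measurable_fun setT (abse \o f) by exact: measurableT_comp.
    have f0 z : (0 <= (abse \o f) z)%E by exact: abse_ge0.
    exact: (@measurable_fun_fubini_tonelli_G _ _ _ _ _ P _ ma f0).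
  - move=> y _; apply: le_abse_integral => //.
    exact: measurableT_comp.
by apply/integrable21ltyP.
Qed.

Lemma expectation_others_fst (X : nat -> T -> R) (k : nat) (a : T * T' -> R)
    (h : R -> R) (C : R) :
  (forall i, measurable_fun setT (X i)) -> mutually_independent P X ->
  measurable_fun setT a -> (forall z, `|a z| <= C) ->
  (forall w', measurable_fun setT ((fun w => a (w, w')) : others X k -> R)) ->
  measurable_fun setT h -> P.-integrable setT (EFin \o (h \o X k)) ->
  PP.-integrable setT (EFin \o (fun z => a z * h (X k z.1))) /\
  \int[PP]_z (a z * h (X k z.1)) = (\int[PP]_z a z) * (\int[P]_w h (X k w)).
Proof.
move=> mX indX ma aC ma' mh hi.
have [i1 _] := fst_integrable hi.
have ia := bounded_integrable PP ma aC.
have iah := boundedM_integrable ma aC i1.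
split=> //; rewrite /Rintegral -(integral21_prod_meas1 iah) -(integral21_prod_meas1 ia).
set c := (\int[P]_w _)%E.
have cf : c \is a fin_num by exact: (integrable_fin_num _ hi).
rewrite -fineM//; last first.
  by rewrite (integral21_prod_meas1 ia); exact: integrable_fin_num.
congr fine; rewrite -(fineK cf) -integralZr//; last exact: integrable_fubini_G'.
apply: eq_integral => w' _; rewrite /fubini_G/=.
have iaw : P.-integrable setT (EFin \o (fun w => a (w, w'))).
  apply: (@bounded_integrable _ _ _ _ _ C) => //.
  exact: measurable_fun_others (ma' w').
have [j1 j2] := expectation_others mX indX (ma' w') mh iaw hi.
move: j2; rewrite /Rintegral -fineM//; last exact: integrable_fin_num.
move=> e; have := congr1 EFin e; rewrite !fineK//.
- by rewrite fin_numM// integrable_fin_num.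
- exact: integrable_fin_num j1.
Qed.

Lemma expectation_others_snd (X : nat -> T' -> R) (k : nat) (a : T * T' -> R)
    (h : R -> R) (C : R) :
  (forall i, measurable_fun setT (X i)) -> mutually_independent P' X ->
  measurable_fun setT a -> (forall z, `|a z| <= C) ->
  (forall w, measurable_fun setT ((fun w' => a (w, w')) : others X k -> R)) ->
  measurable_fun setT h -> P'.-integrable setT (EFin \o (h \o X k)) ->
  PP.-integrable setT (EFin \o (fun z => a z * h (X k z.2))) /\
  \int[PP]_z (a z * h (X k z.2)) = (\int[PP]_z a z) * (\int[P']_w h (X k w)).
Proof.
move=> mX indX ma aC ma' mh hi.
have [i1 _] := snd_integrable hi.
have ia := bounded_integrable PP ma aC.
have iah := boundedM_integrable ma aC i1.
split=> //; rewrite /Rintegral -(integral12_prod_meas1 iah) -(integral12_prod_meas1 ia).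
set c := (\int[P']_w _)%E.
have cf : c \is a fin_num by exact: (integrable_fin_num _ hi).
rewrite -fineM//; last first.
  by rewrite (integral12_prod_meas1 ia); exact: integrable_fin_num.
congr fine; rewrite -(fineK cf) -integralZr//; last exact: integrable_fubini_F.
apply: eq_integral => w _; rewrite /fubini_F/=.
have iaw : P'.-integrable setT (EFin \o (fun w' => a (w, w'))).
  apply: (@bounded_integrable _ _ _ _ _ C) => //.
  exact: measurable_fun_others (ma' w).
have [j1 j2] := expectation_others mX indX (ma' w) mh iaw hi.
move: j2; rewrite /Rintegral -fineM//; last exact: integrable_fin_num.
move=> e; have := congr1 EFin e; rewrite !fineK//.
- by rewrite fin_numM// integrable_fin_num.
- exact: integrable_fin_num j1.
Qed.

End product_independence.

(** * Replacement of the summands one at a time *)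

Section lindeberg.
Context {R : realType} {d d' : measure_display}
  {T : measurableType d} {T' : measurableType d'}.
Variables (P : probability T R) (P' : probability T' R).
Variables (X : nat -> T -> R) (Y : nat -> T' -> R).
Hypotheses (mX : forall i, measurable_fun setT (X i))
  (mY : forall i, measurable_fun setT (Y i))
  (indX : mutually_independent P X) (indY : mutually_independent P' Y).
Hypotheses (iX : forall i, P.-integrable setT (EFin \o X i))
  (iY : forall i, P'.-integrable setT (EFin \o Y i))
  (iX2 : forall i, P.-integrable setT (EFin \o (fun w => X i w ^+ 2)))
  (iY2 : forall i, P'.-integrable setT (EFin \o (fun w => Y i w ^+ 2)))
  (EX : forall i, \int[P]_w X i w = 0) (EY : forall i, \int[P']_w Y i w = 0)
  (EX2 : forall i, \int[P]_w X i w ^+ 2 = 1)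
  (EY2 : forall i, \int[P']_w Y i w ^+ 2 = 1).
Variables (eps : R) (g g1 g2 : nat -> R -> R) (n0 N : nat) (C L : R).
Hypotheses (C0 : 0 <= C) (L0 : 0 <= L) (epsL : eps ^+ 2 * (N - n0)%:R <= L).
Hypothesis gC : forall n, taylor2 C (g n) (g1 n) (g2 n).
Variables (CF M : R) (F F1 F2 : R -> R).
Hypotheses (CF0 : 0 <= CF) (FC : taylor2 CF F F1 F2) (FM : forall y, `|F y| <= M).
Hypotheses (mg : forall n, measurable_fun setT (g n))
  (mg1 : forall n, measurable_fun setT (g1 n))
  (mg2 : forall n, measurable_fun setT (g2 n))
  (mF : measurable_fun setT F) (mF1 : measurable_fun setT F1)
  (mF2 : measurable_fun setT F2).

Local Notation PP := (P \x P')%E.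
Let o := occ eps g n0 N.
Let K := taylor_cst C L CF.

Definition hybrid k (z : T * T') i := if (i < k)%N then X i z.1 else Y i z.2.

Let mhyb k i : measurable_fun setT (fun z => hybrid k z i).
Proof. by rewrite /hybrid; case: (i < k)%N => //; exact: measurableT_comp. Qed.

Let hybridS k z : hybrid k.+1 z = upd (hybrid k z) k (X k z.1).
Proof.
apply/funext => i; rewrite /hybrid /upd ltnS leq_eqVlt.
by case: eqVneq => // ->.
Qed.

Let hybridE k z : hybrid k z = upd (hybrid k z) k (Y k z.2).
Proof.
apply/funext => i; rewrite /hybrid /upd.
by case: eqVneq => // ->; rewrite ltnn.
Qed.

Let mFo k : measurable_fun setT (fun z => F (o (hybrid k z))).
Proof.
apply: measurableT_comp => //.
exact: (@measurable_occ _ eps g n0 N _ _ (fun i z => hybrid k z i) mg (mhyb k)).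
Qed.

Let iFo k : PP.-integrable setT (EFin \o (fun z => F (o (hybrid k z)))).
Proof. exact: (bounded_integrable _ (mFo k) (fun z => FM _)). Qed.

Let lin k z := lin_coef eps g g1 n0 N F1 (hybrid k z) k.
Let quad k z := quad_coef eps g g1 g2 n0 N F1 F2 (hybrid k z) k.

Let hybrid_fst k w' i : i != k ->
  measurable_fun setT ((fun w => hybrid k (w, w') i) : others X k -> R).
Proof. by move=> ik; rewrite /hybrid/=; case: (i < k)%N => //; exact: others_coord. Qed.

Let hybrid_snd k w i : i != k ->
  measurable_fun setT ((fun w' => hybrid k (w, w') i) : others Y k -> R).
Proof. by move=> ik; rewrite /hybrid/=; case: (i < k)%N => //; exact: others_coord. Qed.

Let cubX k : P.-integrable setT (EFin \o (fun w => cub (eps * X k w))).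
Proof.
have i2 : P.-integrable setT (EFin \o (fun w => eps ^+ 2 * X k w ^+ 2)).
  exact: (@boundedM_integrable _ _ _ _ _ _ `|eps ^+ 2|).
apply: le_integrable i2 => //.
  apply/measurable_EFinP; apply: measurable_minr.
    by apply: measurable_funX; exact: measurable_funM.
  by apply: measurable_funX; apply: measurableT_comp => //; exact: measurable_funM.
move=> w _ /=; rewrite lee_fin !ger0_norm ?cub_ge0//.
  by rewrite -exprMn cub_le2.
by rewrite mulr_ge0// sqr_ge0.
Qed.

Let cubY k : P'.-integrable setT (EFin \o (fun w => cub (eps * Y k w))).
Proof.
have i2 : P'.-integrable setT (EFin \o (fun w => eps ^+ 2 * Y k w ^+ 2)).
  exact: (@boundedM_integrable _ _ _ _ _ _ `|eps ^+ 2|).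
apply: le_integrable i2 => //.
  apply/measurable_EFinP; apply: measurable_minr.
    by apply: measurable_funX; exact: measurable_funM.
  by apply: measurable_funX; apply: measurableT_comp => //; exact: measurable_funM.
move=> w _ /=; rewrite lee_fin !ger0_norm ?cub_ge0//.
  by rewrite -exprMn cub_le2.
by rewrite mulr_ge0// sqr_ge0.
Qed.

Let D k := \int[PP]_z F (o (hybrid k z)).

(** [hybrid k.+1] and [hybrid k] are updates of one sequence at coordinate [k]. Expanded at the
    value 0 there, their first and second order terms have equal expectations: the coefficients are
    independent of [X k] and of [Y k], which share their first two moments. Only the two Taylor
    remainders are left. *)
Let D_step k : `|D k.+1 - D k| <=
  K * (\int[P]_w cub (eps * X k w) + \int[P']_w cub (eps * Y k w)).
Proof.
have mlin : measurable_fun setT (lin k).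
  exact: (@measurable_lin_coef _ eps g g1 n0 N F1 _ _ (fun i z => hybrid k z i)
    mg mg1 mF1 k (fun i _ => mhyb k i)).
have mquad : measurable_fun setT (quad k).
  exact: (@measurable_quad_coef _ eps g g1 g2 n0 N F1 F2 _ _ (fun i z => hybrid k z i)
    mg mg1 mg2 mF1 mF2 k (fun i _ => mhyb k i)).
have linC z : `|lin k z| <= CF * (C * L) * `|eps|.
  exact: (lin_coef_le C0 epsL gC FC).
have quadC z : `|quad k z| <= (CF * (C * L) + CF * (C * L) ^+ 2) * eps ^+ 2.
  exact: (quad_coef_le C0 L0 epsL gC FC).
have lin_fst w' : measurable_fun setT ((fun w => lin k (w, w')) : others X k -> R).
  exact: (@measurable_lin_coef _ eps g g1 n0 N F1 _ (others X k)
    (fun i w => hybrid k (w, w') i) mg mg1 mF1 k (@hybrid_fst k w')).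
have lin_snd w : measurable_fun setT ((fun w' => lin k (w, w')) : others Y k -> R).
  exact: (@measurable_lin_coef _ eps g g1 n0 N F1 _ (others Y k)
    (fun i w' => hybrid k (w, w') i) mg mg1 mF1 k (@hybrid_snd k w)).
have quad_fst w' : measurable_fun setT ((fun w => quad k (w, w')) : others X k -> R).
  exact: (@measurable_quad_coef _ eps g g1 g2 n0 N F1 F2 _ (others X k)
    (fun i w => hybrid k (w, w') i) mg mg1 mg2 mF1 mF2 k (@hybrid_fst k w')).
have quad_snd w : measurable_fun setT ((fun w' => quad k (w, w')) : others Y k -> R).
  exact: (@measurable_quad_coef _ eps g g1 g2 n0 N F1 F2 _ (others Y k)
    (fun i w' => hybrid k (w, w') i) mg mg1 mg2 mF1 mF2 k (@hybrid_snd k w)).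
have msq : measurable_fun setT (fun y : R => y ^+ 2) by exact: measurable_funX.
have [i1 E1] := expectation_others_fst P' mX indX mlin linC lin_fst
  (@measurable_id _ _ setT) (iX k).
have [i2 E2] := expectation_others_snd P mY indY mlin linC lin_snd
  (@measurable_id _ _ setT) (iY k).
have [i3 E3] := expectation_others_fst P' mX indX mquad quadC quad_fst msq (iX2 k).
have [i4 E4] := expectation_others_snd P mY indY mquad quadC quad_snd msq (iY2 k).
have [j1 e1] := fst_integrable P' (cubX k).
have [j2 e2] := snd_integrable P (cubY k).
pose l z := (lin k z * X k z.1 - lin k z * Y k z.2)
   + (quad k z * X k z.1 ^+ 2 - quad k z * Y k z.2 ^+ 2).
have i12 : PP.-integrable setT (EFin \o (fun z => lin k z * X k z.1 - lin k z * Y k z.2)).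
  exact: integrableB i1 i2.
have i34 : PP.-integrable setT
    (EFin \o (fun z => quad k z * X k z.1 ^+ 2 - quad k z * Y k z.2 ^+ 2)).
  exact: integrableB i3 i4.
have il : PP.-integrable setT (EFin \o l) by exact: integrableD i12 i34.
have El : \int[PP]_z l z = 0.
  rewrite RintegralD// RintegralB// RintegralB// E1 E2 E3 E4 EX EY EX2 EY2.
  by rewrite !mulr0 !mulr1 !subrr addr0.
pose D' z := F (o (hybrid k.+1 z)) - F (o (hybrid k z)).
have iD : PP.-integrable setT (EFin \o D') by exact: integrableB (iFo _) (iFo _).
have iDl : PP.-integrable setT (EFin \o (fun z => D' z - l z)).
  exact: integrableB iD il.
have -> : D k.+1 - D k = \int[PP]_z (D' z - l z).
  by rewrite RintegralB// El subr0 RintegralB.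
apply: le_trans (le_normr_Rintegral measurableT iDl) _.
have j12 : PP.-integrable setT (EFin \o (fun z => cub (eps * X k z.1) + cub (eps * Y k z.2))).
  exact: integrableD j1 j2.
rewrite -e1 -e2 -RintegralD// -RintegralZl//.
apply: le_Rintegral => //.
- exact: integrable_norm iDl.
- exact: integrableZl j12.
move=> z _.
have hX := F_occ_taylor C0 L0 epsL gC CF0 FC (hybrid k z) k (X k z.1).
have hY := F_occ_taylor C0 L0 epsL gC CF0 FC (hybrid k z) k (Y k z.2).
rewrite -hybridS -/(lin k z) -/(quad k z) in hX.
rewrite -hybridE -/(lin k z) -/(quad k z) in hY.
rewrite mulrDr; apply: le_trans (lerD hX hY).
apply: le_trans (ler_normB _ _).
rewrite /D' /l -/o le_eqVlt; apply/orP; left; apply/eqP; congr (`|_|); ring.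
Qed.

Theorem lindeberg : `|\int[P]_w F (o (X^~ w)) - \int[P']_w F (o (Y^~ w))| <=
  K * \sum_(k < N) (\int[P]_w cub (eps * X k w) + \int[P']_w cub (eps * Y k w)).
Proof.
have iFX : P.-integrable setT (EFin \o (fun w => F (o (X^~ w)))).
  apply: (bounded_integrable _ _ (fun w => FM _)); apply: measurableT_comp => //.
  exact: measurable_occ.
have iFY : P'.-integrable setT (EFin \o (fun w => F (o (Y^~ w)))).
  apply: (bounded_integrable _ _ (fun w => FM _)); apply: measurableT_comp => //.
  exact: measurable_occ.
(* [hybrid N] agrees with X on the coordinates below N, the only ones that the occupation sum reads;
   [hybrid 0] is Y. *)
have -> : \int[P]_w F (o (X^~ w)) = D N.
  have [_ <-] := fst_integrable P' iFX; apply: eq_Rintegral => z _; congr F.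
  by apply: eq_occ => i iN; rewrite /hybrid iN.
have -> : \int[P']_w F (o (Y^~ w)) = D 0%N.
  by have [_ <-] := snd_integrable P iFY; apply: eq_Rintegral => z _; congr F.
rewrite -(telescope_sumr D (leq0n N)) big_mkord mulr_sumr.
apply: le_trans (ler_norm_sum _ _ _) _.
by apply: ler_sum => k _; exact: D_step.
Qed.

End lindeberg.

Lemma Rintegral_probability_cst {R : realType} {d : measure_display}
  {T : measurableType d} (P : probability T R) (r : R) : \int[P]_w r = r.
Proof.
rewrite Rintegral_cst//; transitivity (r * fine 1%E); last exact: mulr1.
by congr (_ * fine _); exact: probability_setT.
Qed.

(** * Hajek-Renyi inequality *)

Section hajek_renyi.
Context {R : realType} {d : measure_display} {T : measurableType d}.
Variables (P : probability T R) (X : nat -> T -> R).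
Hypotheses (mX : forall i, measurable_fun setT (X i))
  (indX : mutually_independent P X)
  (iX : forall i, P.-integrable setT (EFin \o X i))
  (iX2 : forall i, P.-integrable setT (EFin \o (fun w => X i w ^+ 2)))
  (EX : forall i, \int[P]_w X i w = 0)
  (EX2 : forall i, \int[P]_w X i w ^+ 2 = 1).

Let S n w := psum (X^~ w) n.

Let S_others n k : (k <= n)%N -> measurable_fun setT (S k : others X n -> R).
Proof.
move=> kn; rewrite /S /psum /=.
rewrite [X in measurable_fun _ X](_ : _ = fun w => \sum_(i < n)
  (if (i < k)%N then X i w else 0)).
  apply: measurable_sum => i; case: (i < k)%N => //.
  by apply: others_coord; rewrite neq_ltn ltn_ord.
apply/funext => w; rewrite (big_ord_widen _ (fun i => X i w) kn).
by rewrite [LHS]big_mkcond.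
Qed.

Let mS n : measurable_fun setT (S n).
Proof. exact: measurable_sum. Qed.

Let SS n w : S n.+1 w = S n w + X n w.
Proof. by rewrite /S /psum big_ord_recr. Qed.

Let iS n : P.-integrable setT (EFin \o S n).
Proof.
elim: n => [|n ih]; last first.
  rewrite [X in _.-integrable _ X](_ : _ = EFin \o (fun w => S n w + X n w)).
    exact: integrableD ih (iX n).
  by apply/funext => w /=; rewrite SS.
rewrite [X in _.-integrable _ X](_ : _ = EFin \o (fun=> 0)).
  by apply: (bounded_integrable _ _ (C := 0)) => // w; rewrite normr0.
by apply/funext => w /=; rewrite /S /psum big_ord0.
Qed.

(** Expanding the square, the cross term has mean 0 and the new square has conditional mean 1,
    because both [p] and [S n] are independent of [X n]. The weight [p] will be an indicator of the
    past. *)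
Let second_moment_step n (p : T -> R) :
  measurable_fun setT (p : others X n -> R) -> (forall w, `|p w| <= 1) ->
  P.-integrable setT (EFin \o (fun w => S n w ^+ 2)) ->
  P.-integrable setT (EFin \o (fun w => S n.+1 w ^+ 2)) /\
  \int[P]_w (p w * S n.+1 w ^+ 2) =
    \int[P]_w (p w * S n w ^+ 2) + \int[P]_w p w.
Proof.
move=> mp p1 iS2.
have mp' : measurable_fun setT p := measurable_fun_others mX mp.
have msq : measurable_fun setT (fun y : R => y ^+ 2) by exact: measurable_funX.
have ip : P.-integrable setT (EFin \o p) by exact: bounded_integrable p1.
have ipS : P.-integrable setT (EFin \o (fun w => p w * S n w)).
  exact: boundedM_integrable p1 (iS n).
have ipS2 : P.-integrable setT (EFin \o (fun w => p w * S n w ^+ 2)).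
  exact: boundedM_integrable p1 iS2.
have [iSX _] := expectation_others mX indX (S_others (leqnn n))
  (@measurable_id _ _ setT) (iS n) (iX n).
have mpS : measurable_fun setT ((fun w => p w * S n w) : others X n -> R).
  by apply: measurable_funM => //; exact: S_others.
have [ipSX epSX] := expectation_others mX indX mpS (@measurable_id _ _ setT) ipS (iX n).
have [ipX2 epX2] := expectation_others mX indX mp msq ip (iX2 n).
split.
  rewrite [X in _.-integrable _ X](_ : _ = EFin \o (fun w => S n w ^+ 2 +
    (2 * (S n w * X n w) + X n w ^+ 2))).
    have i1 : P.-integrable setT (EFin \o (fun w => 2 * (S n w * X n w))).
      exact: integrableZl iSX.
    have i2 : P.-integrable setT
        (EFin \o (fun w => 2 * (S n w * X n w) + X n w ^+ 2)).
      exact: integrableD i1 (iX2 n).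
    exact: integrableD iS2 i2.
  by apply/funext => w /=; rewrite SS; congr EFin; ring.
under eq_Rintegral => w _.
  rewrite SS (_ : _ * _ = p w * S n w ^+ 2 + (2 * (p w * S n w * X n w)
    + p w * X n w ^+ 2)); last by ring.
  over.
have i2 : P.-integrable setT (EFin \o (fun w => 2 * (p w * S n w * X n w))).
  exact: integrableZl ipSX.
rewrite RintegralD//; last by exact: integrableD i2 ipX2.
rewrite RintegralD// RintegralZl// epSX epX2 EX EX2.
by rewrite !mulr0 add0r mulr1.
Qed.

Let iS2 n : P.-integrable setT (EFin \o (fun w => S n w ^+ 2)).
Proof.
elim: n => [|n ih]; last first.
  have [] // := @second_moment_step n (fun=> 1) _ _ ih.
  by move=> w; rewrite normr1.
rewrite [X in _.-integrable _ X](_ : _ = EFin \o (fun=> 0)).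
  by apply: (bounded_integrable _ _ (C := 0)) => // w; rewrite normr0.
by apply/funext => w /=; rewrite /S /psum big_ord0 expr0n.
Qed.

Let ES2 n : \int[P]_w S n w ^+ 2 = n%:R.
Proof.
elim: n => [|n ih].
  rewrite -[RHS](Rintegral_probability_cst P).
  by apply: eq_Rintegral => w _; rewrite /S /psum big_ord0 expr0n.
have [] // := @second_moment_step n (fun=> 1) _ _ (iS2 n).
  by move=> w; rewrite normr1.
move=> _; under eq_Rintegral do rewrite mul1r.
move=> ->; under eq_Rintegral do rewrite mul1r.
by rewrite ih Rintegral_probability_cst natr1.
Qed.

Variables (c : R) (m : nat).
Hypotheses (c0 : 0 < c) (m0 : (0 < m)%N).

(** The indicator that the walk stays below the barrier at the times m, ..., M - 1, and the constant
    1 for M <= m. As a product it has a one-step recursion. *)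
Let nohit M w : R :=
  \prod_(m <= n < M) (if `|S n w| < c * n%:R then 1 else 0).

Let nohit01 M w : nohit M w = 0 \/ nohit M w = 1.
Proof.
rewrite /nohit; elim/big_ind: _; first by right.
  by move=> x y [->|->] [->|->]; rewrite ?(mul0r,mulr0,mul1r); tauto.
by move=> i _; case: ifP => _; tauto.
Qed.

Let nohitS M w : (m <= M)%N ->
  nohit M.+1 w = nohit M w * (if `|S M w| < c * M%:R then 1 else 0).
Proof. by move=> mM; rewrite /nohit big_nat_recr. Qed.

(** The last time that [nohit M] inspects is M - 1 <= n, and [S n] is the sum of the [X i] with i <
    n. *)
Let nohit_others M n : (M <= n.+1)%N ->
  measurable_fun setT (nohit M : others X n -> R).
Proof.
elim: M => [|M ih] Mn.
  rewrite [X in measurable_fun _ X](_ : _ = fun=> 1)//.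
  by apply/funext => w; rewrite /nohit big_geq.
case: (leqP m M) => mM.
  rewrite [X in measurable_fun _ X](_ : _ = fun w => nohit M w *
    (if `|S M w| < c * M%:R then 1 else 0)).
    apply: measurable_funM; first by apply: ih; exact: ltnW.
    apply: measurable_fun_ifT => //; apply: measurable_fun_ltr => //.
    by apply: measurableT_comp => //; exact: S_others.
  by apply/funext => w; rewrite nohitS.
rewrite [X in measurable_fun _ X](_ : _ = fun=> 1)//.
by apply/funext => w; rewrite /nohit big_geq.
Qed.

Let nohit_le1 M w : `|nohit M w| <= 1.
Proof. by case: (nohit01 M w) => ->; rewrite ?normr0 ?normr1. Qed.

Let inohit M : P.-integrable setT (EFin \o nohit M).
Proof.
apply: (bounded_integrable _ _ (@nohit_le1 M)).
exact: (measurable_fun_others mX (@nohit_others M M (leqnSn _))).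
Qed.

Let inohitS2 M n : P.-integrable setT (EFin \o (fun w => nohit M w * S n w ^+ 2)).
Proof.
apply: (boundedM_integrable _ (@nohit_le1 M)) => //.
exact: (measurable_fun_others mX (@nohit_others M M (leqnSn _))).
Qed.

Let q M := \int[P]_w nohit M w.
(** The term 1 / n is a reserve for the variances still to be added: 1 / (n + 1)^2 <= 1 / n - 1 / (n
    + 1). With it the weighted second moments become nonincreasing. *)
Let V n := \int[P]_w (nohit n w * S n w ^+ 2) / n%:R ^+ 2 + n%:R^-1.

(* On the event of a first passage at time n, S_n^2 / n^2 >= c^2; the second
   moment lost there is paid for by the decrease of V. *)
Let V_step n : (m <= n)%N -> c ^+ 2 * (q n - q n.+1) <= V n - V n.+1.
Proof.
move=> mn; have n0 : 0 < n%:R :> R by rewrite ltr0n (leq_trans m0).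
pose p := nohit n.+1.
have [_ e1] := second_moment_step (@nohit_others n.+1 n (leqnn _)) (@nohit_le1 _) (iS2 n).
have a1 : c ^+ 2 * n%:R ^+ 2 * (q n - q n.+1) <=
   \int[P]_w (nohit n w * S n w ^+ 2) - \int[P]_w (p w * S n w ^+ 2).
  rewrite -(RintegralB measurableT (inohit n) (inohit n.+1)).
  rewrite -(RintegralB measurableT (inohitS2 n n) (inohitS2 n.+1 n)).
  have d1 : P.-integrable setT (EFin \o (fun w => nohit n w - nohit n.+1 w)).
    exact: integrableB (inohit n) (inohit n.+1).
  have d2 : P.-integrable setT
      (EFin \o (fun w => nohit n w * S n w ^+ 2 - nohit n.+1 w * S n w ^+ 2)).
    exact: integrableB (inohitS2 n n) (inohitS2 n.+1 n).
  rewrite -RintegralZl//; apply: le_Rintegral => //; first exact: integrableZl d1.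
  move=> w _; rewrite -mulrBl /p nohitS//; case: ifPn => [|].
    by rewrite mulr1 subrr mulr0 mul0r.
  rewrite -leNgt mulr0 subr0 => h.
  rewrite [leLHS]mulrC ler_wpM2l//; first by case: (nohit01 n w) => ->.
  rewrite -exprMn -[leRHS]real_normK ?num_real// lerXn2r ?nnegrE//.
  by rewrite mulr_ge0// ltW.
have p0 : 0 <= \int[P]_w (p w * S n w ^+ 2).
  apply: Rintegral_ge0 => w _; rewrite mulr_ge0 ?sqr_ge0//.
  by rewrite /p; case: (nohit01 n.+1 w) => ->.
have q1 : q n.+1 <= 1.
  rewrite -[leRHS](Rintegral_probability_cst P); apply: le_Rintegral => //.
    by apply: (bounded_integrable _ _ (C := 1)) => // w; rewrite normr1.
  by move=> w _; case: (nohit01 n.+1 w) => ->.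
rewrite /V e1 -/p -/(q n.+1).
set A := \int[P]_w _ in a1 *; set B := \int[P]_w _ in a1 p0 *.
have n10 : 0 < n.+1%:R :> R by rewrite ltr0n.
have h1 : c ^+ 2 * (q n - q n.+1) <= (A - B) / n%:R ^+ 2.
  rewrite ler_pdivlMr ?exprn_gt0//; apply: le_trans a1.
  by rewrite le_eqVlt; apply/orP; left; apply/eqP; ring.
apply: (le_trans h1).
have h2 : B / n.+1%:R ^+ 2 <= B / n%:R ^+ 2.
  rewrite ler_wpM2l// lef_pV2 ?posrE ?exprn_gt0//.
  by rewrite lerXn2r ?nnegrE ?ltW// ltr_nat.
have h3 : q n.+1 / n.+1%:R ^+ 2 <= n%:R^-1 - n.+1%:R^-1.
  apply: (@le_trans _ _ (1 / n.+1%:R ^+ 2)).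
    by rewrite ler_wpM2r// invr_ge0 exprn_ge0// ltW.
  have -> : n%:R^-1 - n.+1%:R^-1 = 1 / (n%:R * n.+1%:R) :> R.
    by rewrite -natr1; field; rewrite natr1 !gt_eqF.
  rewrite ler_wpM2l// lef_pV2 ?posrE ?exprn_gt0 ?mulr_gt0//.
  by rewrite expr2 ler_wpM2r ?ltW// ltr_nat.
have -> : (A - B) / n%:R ^+ 2 = A / n%:R ^+ 2 - B / n%:R ^+ 2 by rewrite mulrBl.
have -> : (B + q n.+1) / n.+1%:R ^+ 2 =
  B / n.+1%:R ^+ 2 + q n.+1 / n.+1%:R ^+ 2 by rewrite mulrDl.
move: h2 h3; set b1 := B / _; set b2 := B / _; set q2 := q n.+1 / _.
set a2 := A / _; set r1 := n%:R^-1; set r2 := n.+1%:R^-1; lra.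
Qed.

Let q_ge M : (m <= M)%N -> c ^+ 2 * (1 - q M) <= 2 / m%:R.
Proof.
move=> mM; have m0' : 0 < m%:R :> R by rewrite ltr0n.
have nohitm w : nohit m w = 1 by rewrite /nohit big_geq.
have qm : q m = 1.
  rewrite /q; under eq_Rintegral do rewrite nohitm.
  by rewrite Rintegral_probability_cst.
(* The second moment m / m^2 and the reserve 1 / m contribute equally; this is the 2 of the final
   inequality. *)
have Vm : V m = 2 / m%:R.
  rewrite /V; under eq_Rintegral do rewrite nohitm mul1r.
  by rewrite ES2; field; rewrite gt_eqF.
have VM : 0 <= V M.
  rewrite /V addr_ge0 ?invr_ge0// divr_ge0 ?sqr_ge0//.
  apply: Rintegral_ge0 => w _; rewrite mulr_ge0 ?sqr_ge0//.
  by case: (nohit01 M w) => ->.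
have h : c ^+ 2 * (q m - q M) <= V m - V M.
  elim: M mM {VM} => [|M ih]; first by rewrite leqn0 => /eqP ->; rewrite !subrr mulr0.
  rewrite leq_eqVlt => /predU1P[<-|]; first by rewrite !subrr mulr0.
  by rewrite ltnS => mM; have := V_step mM; have := ih mM; lra.
by rewrite qm Vm in h; lra.
Qed.

Lemma hajek_renyi :
  measurable [set w | exists2 n, (m <= n)%N & c * n%:R <= `|S n w|] /\
  (P [set w | exists2 n, (m <= n)%N & (c * n%:R <= `|S n w|)%R] <=
    (2 / (c ^+ 2 * m%:R))%:E)%E.
Proof.
pose A M := [set w | exists2 n, (m <= n < M)%N & c * n%:R <= `|S n w|].
have AE M : A M = nohit M @^-1` [set 0].
  apply/seteqP; split => w /=.
    move=> [n nM h]; rewrite /nohit (@bigD1_seq _ _ _ _ _ n)//= ?mem_index_iota ?iota_uniq//.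
    by rewrite ltNge h mul0r.
  move=> /eqP; rewrite /nohit prodf_seq_eq0 => /hasP[n]; rewrite mem_index_iota => mn /=.
  by case: ifPn; rewrite ?oner_eq0// -leNgt => h _; exists n.
have mA M : measurable (A M).
  rewrite AE -[X in measurable X]setTI.
  exact: (measurable_fun_others mX (@nohit_others M M (leqnSn _))).
have -> : [set w | exists2 n, (m <= n)%N & c * n%:R <= `|S n w|] = \bigcup_M A M.
  apply/seteqP; split => w /=.
    by move=> [n mn h]; exists n.+1 => //; exists n => //; rewrite mn/=.
  by move=> [M _ [n /andP[mn _] h]]; exists n.
have mU : measurable (\bigcup_M A M) by exact: bigcup_measurable.
split=> //.
have ndA : nondecreasing_seq A.
  move=> M N MN; apply/subsetPset => w [n /andP[mn nM] h]; exists n => //.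
  by rewrite mn (leq_trans nM).
have cv := nondecreasing_cvg_mu mA mU ndA (mu := P).
rewrite -(cvg_lim _ cv)//; apply: lime_le; first exact: cvgP cv.
near=> M => /=.
have mM : (m <= M)%N by near: M; exists m.
have -> : P (A M) = (1 - q M)%:E.
  rewrite -[LHS]fineK ?fin_num_measure//; congr EFin.
  transitivity (\int[P]_w (\1_(A M) w : R)).
    by rewrite /Rintegral integral_indic// setIT.
  rewrite -[X in X - _](Rintegral_probability_cst P) -RintegralB//.
    apply: eq_Rintegral => w _; rewrite indicE AE.
    case: (nohit01 M w) => h; first by rewrite mem_set//= h subr0.
    by rewrite memNset/= h ?subrr//; apply/eqP; rewrite oner_eq0.
  by apply: (bounded_integrable _ _ (C := 1)) => // w; rewrite normr1.
rewrite lee_fin invfM mulrCA ler_pdivlMl ?exprn_gt0//.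
exact: q_ge.
Unshelve. all: by end_near. Qed.

End hajek_renyi.

(** * Brownian motion *)

Section normal_moments.
Context {R : realType}.
Local Notation mu := (@lebesgue_measure R).
Implicit Types (m s : R).

Let mpdf m s : measurable_fun setT (fun x => (normal_pdf m s x)%:E).
Proof. by apply/measurable_EFinP; exact: measurable_normal_pdf. Qed.

Lemma ge0_integral_normal_prob m s (f : R -> \bar R) :
  (forall x, 0 <= f x)%E -> measurable_fun setT f ->
  (\int[normal_prob m s]_x f x = \int[mu]_x (f x * (normal_pdf m s x)%:E))%E.
Proof.
move=> f0 mf; have dom := normal_prob_dominates m s.
rewrite -(Radon_Nikodym_SigmaFinite.change_of_variables dom f0 measurableT mf).
have fi := Radon_Nikodym_SigmaFinite.f_integrable dom.
apply: ae_eq_integral => //.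
- by apply: emeasurable_funM => //; exact: measurable_int fi.
- by apply: emeasurable_funM => //; exact: mpdf.
- apply: ae_eqe_mul2l; apply: integral_ae_eq => //.
    exact: mpdf.
  by move=> E _ mE; rewrite -Radon_Nikodym_SigmaFinite.f_integral.
Qed.

Lemma integral_normal_prob m s (f : R -> R) :
  (normal_prob m s).-integrable setT (EFin \o f) ->
  mu.-integrable setT (EFin \o (fun x => f x * normal_pdf m s x)) /\
  \int[normal_prob m s]_x f x = \int[mu]_x (f x * normal_pdf m s x).
Proof.
move=> fi; have mf := measurable_int _ fi.
have p0 x : (0 <= (normal_pdf m s x)%:E)%E by rewrite lee_fin normal_pdf_ge0.
have int g : measurable_fun setT g -> (forall x, 0 <= g x)%E ->
    (\int[normal_prob m s]_x g x < +oo)%E ->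
    mu.-integrable setT (fun x => (g x * (normal_pdf m s x)%:E)%E).
  move=> mg g0 goo; apply/integrableP; split.
    by apply: emeasurable_funM => //; exact: mpdf.
  under eq_integral do rewrite gee0_abs ?mule_ge0//.
  by rewrite -ge0_integral_normal_prob.
have /integrableP[mp] := integrable_funepos measurableT fi.
under eq_integral do rewrite gee0_abs ?funepos_ge0//.
move=> /(int _ mp (funepos_ge0 _)) ip.
have /integrableP[mn] := integrable_funeneg measurableT fi.
under eq_integral do rewrite gee0_abs ?funeneg_ge0//.
move=> /(int _ mn (funeneg_ge0 _)) in_.
have E x : ((EFin \o f)^\+ x * (normal_pdf m s x)%:E
    - (EFin \o f)^\- x * (normal_pdf m s x)%:E = (f x * normal_pdf m s x)%:E)%E.
  rewrite EFinM -muleBl//.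
    by congr (_ * _)%E; rewrite -[RHS]/((EFin \o f) x) [in RHS](funeposneg (EFin \o f)).
  exact: add_def_funeposneg.
split.
  rewrite [X in _.-integrable _ X](_ : _ = ((fun x =>
    (EFin \o f)^\+ x * (normal_pdf m s x)%:E) \- (fun x =>
    (EFin \o f)^\- x * (normal_pdf m s x)%:E))%E); first exact: integrableB ip in_.
  by apply/funext => x; rewrite /= -E.
rewrite /Rintegral; congr fine; rewrite integralE.
rewrite !ge0_integral_normal_prob// -integralB//.
by apply: eq_integral => x _; exact: E.
Qed.

(** The right-hand density has total mass 1. Taking for [c * l] a minorant of the likelihood ratio,
    obtained from 1 + v <= exp v, gives the first two moments by perturbing the parameters, without
    computing any integral. *)
Lemma normal_prob_le m s m' s' (c : R) (l : R -> R) : 0 <= c ->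
  (normal_prob m s).-integrable setT (EFin \o l) ->
  (forall x, c * (l x * normal_pdf m s x) <= normal_pdf m' s' x) ->
  c * \int[normal_prob m s]_x l x <= 1.
Proof.
move=> c0 il lp; have [i1 ->] := integral_normal_prob il.
rewrite -RintegralZl//; apply: (@le_trans _ _ (\int[mu]_x normal_pdf m' s' x)).
  apply: le_Rintegral => //; last exact: integrable_normal_pdf.
  exact: integrableZl i1.
by rewrite /Rintegral integral_normal_pdf.
Qed.

Variable s : R.
Hypothesis s0 : 0 < s.
Local Notation nu := (normal_prob 0 s).

Let pdfE m' s' x : s' != 0 -> normal_pdf m' s' x =
  normal_peak s' * expR (- ((x - m') ^+ 2 / (s' ^+ 2 *+ 2))).
Proof. by move=> h; rewrite normal_pdfE// /normal_fun mulNr. Qed.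

Let peakE (k : R) : 0 < k -> normal_peak (k * s) = k^-1 * normal_peak s.
Proof.
move=> k0; rewrite /normal_peak.
have -> : (k * s) ^+ 2 * pi *+ 2 = k ^+ 2 * (s ^+ 2 * pi *+ 2).
  by rewrite exprMn -(mulrA (k ^+ 2)) mulrnAr.
by rewrite sqrtrM ?sqr_ge0// sqrtr_sqr gtr0_norm// invfM.
Qed.

Lemma normal_moment4 : (\int[nu]_x (x ^+ 4)%:E <= (64 * s ^+ 4)%:E)%E.
Proof.
have x4 (x : R) : 0 <= x ^+ 4 by rewrite -[4%N]/(2 * 2)%N exprM sqr_ge0.
have q0 : 0 < Num.sqrt 2 :> R by rewrite sqrtr_gt0.
have ss0 : Num.sqrt 2 * s != 0 by rewrite mulf_neq0// gt_eqF.
(* Put u = x^2 / (4 s^2). One factor exp(-u) of the density goes into the normal density of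
   deviation sqrt 2 * s, the other absorbs u^2. The constant is 64 = 16 * 2 * 2, from x^4 = 16 s^4
   u^2, u^2 exp(-u) <= 2 and sqrt 2 <= 2. *)
have key (x : R) : x ^+ 4 * normal_pdf 0 s x <=
    64 * s ^+ 4 * normal_pdf 0 (Num.sqrt 2 * s) x.
  rewrite !pdfE ?gt_eqF// ?mulr_gt0// subr0 peakE//.
  set u := x ^+ 2 / (4 * s ^+ 2).
  have u0 : 0 <= u by rewrite divr_ge0 ?sqr_ge0// mulr_ge0// sqr_ge0.
  have -> : x ^+ 2 / (s ^+ 2 *+ 2) = u + u.
    by rewrite /u -mulr_natr; field; rewrite gt_eqF.
  have -> : x ^+ 2 / ((Num.sqrt 2 * s) ^+ 2 *+ 2) = u.
    rewrite exprMn sqr_sqrtr// /u -mulr_natr; congr (_ / _); ring.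
  have -> : x ^+ 4 = 16 * s ^+ 4 * u ^+ 2.
    by rewrite /u; field; rewrite gt_eqF.
  rewrite opprD expRD.
  have h1 : u ^+ 2 * expR (- u) <= 2.
    rewrite expRN ler_pdivrMr ?expR_gt0//.
    have := expR_ge1Dxn 1 u0; rewrite (_ : (1.+1)`! = 2%N)//; lra.
  have q2 : 2^-1 <= (Num.sqrt 2 : R)^-1.
    rewrite lef_pV2 ?posrE// -[leRHS](ger0_norm (ler0n _ 2)) -sqrtr_sqr ler_wsqrtr//.
    lra.
  have e0 : 0 <= expR (- u) by exact: expR_ge0.
  have p0 : 0 <= normal_peak s by exact: normal_peak_ge0.
  have s4 : 0 <= s ^+ 4 by exact: x4.
  apply: (@le_trans _ _ (32 * (s ^+ 4 * normal_peak s * expR (- u)))).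
    rewrite [leLHS](_ : _ = 16 * (s ^+ 4 * normal_peak s * expR (- u)) * (u ^+ 2 * expR (- u))).
      rewrite (_ : 32 * _ = 16 * (s ^+ 4 * normal_peak s * expR (- u)) * 2); last by ring.
      by rewrite ler_wpM2l// (mulr_ge0 _ (mulr_ge0 (mulr_ge0 s4 p0) e0)).
    ring.
  rewrite [leRHS](_ : _ = 64 * (s ^+ 4 * normal_peak s * expR (- u)) * (Num.sqrt 2)^-1).
    rewrite (_ : 32 * _ = 64 * (s ^+ 4 * normal_peak s * expR (- u)) * 2^-1).
      by rewrite ler_wpM2l// (mulr_ge0 _ (mulr_ge0 (mulr_ge0 s4 p0) e0)).
    by field.
  ring.
rewrite ge0_integral_normal_prob; last 2 first.
- by move=> x; rewrite lee_fin.
- by apply/measurable_EFinP; exact: measurable_funX.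
apply: (@le_trans _ _ (\int[mu]_x ((64 * s ^+ 4)%:E *
    (normal_pdf 0 (Num.sqrt 2 * s) x)%:E))%E).
  apply: ge0_le_integral => //.
  - by move=> x _; rewrite -EFinM lee_fin mulr_ge0// normal_pdf_ge0.
  - apply: emeasurable_funM; last exact: mpdf.
    by apply/measurable_EFinP; exact: measurable_funX.
  - by apply: emeasurable_funM => //; exact: mpdf.
  by move=> x _; rewrite -!EFinM lee_fin.
rewrite ge0_integralZl//.
- by rewrite integral_normal_pdf mule1.
- exact: mpdf.
- by move=> x _; rewrite lee_fin normal_pdf_ge0.
- by rewrite lee_fin mulr_ge0// -[4%N]/(2 * 2)%N exprM sqr_ge0.
Qed.

Let integrable_poly4 (f : R -> R) (C : R) : measurable_fun setT f ->
  (forall x, `|f x| <= C * (1 + x ^+ 4)) -> nu.-integrable setT (EFin \o f).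
Proof.
move=> mf fC; have x4 (x : R) : 0 <= x ^+ 4.
  by rewrite -[4%N]/(2 * 2)%N exprM sqr_ge0.
have i1 : nu.-integrable setT (EFin \o (fun=> 1 : R)).
  exact: finite_measure_integrable_cst.
have i4 : nu.-integrable setT (EFin \o (fun x : R => x ^+ 4)).
  apply/integrableP; split; first by apply/measurable_EFinP; exact: measurable_funX.
  under eq_integral do rewrite /= ger0_norm//.
  by rewrite (le_lt_trans normal_moment4)// ltry.
have i : nu.-integrable setT (EFin \o (fun x : R => C * (1 + x ^+ 4))).
  exact: integrableZl (integrableD measurableT i1 i4).
apply: le_integrable i => //; first exact/measurable_EFinP.
by move=> x _ /=; rewrite lee_fin (le_trans (fC x))// ler_norm.
Qed.

Lemma normal_integrable : nu.-integrable setT (EFin \o (fun x : R => x)).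
Proof.
apply: (@integrable_poly4 _ 1) => // x; rewrite mul1r.
have := sqr_ge0 (x ^+ 2 - 1); have := sqr_ge0 (x - 1); have := sqr_ge0 (x + 1).
have := sqr_ge0 (x ^+ 2).
by rewrite ler_norml -[4%N]/(2 * 2)%N exprM; nra.
Qed.

Lemma normal_integrable2 : nu.-integrable setT (EFin \o (fun x : R => x ^+ 2)).
Proof.
apply: (@integrable_poly4 _ 1) => [|x]; first exact: measurable_funX.
rewrite mul1r ger0_norm ?sqr_ge0//.
have := sqr_ge0 (x ^+ 2 - 1); have := sqr_ge0 (x ^+ 2).
by rewrite -[4%N]/(2 * 2)%N exprM; nra.
Qed.

(* Shifting the mean multiplies the density by exp((m x - m^2 / 2) / s^2); the
   bound exp u >= 1 + u then squeezes m E X between 0 and m^2 / 2. *)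
Lemma normal_mean : \int[nu]_x x = 0.
Proof.
set E := \int[nu]_x x.
have key m : m * E <= m ^+ 2.
  pose l x : R := 1 + (m / s ^+ 2 * x - m ^+ 2 / (2 * s ^+ 2)).
  have i0 : nu.-integrable setT (EFin \o (fun=> m ^+ 2 / (2 * s ^+ 2))).
    exact: finite_measure_integrable_cst.
  have i1 : nu.-integrable setT (EFin \o (fun=> 1 : R)).
    exact: finite_measure_integrable_cst.
  have i2 : nu.-integrable setT (EFin \o (fun x : R => m / s ^+ 2 * x)).
    exact: integrableZl normal_integrable.
  have i3 : nu.-integrable setT
      (EFin \o (fun x : R => m / s ^+ 2 * x - m ^+ 2 / (2 * s ^+ 2))).
    exact: integrableB i2 i0.
  have il : nu.-integrable setT (EFin \o l) by exact: integrableD i1 i3.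
  have := @normal_prob_le 0 s m s 1 l ler01 il.
  rewrite mul1r RintegralD// RintegralB// RintegralZl//; last exact: normal_integrable.
  rewrite !Rintegral_probability_cst -/E => h.
  have {}h : 1 + (m / s ^+ 2 * E - m ^+ 2 / (2 * s ^+ 2)) <= 1.
    apply: h => x; rewrite mul1r !pdfE ?gt_eqF// subr0 mulrCA ler_wpM2l ?normal_peak_ge0//.
    have -> : (x - m) ^+ 2 / (s ^+ 2 *+ 2) =
        x ^+ 2 / (s ^+ 2 *+ 2) - (m / s ^+ 2 * x - m ^+ 2 / (2 * s ^+ 2)).
      by rewrite -mulr_natr; field; rewrite gt_eqF.
    rewrite opprB expRD ler_wpM2r ?expR_ge0//.
    exact: expR_ge1Dx.
  have : m * E - m ^+ 2 / 2 <= 0.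
    have s2 : 0 < s ^+ 2 by rewrite exprn_gt0.
    rewrite (_ : _ - _ = s ^+ 2 * (m / s ^+ 2 * E - m ^+ 2 / (2 * s ^+ 2))).
      by rewrite pmulr_rle0//; lra.
    by field; rewrite gt_eqF.
  by have := sqr_ge0 m; lra.
(* At m = E / 2 the bound reads E^2 / 2 <= E^2 / 4, which forces E = 0. *)
have := key (E / 2); have := key (- E / 2).
have := sqr_ge0 E; nra.
Qed.

(* Changing the deviation from s to k s multiplies the density by
   k^-1 exp(x^2 (1 - k^-2) / (2 s^2)); let k tend to 1 from both sides. *)
Lemma normal_second_moment : \int[nu]_x x ^+ 2 = s ^+ 2.
Proof.
set M := \int[nu]_x _.
have s2 : 0 < s ^+ 2 by rewrite exprn_gt0.
have key (k : R) : 0 < k -> (1 - k ^- 2) * (M / s ^+ 2) <= 2 * (k - 1).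
  move=> k0; pose b := (1 - k ^- 2) / (2 * s ^+ 2).
  pose l x : R := 1 + b * x ^+ 2.
  have i1 : nu.-integrable setT (EFin \o (fun=> 1 : R)).
    exact: finite_measure_integrable_cst.
  have i2 : nu.-integrable setT (EFin \o (fun x : R => b * x ^+ 2)).
    exact: integrableZl normal_integrable2.
  have il : nu.-integrable setT (EFin \o l) by exact: integrableD i1 i2.
  have := @normal_prob_le 0 s 0 (k * s) k^-1 l _ il.
  rewrite RintegralD// RintegralZl//; last exact: normal_integrable2.
  rewrite Rintegral_probability_cst -/M => h.
  have {}h : k^-1 * (1 + b * M) <= 1.
    apply: h => [|x]; first by rewrite invr_ge0 ltW.
    rewrite !pdfE ?gt_eqF// ?mulr_gt0// subr0 peakE// -[leRHS]mulrA ler_wpM2l ?invr_ge0 ?(ltW k0)//.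
    rewrite mulrCA ler_wpM2l ?normal_peak_ge0//.
    have -> : x ^+ 2 / ((k * s) ^+ 2 *+ 2) = x ^+ 2 / (s ^+ 2 *+ 2) - b * x ^+ 2.
      by rewrite /b -mulr_natr; field; rewrite !gt_eqF.
    by rewrite opprB expRD ler_wpM2r ?expR_ge0// expR_ge1Dx.
  move: h; rewrite ler_pdivrMl// mulr1 /b.
  rewrite (_ : _ / _ * M = 2^-1 * ((1 - k ^- 2) * (M / s ^+ 2))); first lra.
  by field; rewrite !gt_eqF.
set q := M / s ^+ 2 in key.
suff : q = 1 by move/(congr1 ( *%R^~ (s ^+ 2))); rewrite /q divfK ?gt_eqF// mul1r.
have key2 (k : R) : 0 < k -> (k ^+ 2 - 1) * q <= 2 * k ^+ 2 * (k - 1).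
  move=> k0; have k2 : 0 < k ^+ 2 by rewrite exprn_gt0.
  rewrite [leLHS](_ : _ = k ^+ 2 * ((1 - k ^- 2) * q)); last by field; rewrite gt_eqF.
  rewrite [leRHS](_ : _ = k ^+ 2 * (2 * (k - 1))); last by ring.
  by rewrite ler_pM2l// key.
have q0 : 0 <= q.
  by apply: divr_ge0; [apply: Rintegral_ge0 => x _; exact: sqr_ge0|exact: ltW].
apply/eqP; rewrite eq_le; apply/andP; split; apply/ler_addgt0Pr => e e0.
- pose t := e / (3 + e).
  have t0 : 0 < t by rewrite divr_gt0//; lra.
  have t1 : t <= 1 by rewrite ler_pdivrMr; lra.
  have t2 : t <= e / 3 by rewrite ler_pM2l// lef_pV2 ?posrE; lra.
  have := key2 (1 + t) ltac:(lra).
  rewrite (_ : _ * q = t * ((2 + t) * q)); last by ring.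
  rewrite [leRHS](_ : _ = t * (2 * (1 + t) ^+ 2)); last by ring.
  by rewrite ler_pM2l//; nra.
- pose t := Num.min (e / 2) 2^-1.
  have t0 : 0 < t by rewrite lt_min; apply/andP; split; lra.
  have t1 : t <= 2^-1 by rewrite ge_min lexx orbT.
  have t2 : t <= e / 2 by rewrite ge_min lexx.
  have := key2 (1 - t) ltac:(lra).
  rewrite (_ : _ * q = - (t * ((2 - t) * q))); last by ring.
  rewrite [leRHS](_ : _ = - (t * (2 * (1 - t) ^+ 2))); last by ring.
  by rewrite lerN2 ler_pM2l//; nra.
Qed.

End normal_moments.

(** * Smoothed indicators of exceedance *)

Section soft_exceedance.
Context {R : realType}.
Implicit Types (C k b x y z t c e : R).

Lemma taylor2_affine C k b (f f1 f2 : R -> R) : 0 <= C -> taylor2 C f f1 f2 ->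
  taylor2 (C * (1 + `|k|) ^+ 3) (fun y => f (k * y + b))
    (fun y => k * f1 (k * y + b)) (fun y => k ^+ 2 * f2 (k * y + b)).
Proof.
move=> C0 [h1 h2 h3 h4].
have k1 : `|k| <= (1 + `|k|) ^+ 3.
  have k0 := normr_ge0 k; have := mulr_ge0 k0 k0.
  by have := mulr_ge0 k0 (mulr_ge0 k0 k0); rewrite !exprS expr0; lra.
have k2 : `|k| ^+ 2 <= (1 + `|k|) ^+ 3.
  have k0 := normr_ge0 k; have := mulr_ge0 k0 k0.
  by have := mulr_ge0 k0 (mulr_ge0 k0 k0); rewrite !exprS expr0; lra.
have k3 : `|k| ^+ 3 <= (1 + `|k|) ^+ 3.
  have k0 := normr_ge0 k; have := mulr_ge0 k0 k0.
  by have := mulr_ge0 k0 (mulr_ge0 k0 k0); rewrite !exprS expr0; lra.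
have cubM z : cub (k * z) <= (1 + `|k|) ^+ 3 * cub z.
  rewrite /cub minr_pMr ?exprn_ge0 ?addr_ge0// le_min !ge_min; apply/andP; split.
    by rewrite exprMn -(real_normK (num_real k)) ler_wpM2r// sqr_ge0.
  by apply/orP; right; rewrite normrM exprMn ler_wpM2r// exprn_ge0.
have shift y z : k * (y + z) + b = (k * y + b) + k * z by ring.
split => [y|y|y z|y z].
- by rewrite normrM mulrC ler_pM.
- by rewrite normrM mulrC ler_pM// normrX.
- by rewrite shift (le_trans (h3 _ _))// normrM mulrA ler_wpM2r// ler_wpM2l.
- rewrite shift.
  have -> : k * f1 (k * y + b) * z = f1 (k * y + b) * (k * z) by ring.
  have -> : k ^+ 2 * f2 (k * y + b) * z ^+ 2 = f2 (k * y + b) * (k * z) ^+ 2 by ring.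
  by rewrite (le_trans (h4 _ _))// -mulrA ler_wpM2l.
Qed.

Lemma taylor2D C C' (f f1 f2 g g1 g2 : R -> R) :
  taylor2 C f f1 f2 -> taylor2 C' g g1 g2 ->
  taylor2 (C + C') (fun y => f y + g y) (fun y => f1 y + g1 y) (fun y => f2 y + g2 y).
Proof.
move=> [f1C f2C f3C f4C] [g1C g2C g3C g4C]; split => [y|y|y z|y z].
- by rewrite (le_trans (ler_normD _ _))// lerD.
- by rewrite (le_trans (ler_normD _ _))// lerD.
- rewrite opprD addrACA mulrDl (le_trans (ler_normD _ _))// lerD//.
- have -> : f (y + z) + g (y + z) - (f y + g y) - (f1 y + g1 y) * z
      - (f2 y + g2 y) * z ^+ 2 =
    (f (y + z) - f y - f1 y * z - f2 y * z ^+ 2)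
    + (g (y + z) - g y - g1 y * z - g2 y * z ^+ 2) by ring.
  by rewrite mulrDl (le_trans (ler_normD _ _))// lerD.
Qed.

(* A smooth version of the indicator of |x| >= t, with the transition displaced
   by c units of e: it dominates the indicator of |x| >= t - e for c = 2, and is
   dominated by the indicator of |x| >= t + e for c = -1. *)
Definition soft c e t x : R :=
  step (e^-1 * x + (c - t / e)) + step (- e^-1 * x + (c - t / e)).
Definition soft1 c e t x : R :=
  e^-1 * step1 (e^-1 * x + (c - t / e))
  + - e^-1 * step1 (- e^-1 * x + (c - t / e)).
Definition soft2 c e t x : R :=
  e^-1 ^+ 2 * step2 (e^-1 * x + (c - t / e))
  + (- e^-1) ^+ 2 * step2 (- e^-1 * x + (c - t / e)).
Definition soft_cst e : R :=
  100 * (1 + `|e^-1|) ^+ 3 + 100 * (1 + `|- e^-1|) ^+ 3.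

Lemma soft_cst_ge0 e : 0 <= soft_cst e.
Proof. by rewrite addr_ge0// mulr_ge0// exprn_ge0// addr_ge0. Qed.

Lemma taylor2_soft c e t : taylor2 (soft_cst e) (soft c e t) (soft1 c e t) (soft2 c e t).
Proof.
by apply: taylor2D; apply: taylor2_affine => //; exact: taylor2_step.
Qed.

Let maff k b : measurable_fun setT (fun x : R => k * x + b).
Proof. by apply: measurable_funD => //; exact: measurable_funM. Qed.

Lemma measurable_soft c e t : measurable_fun setT (soft c e t).
Proof.
by apply: measurable_funD; apply: measurableT_comp => //; exact: measurable_step.
Qed.

Lemma measurable_soft1 c e t : measurable_fun setT (soft1 c e t).
Proof.
by apply: measurable_funD; apply: measurable_funM => //;
  apply: measurableT_comp => //; exact: measurable_step1.
Qed.

Lemma measurable_soft2 c e t : measurable_fun setT (soft2 c e t).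
Proof.
by apply: measurable_funD; apply: measurable_funM => //;
  apply: measurableT_comp => //; exact: measurable_step2.
Qed.

Lemma soft_ge0 c e t x : 0 <= soft c e t x.
Proof. by rewrite addr_ge0// step_ge0. Qed.

Lemma soft_le2 c e t x : soft c e t x <= 2.
Proof. by rewrite -[2]/(1 + 1) lerD// step_le1. Qed.

Lemma soft2_ge1 e t x : 0 < e -> t - e <= `|x| -> 1 <= soft 2 e t x.
Proof.
move=> e0 h; have i0 : 0 < e^-1 by rewrite invr_gt0.
have key u : t - e <= u -> 1 <= e^-1 * u + (2 - t / e).
  move=> tu; have : e^-1 * (t - e) <= e^-1 * u by rewrite ler_pM2l.
  by rewrite mulrBr mulVf ?gt_eqF// [e^-1 * t]mulrC; lra.
rewrite /soft; case: (ler0P x) h => x0 h.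
- rewrite [X in _ + X]step_ge1; first by rewrite lerDr step_ge0.
  by rewrite mulNr -mulrN key.
- by rewrite [X in X + _]step_ge1 ?key// lerDl step_ge0.
Qed.

Lemma softN1_eq0 e t x : 0 < e -> `|x| < t + e -> soft (-1) e t x = 0.
Proof.
move=> e0; have i0 : 0 < e^-1 by rewrite invr_gt0.
have key u : u <= t + e -> e^-1 * u + (-1 - t / e) <= 0.
  move=> tu; have : e^-1 * u <= e^-1 * (t + e) by rewrite ler_pM2l.
  by rewrite mulrDr mulVf ?gt_eqF// [e^-1 * t]mulrC; lra.
rewrite ltr_norml => /andP[h1 h2].
by rewrite /soft !step_le0 ?addr0// ?key//; [rewrite mulNr -mulrN key//; lra|lra].
Qed.

Lemma softN1_le1 e t x : 0 < e -> 0 <= t -> soft (-1) e t x <= 1.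
Proof.
move=> e0 t0; have i0 : 0 < e^-1 by rewrite invr_gt0.
have te : 0 <= t / e by rewrite divr_ge0// ltW.
rewrite /soft; case: (lerP 0 x) => x0.
- rewrite [X in _ + X]step_le0 ?addr0 ?step_le1//.
  by have : 0 <= e^-1 * x by [rewrite mulr_ge0// ltW]; rewrite mulNr; lra.
- rewrite [X in X + _]step_le0 ?add0r ?step_le1//.
  by have : e^-1 * x <= 0 by [rewrite pmulr_rle0// ltW]; lra.
Qed.

Lemma soft_small c e t x : 0 < e -> `|x| <= t - c * e -> soft c e t x = 0.
Proof.
move=> e0; have i0 : 0 < e^-1 by rewrite invr_gt0.
have key u : u <= t - c * e -> e^-1 * u + (c - t / e) <= 0.
  move=> tu; have : e^-1 * u <= e^-1 * (t - c * e) by rewrite ler_pM2l.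
  rewrite mulrBr [e^-1 * (c * e)]mulrCA mulVf ?gt_eqF// [e^-1 * t]mulrC; lra.
rewrite ler_norml => /andP[h1 h2].
by rewrite /soft !step_le0 ?addr0// ?key//; rewrite mulNr -mulrN key//; lra.
Qed.

(** The condition c * e <= t keeps the step of the opposite sign at 0, so that the two steps do not
    add up to 2. *)
Lemma soft_large c e t x : 0 < e -> t + (1 - c) * e <= `|x| -> c * e <= t ->
  soft c e t x = 1.
Proof.
move=> e0 h ct; have i0 : 0 < e^-1 by rewrite invr_gt0.
have cte : c <= t / e by rewrite ler_pdivlMr.
have key u : t + (1 - c) * e <= u -> 1 <= e^-1 * u + (c - t / e).
  move=> tu; have : e^-1 * (t + (1 - c) * e) <= e^-1 * u by rewrite ler_pM2l.
  rewrite mulrDr [e^-1 * ((1 - c) * e)]mulrCA mulVf ?gt_eqF// [e^-1 * t]mulrC; lra.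
rewrite /soft; case: (ler0P x) h => x0 h.
- rewrite [X in _ + X]step_ge1; last by rewrite mulNr -mulrN key.
  rewrite [X in X + _]step_le0 ?add0r//.
  by have : e^-1 * x <= 0 by [rewrite pmulr_rle0]; lra.
- rewrite [X in X + _]step_ge1 ?key// [X in _ + X]step_le0 ?addr0//.
  by have : 0 <= e^-1 * x by [rewrite mulr_ge0// ltW]; rewrite mulNr; lra.
Qed.

Lemma continuous_soft c e (x : R -> R) t : {for t, continuous x} ->
  {for t, continuous (fun t => soft c e t (x t))}.
Proof.
move=> cx; have ct : {for t, continuous (fun t : R => c - t / e)}.
  by apply: cvgB; [exact: cvg_cst|apply: cvgMl; exact: cvg_id].
apply: cvgD.
  apply: (continuous_comp (f := fun t => e^-1 * x t + (c - t / e)) (g := step));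
    last exact: continuous_step.
  by apply: cvgD => //; apply: cvgMr.
apply: (continuous_comp (f := fun t => - e^-1 * x t + (c - t / e)) (g := step));
  last exact: continuous_step.
by apply: cvgD => //; apply: cvgMr.
Qed.

End soft_exceedance.

Section law.
Context {R : realType} {d : measure_display} {T : measurableType d}.
Variables (P : probability T R) (X : T -> R) (nu : probability (measurableTypeR R) R).
Hypotheses (mX : measurable_fun setT X)
  (Xnu : forall B, measurable B -> P (X @^-1` B) = nu B).

Let rX : {mfun T >-> measurableTypeR R} :=
  HB.pack (X : T -> measurableTypeR R) (isMeasurableFun.Build _ _ T (measurableTypeR R) X mX).

Lemma ge0_integral_law (f : R -> \bar R) : measurable_fun setT f ->
  (forall x, 0 <= f x)%E -> (\int[P]_w f (X w) = \int[nu]_x f x)%E.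
Proof.
move=> mf f0; rewrite -(ge0_integral_distribution rX mf f0).
by apply: eq_measure_integral => A mA _; exact: Xnu.
Qed.

Lemma integrable_law (f : R -> R) : nu.-integrable setT (EFin \o f) ->
  P.-integrable setT (EFin \o (f \o X)) /\ \int[P]_w f (X w) = \int[nu]_x f x.
Proof.
move=> fi; have mf := measurable_int _ fi.
have fX : P.-integrable setT (EFin \o (f \o X)).
  apply/integrableP; split; first exact: (measurableT_comp mf mX).
  have [_] := integrableP _ _ _ fi; congr (_ < _)%E.
  rewrite -(@ge0_integral_law (fun x => `|(EFin \o f) x|)%E)//.
  exact: measurableT_comp.
split=> //; rewrite /Rintegral; congr fine.
rewrite -(integral_distribution (X := rX) mf)//.
by apply: eq_measure_integral => A mA _; exact: Xnu.
Qed.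

End law.

(** * Normalized increments of Brownian motion on a grid *)

Section brownian_grid.
Context {R : realType} {d : measure_display} {T : measurableType d}.
Variables (P : probability T R) (W : R -> {RV P >-> R}).
Hypothesis bm : standard_brownian_motion P W.
Variable eta : R.
Hypothesis eta0 : 0 < eta.

Definition increment (i : nat) (w : T) : R :=
  (W (eta ^+ 2 * i.+1%:R) w - W (eta ^+ 2 * i%:R) w) / eta.

Let h0 : 0 < eta ^+ 2. Proof. by rewrite exprn_gt0. Qed.

Lemma measurable_increment i : measurable_fun setT (increment i).
Proof. by apply: measurable_funM => //; exact: measurable_funB. Qed.

Lemma psum_increment n w : eta * psum (increment^~ w) n = W (eta ^+ 2 * n%:R) w.
Proof.
have [W0 _ _ _] := bm.
elim: n => [|n ih]; first by rewrite /psum big_ord0 !mulr0 W0.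
rewrite /psum big_ord_recr/= mulrDr -/(psum (increment^~ w) n) ih /increment.
by rewrite mulrCA divff ?gt_eqF// mulr1 addrC subrK.
Qed.

Lemma increment_indep : mutually_independent P increment.
Proof.
have [_ Wind _ _] := bm => J B mB.
(* Brownian motion comes with independence of increments indexed by some 'I_n; a finite set of
   natural numbers lies below its maximum plus one. *)
pose n := (\max_(i <- J) i).+1.
have Jn i : i \in J -> (i < n)%N by move=> iJ; rewrite ltnS; exact: leq_bigmax_seq.
pose t (j : nat) := eta ^+ 2 * j%:R.
have t0 : 0 <= t 0%N by rewrite /t mulr0.
have tmono : {homo t : i j / (i <= j)%N >-> i <= j}.
  by move=> i j ij; rewrite ler_pM2l// ler_nat.
pose J' := [fset i : 'I_n | (i : nat) \in J]%fset.
pose B' (i : 'I_n) := (fun x : R => x / eta) @^-1` B i.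
have mB' i : measurable (B' i).
  by rewrite -[X in measurable X]setTI; apply: (measurable_funM (f := id)).
have := Wind n t t0 tmono J' B' mB'.
have -> : \bigcap_(i in [set` J']) ((fun w => W (t i.+1) w - W (t i) w) @^-1` B' i) =
    \bigcap_(i in [set` J]) (increment i @^-1` B i).
  apply/seteqP; split => w /= h i /= iJ.
    by have := h (Ordinal (Jn _ iJ)); apply; rewrite /= !inE.
  by move: iJ; rewrite /= !inE => /= iJ; exact: h.
move=> ->.
have -> : (\prod_(i <- J) P (increment i @^-1` B i) =
    \prod_(i <- map val J') P (increment i @^-1` B i))%E.
  apply: perm_big; apply: uniq_perm.
  - exact: fset_uniq.
  - by rewrite map_inj_uniq ?fset_uniq//; exact: val_inj.
  move=> i; apply/idP/mapP => [iJ|[j]].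
    by exists (Ordinal (Jn _ iJ)) => //; rewrite !inE.
  by rewrite !inE => jJ ->.
by rewrite big_map.
Qed.

Let N : probability (measurableTypeR R) R := normal_prob 0 eta.

Let law i (B : set R) : measurable B ->
  P ((fun w => eta * increment i w) @^-1` B) = N B.
Proof.
have [_ _ Wlaw _] := bm => mB.
have -> : N B =
    normal_prob 0 (Num.sqrt (eta ^+ 2 * i.+1%:R - eta ^+ 2 * i%:R)) B.
  by rewrite -mulrBr -natr1 [_%:R + 1]addrC addrK mulr1 sqrtr_sqr gtr0_norm.
rewrite -Wlaw//.
- congr (P _); apply/seteqP; split => w /=;
  by rewrite /increment mulrCA divff ?gt_eqF// mulr1.
- by rewrite mulr_ge0// ltW.
- by rewrite ltr_pM2l// ltr_nat.
Qed.

Let meinc i : measurable_fun setT (fun w => eta * increment i w).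
Proof. by apply: measurable_funM => //; exact: measurable_increment. Qed.

Let sqK (y : R) : eta ^- 2 * (eta * y) ^+ 2 = y ^+ 2.
Proof. by field; rewrite gt_eqF. Qed.

Lemma increment_integrable i : P.-integrable setT (EFin \o increment i).
Proof.
have [h _] := integrable_law (nu := N) (meinc i) (@law i) (normal_integrable eta0).
rewrite [X in _.-integrable _ X](_ : _ =
    EFin \o (fun w => eta^-1 * (eta * increment i w))).
  exact: integrableZl h.
by apply/funext => w /=; rewrite mulKf ?gt_eqF.
Qed.

Lemma increment_integrable2 i :
  P.-integrable setT (EFin \o (fun w => increment i w ^+ 2)).
Proof.
have [h _] := integrable_law (nu := N) (meinc i) (@law i) (normal_integrable2 eta0).
rewrite [X in _.-integrable _ X](_ : _ =
    EFin \o (fun w => eta ^- 2 * (eta * increment i w) ^+ 2)).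
  exact: integrableZl h.
by apply/funext => w /=; rewrite sqK.
Qed.

Lemma increment_mean i : \int[P]_w increment i w = 0.
Proof.
have [h e] := integrable_law (nu := N) (meinc i) (@law i) (normal_integrable eta0).
have -> : increment i = fun w => eta^-1 * (eta * increment i w).
  by apply/funext => w /=; rewrite mulKf ?gt_eqF.
by rewrite RintegralZl// e normal_mean// mulr0.
Qed.

Lemma increment_second_moment i : \int[P]_w increment i w ^+ 2 = 1.
Proof.
have [h e] := integrable_law (nu := N) (meinc i) (@law i) (normal_integrable2 eta0).
under eq_Rintegral => w _.
  rewrite (_ : _ ^+ 2 = eta ^- 2 * (eta * increment i w) ^+ 2).
    over.
  by rewrite sqK.
by rewrite RintegralZl// e normal_second_moment// mulVf ?gt_eqF.
Qed.

(* |x|^3 <= (eta x^2 + x^4 / eta) / 2, with fourth moment at most 64 eta^4 *)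
Lemma increment_cub i : \int[P]_w cub (eta * increment i w) <= 33 * eta ^+ 3.
Proof.
have x4 (x : R) : 0 <= x ^+ 4 by rewrite -[4%N]/(2 * 2)%N exprM sqr_ge0.
have m4 := normal_moment4 eta0.
have i4 : N.-integrable setT (EFin \o (fun x : R => x ^+ 4)).
  apply/integrableP; split; first by apply/measurable_EFinP; exact: measurable_funX.
  under eq_integral do rewrite /= ger0_norm//.
  by rewrite (le_lt_trans m4)// ltry.
have i2 : N.-integrable setT (EFin \o (fun x : R => x ^+ 2)).
  exact: normal_integrable2 eta0.
have im : N.-integrable setT
    (EFin \o (fun x : R => eta / 2 * x ^+ 2 + (2 * eta)^-1 * x ^+ 4)).
  exact: (integrableD measurableT (integrableZl measurableT _ i2)
    (integrableZl measurableT _ i4)).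
have cub_le (x : R) : cub x <= eta / 2 * x ^+ 2 + (2 * eta)^-1 * x ^+ 4.
  apply: (le_trans (cub_le3 x)); rewrite -(real_normK (num_real x)).
  rewrite -[4%N]/(2 * 2)%N exprM -(real_normK (num_real x)) -subr_ge0.
  have -> : eta / 2 * `|x| ^+ 2 + (2 * eta)^-1 * (`|x| ^+ 2) ^+ 2 - `|x| ^+ 3 =
    (2 * eta)^-1 * (`|x| * (eta - `|x|)) ^+ 2 by field; rewrite gt_eqF.
  by rewrite mulr_ge0 ?sqr_ge0// invr_ge0 mulr_ge0// ltW.
have ic : N.-integrable setT (EFin \o (fun x : R => cub x)).
  apply: le_integrable im => //.
    apply/measurable_EFinP; apply: measurable_minr; apply: measurable_funX => //.
  move=> x _ /=; rewrite lee_fin ger0_norm ?cub_ge0// (le_trans (cub_le x))//.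
  exact: ler_norm.
have [_ ->] := integrable_law (nu := N) (meinc i) (@law i) ic.
apply: (@le_trans _ _ (\int[N]_x (eta / 2 * x ^+ 2 + (2 * eta)^-1 * x ^+ 4))).
  by apply: le_Rintegral => // x _; exact: cub_le.
rewrite RintegralD//; last 2 first.
- exact: integrableZl i2.
- exact: integrableZl i4.
rewrite !RintegralZl// normal_second_moment//.
have m4' : \int[N]_x x ^+ 4 <= 64 * eta ^+ 4.
  by rewrite -lee_fin /Rintegral fineK// (integrable_fin_num _ i4).
have h : (2 * eta)^-1 * \int[N]_x x ^+ 4 <= (2 * eta)^-1 * (64 * eta ^+ 4).
  by rewrite ler_wpM2l// invr_ge0 mulr_ge0// ltW.
apply: (le_trans (lerD (lexx _) h)).
have -> : (2 * eta)^-1 * (64 * eta ^+ 4) = 32 * eta ^+ 3 by field; rewrite gt_eqF.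
have : 0 < eta ^+ 3 by rewrite exprn_gt0.
have -> : eta / 2 * eta ^+ 2 = eta ^+ 3 / 2 by ring.
lra.
Qed.

End brownian_grid.

(** * Exceedance times of a Brownian path *)

Section brownian_occupation.
Context {R : realType} {d : measure_display} {T : measurableType d}.
Variables (P : probability T R) (W : R -> {RV P >-> R}).
Hypothesis bm : standard_brownian_motion P W.
Local Notation mu := (@lebesgue_measure R).

(* W t is arbitrary for t < 0. *)
Definition path t w : R := W (Num.max 0 t) w.

Lemma path_ge0 t w : 0 <= t -> path t w = W t w.
Proof. by move=> t0; rewrite /path max_r. Qed.

Lemma continuous_path w : continuous (path ^~ w).
Proof.
have [_ _ _ /(_ w) cW] := bm; move=> t.
have [cW' cW0] := (continuous_within_itvcyP _ _).1 cW.
apply/cvgrPdist_lt => e e0; case: (ltgtP t 0) => t0.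
- near=> s.
  have s0 : s <= 0 by apply: ltW; near: s; apply: (cvgr_lt t) => //; exact: cvg_id.
  by rewrite /path !max_l ?subrr ?normr0// ltW.
- have ct : {for t, continuous (fun t => W t w)} by apply: cW'; rewrite in_itv/= andbT.
  near=> s.
  have s0 : 0 <= s by apply: ltW; near: s; apply: (cvgr_gt t) => //; exact: cvg_id.
  rewrite !path_ge0// ?ltW//; near: s.
  by move/cvgrPdist_lt : ct; exact.
- rewrite t0; move/cvgrPdist_lt : cW0 => /(_ _ e0)[r /= r0 h].
  near=> s.
  rewrite {1}/path maxxx; case: (leP s 0) => s0.
    by rewrite /path max_l// subrr normr0.
  rewrite path_ge0 ?ltW//; apply: h => //=.
Unshelve. all: by end_near. Qed.

Let grid (n : nat) (t : R) : nat := Num.truncn (n.+1%:R * Num.max 0 t).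

Let grid_preimage n (k : nat) : measurable [set t : measurableTypeR R | grid n t = k].
Proof.
pose f (t : R) := n.+1%:R * Num.max 0 t.
have mf : measurable_fun setT f.
  by apply: measurable_funM => //; exact: measurable_maxr.
have -> : [set t : measurableTypeR R | grid n t = k] =
    f @^-1` [set` `[k%:R, k.+1%:R[].
  apply/seteqP; split => t /=.
    by move=> <-; rewrite in_itv/= truncn_itv// mulr_ge0// le_max lexx.
  by rewrite in_itv/= => /truncn_def.
by rewrite -[X in measurable X]setTI; exact: mf.
Qed.

(** By continuity the path is the limit of its samples on grids of mesh 1 / (n + 1). A sampled path
    is jointly measurable in time and chance, its preimages being countable unions of rectangles. *)
Lemma measurable_path :
  measurable_fun setT (fun z : measurableTypeR R * T => path z.1 z.2).
Proof.
pose V (n : nat) (z : measurableTypeR R * T) : R := W ((grid n z.1)%:R / n.+1%:R) z.2.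
apply: (@measurable_fun_cvg _ _ _ _ V) => [n _ B mB|z _].
  have -> : setT `&` V n @^-1` B = \bigcup_k
      ([set t | grid n t = k] `*` (W (k%:R / n.+1%:R) @^-1` B)).
    apply/seteqP; split => [[t w]|[t w]] /=.
      by move=> [_ h]; exists (grid n t).
    by move=> [k _ [/= <- h]].
  apply: bigcup_measurable => k _; apply: measurableX; first exact: grid_preimage.
  by rewrite -[X in measurable X]setTI; exact: measurable_funP.
have -> : (fun n => V n z) = (path ^~ z.2) \o (fun n => (grid n z.1)%:R / n.+1%:R).
  by apply/funext => n /=; rewrite path_ge0.
have -> : path z.1 z.2 = path (Num.max 0 z.1) z.2.
  by rewrite /path [in RHS]max_r// le_max lexx.
apply: continuous_cvg; first exact: continuous_path.
apply/cvgrPdist_lt => e e0; near=> n.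
have n0 : 0 < n.+1%:R :> R by rewrite ltr0n.
have m0 : 0 <= Num.max 0 z.1 by rewrite le_max lexx.
have /andP[h1 h2] := truncn_itv (mulr_ge0 (ltW n0) m0).
rewrite -/(grid n z.1) in h1 h2.
have g1 : (grid n z.1)%:R / n.+1%:R <= Num.max 0 z.1 by rewrite ler_pdivrMr// mulrC.
rewrite ger0_norm ?subr_ge0//.
have g2 : Num.max 0 z.1 < (grid n z.1)%:R / n.+1%:R + n.+1%:R^-1.
  by rewrite -[X in _ + X]mul1r -mulrDl natr1 ltr_pdivlMr// mulrC.
have ne : n.+1%:R^-1 < e.
  near: n; exact: near_infty_natSinv_lt (PosNum e0).
by move: g2 ne; set a := _ / _; set b := n.+1%:R^-1; set c := Num.max _ _; lra.
Unshelve. all: by end_near. Qed.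

(** The slope [c] of the barrier is 1 in the theorem; slope 1 / 2 provides a dominating function for
    the smoothed indicators. Time 0 is left out, where c * 0 <= |W 0| would hold trivially. *)
Definition exceed_set (b c : R) : set (measurableTypeR R * T) :=
  [set z | [/\ 0 < z.1, b <= z.1 & c * z.1 <= `|path z.1 z.2|]].

Let mfst : measurable_fun setT (fun z : measurableTypeR R * T => z.1 : R).
Proof. exact: measurable_fst. Qed.

Lemma measurable_exceed_set b c : measurable (exceed_set b c).
Proof.
have -> : exceed_set b c = ((fun z => 0 < z.1) @^-1` [set true]) `&`
   (((fun z => b <= z.1) @^-1` [set true]) `&`
    ((fun z => c * z.1 <= `|path z.1 z.2|) @^-1` [set true])).
  by apply/seteqP; split => z /=; [move=> []|move=> [h1 [h2 h3]]].
have mp := measurable_path.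
apply: measurableI; [|apply: measurableI]; rewrite -[X in measurable X]setTI.
- by apply: (measurable_fun_ltr (f := fun=> 0) (g := fun z => z.1)).
- by apply: (measurable_fun_ler (f := fun=> b) (g := fun z => z.1)).
- apply: (measurable_fun_ler (f := fun z => c * z.1) (g := fun z => `|path z.1 z.2|)) => //.
    exact: measurable_funM.
  exact: measurableT_comp.
Qed.

Definition exceed (b c : R) w : set (measurableTypeR R) :=
  [set t | [/\ 0 < t, b <= t & c * t <= `|path t w|]].

Lemma exceedE b c w : exceed b c w = ysection (exceed_set b c) w.
Proof. by apply/seteqP; split => t /=; rewrite /ysection/= ?inE. Qed.

Lemma measurable_exceed b c w : measurable (exceed b c w).
Proof. by rewrite exceedE; apply: measurable_ysection; exact: measurable_exceed_set. Qed.

Lemma measurable_occupation b c :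
  measurable_fun setT (fun w => mu (exceed b c w)).
Proof.
have := measurable_fun_ysection mu (measurable_exceed_set b c).
by apply: eq_measurable_fun => w _ /=; rewrite exceedE.
Qed.

Lemma tonelli_section (A : set (measurableTypeR R * T)) : measurable A ->
  (\int[P]_w mu (ysection A w) = \int[mu]_t P (xsection A t))%E.
Proof.
move=> mA; have := indic_fubini_tonelli mu P mA.
rewrite indic_fubini_tonelli_FE// indic_fubini_tonelli_GE//.
Qed.

Lemma brownian_law t (B : set R) : 0 < t -> measurable B ->
  P (W t @^-1` B) = normal_prob 0 (Num.sqrt t) B.
Proof.
have [W0 _ Wlaw _] := bm => t0 mB.
have := Wlaw 0 t (lexx _) t0 B mB; rewrite subr0 => <-.
by congr (P _); apply/seteqP; split => w /=; rewrite W0 subr0.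
Qed.

(** Markov's inequality with the fourth moment gives 64 / (c^4 t^2), and the bound by 1 takes care
    of small t. The second moment would give only 1 / (c^2 t), which is not integrable at
    infinity. *)
Lemma brownian_exceed_prob c t : 0 < c -> 0 < t ->
  (P [set w | (c * t <= `|W t w|)%R] <= ((1 + 64 / c ^+ 4) / (1 + t ^+ 2))%:E)%E.
Proof.
move=> c0 t0; set B := [set x : R | c * t <= `|x|].
have mB : measurable B.
  have -> : B = (fun x : R => c * t <= `|x|) @^-1` [set true] by [].
  rewrite -[X in measurable X]setTI.
  by apply: (measurable_fun_ler (f := fun=> c * t) (g := fun x : R => `|x|)).
rewrite (brownian_law t0 mB).
have st0 : 0 < Num.sqrt t by rewrite sqrtr_gt0.
have ct0 : 0 < c * t by rewrite mulr_gt0.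
pose N : probability (measurableTypeR R) R := normal_prob 0 (Num.sqrt t).
have le1 : (N B <= 1)%E by exact: probability_le1.
have leK : (((c * t) ^+ 4)%:E * N B <= (64 * t ^+ 2)%:E)%E.
  have := normal_moment4 st0.
  rewrite [X in (_ * X)%:E](_ : _ = t ^+ 2); last first.
    by rewrite -[4%N]/(2 * 2)%N exprM sqr_sqrtr// ltW.
  apply: le_trans.
  rewrite -[N B]mul1e.
  have -> : (1 * N B = \int[N]_x (\1_B x)%:E)%E.
    by rewrite mul1e integral_indic// setIT.
  rewrite -ge0_integralZl//; last 2 first.
  - exact/measurable_EFinP/measurable_indic.
  - by rewrite lee_fin exprn_ge0// ltW.
  apply: ge0_le_integral => //.
  - by move=> x _; rewrite -EFinM lee_fin mulr_ge0// exprn_ge0// ltW.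
  - by apply/measurable_EFinP; apply: measurable_funM.
  - by apply/measurable_EFinP; exact: measurable_funX.
  move=> x _; rewrite -EFinM lee_fin indicE.
  case: (boolP (x \in B)) => [|_]; rewrite ?mulr1 ?mulr0.
    rewrite inE => xB; rewrite -[x ^+ 4](_ : `|x| ^+ 4 = _).
      by rewrite lerXn2r// nnegrE// ltW.
    by rewrite -normrX ger0_norm// -[4%N]/(2 * 2)%N exprM sqr_ge0.
  by rewrite -[4%N]/(2 * 2)%N exprM sqr_ge0.
have Nfin : N B \is a fin_num by rewrite fin_num_measure.
move: le1 leK; rewrite -[normal_prob _ _ B]/(N B) -(fineK Nfin) -EFinM !lee_fin.
set p := fine _ => p1 pK.
rewrite ler_pdivlMr ?ltr_pwDl ?sqr_ge0//.
have t20 : 0 < t ^+ 2 by rewrite exprn_gt0.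
have c40 : 0 < c ^+ 4 by rewrite exprn_gt0.
have : t ^+ 2 * p <= 64 / c ^+ 4.
  rewrite ler_pdivlMr// -(ler_pM2r t20).
  by apply: le_trans pK; rewrite le_eqVlt; apply/orP; left; apply/eqP; ring.
lra.
Qed.

(** By Tonelli's theorem the expectation is the integral over time of the exceedance probabilities,
    which are dominated by a multiple of 1 / (1 + t^2). *)
Lemma occupation_expectation_finite b c : 0 <= b -> 0 < c ->
  (\int[P]_w mu (exceed b c w) < +oo)%E.
Proof.
move=> b0 c0; under eq_integral do rewrite exceedE.
rewrite tonelli_section; last exact: measurable_exceed_set.
set K := 1 + 64 / c ^+ 4.
have K0 : 0 <= K by rewrite addr_ge0// divr_ge0// exprn_ge0// ltW.
have m1 : measurable_fun setT (fun t : measurableTypeR R => (oneDsqr t)^-1).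
  by apply: continuous_measurable_fun; exact: continuous_oneDsqrV.
apply: (@le_lt_trans _ _ (\int[mu]_(t in `[0%R, +oo[) (K%:E * (oneDsqr t)^-1%:E))%E).
  rewrite [leRHS]integral_mkcond; apply: ge0_le_integral => //.
  - by apply: measurable_fun_xsection; exact: measurable_exceed_set.
  - apply/(measurable_restrictT _ _).1 => //.
    apply: measurable_funTS; apply: emeasurable_funM => //.
    exact/measurable_EFinP.
  move=> t _; rewrite patchE mem_setE in_itv/= andbT.
  case: (leP 0 t) => t0; last first.
    rewrite (_ : xsection _ _ = set0) ?measure0//.
    apply/seteqP; split => w //=; rewrite /xsection/= inE => -[/= t0'].
    by move: (lt_trans t0 t0'); rewrite ltxx.
  move: t0; rewrite le_eqVlt => /predU1P[<-|t0].
    rewrite (_ : xsection _ _ = set0) ?measure0//.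
      by rewrite -EFinM lee_fin mulr_ge0// invr_ge0 addr_ge0// sqr_ge0.
    by apply/seteqP; split => w //=; rewrite /xsection/= inE => -[/=]; rewrite ltxx.
  rewrite -EFinM; apply: le_trans (brownian_exceed_prob c0 t0).
  apply: le_measure; rewrite ?inE.
  - by apply: measurable_xsection; exact: measurable_exceed_set.
  - rewrite -[X in measurable X]setTI.
    apply: (measurable_fun_ler (f := fun=> c * t) (g := fun w => `|W t w|)) => //.
    exact: measurableT_comp.
  by move=> w; rewrite /xsection/= inE => -[/= _ _]; rewrite path_ge0// ltW.
rewrite ge0_integralZl//.
- by rewrite integral0y_oneDsqr -EFinM ltry.
- by apply/measurable_EFinP; exact: measurable_funTS.
Qed.

Lemma ae_occupation_finite b c : 0 <= b -> 0 < c ->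
  {ae P, forall w, (mu (exceed b c w) < +oo)%E}.
Proof.
move=> b0 c0.
have i : P.-integrable setT (fun w => mu (exceed b c w)).
  apply/integrableP; split; first exact: measurable_occupation.
  under eq_integral do rewrite gee0_abs//.
  exact: occupation_expectation_finite.
have := integrable_ae measurableT i; apply: filterS => w /(_ Logic.I).
by rewrite ge0_fin_numE.
Qed.

Definition boundary_set : set (measurableTypeR R * T) :=
  [set z | 0 < z.1 /\ `|path z.1 z.2| = z.1].

Lemma measurable_boundary_set : measurable boundary_set.
Proof.
have -> : boundary_set = ((fun z => 0 < z.1) @^-1` [set true]) `&`
    ((fun z => `|path z.1 z.2| == z.1) @^-1` [set true]).
  by apply/seteqP; split => z /= [h1 h2]; split => //; exact/eqP.
have mp := measurable_path.
apply: measurableI; rewrite -[X in measurable X]setTI.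
- by apply: (measurable_fun_ltr (f := fun=> 0) (g := fun z => z.1)).
- apply: (measurable_fun_eqr (f := fun z => `|path z.1 z.2|) (g := fun z => z.1)) => //.
  exact: measurableT_comp.
Qed.

Lemma boundary_setE w :
  ysection boundary_set w = [set t : measurableTypeR R | 0 < t /\ `|path t w| = t].
Proof. by apply/seteqP; split => t /=; rewrite /ysection/= ?inE. Qed.

Lemma measurable_boundary w :
  measurable [set t : measurableTypeR R | 0 < t /\ `|path t w| = t].
Proof. by rewrite -boundary_setE; apply: measurable_ysection; exact: measurable_boundary_set. Qed.

(** By Tonelli's theorem it is enough that for each fixed t > 0 the event W t = t or W t = - t be
    null, and the law of W t has a density. *)
Lemma ae_boundary_null :
  {ae P, forall w, mu [set t : measurableTypeR R | 0 < t /\ `|path t w| = t] = 0%E}.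
Proof.
have mA := measurable_boundary_set.
have m1 : measurable_fun setT (fun w => mu (ysection boundary_set w)).
  exact: measurable_fun_ysection.
have : (\int[P]_w `|mu (ysection boundary_set w)| = 0)%E.
  under eq_integral do rewrite gee0_abs//.
  rewrite tonelli_section//; apply: integral0_eq => t _.
  have [t0|t0] := ltP 0 t; last first.
    rewrite (_ : xsection _ _ = set0) ?measure0//.
    apply/seteqP; split => w //=; rewrite /xsection/= inE => -[/= t0' _].
    by move: (lt_le_trans t0' t0); rewrite ltxx.
  have mB : measurable ([set t] `|` [set - t] : set R) by exact: measurableU.
  rewrite (_ : xsection _ _ = W t @^-1` ([set t] `|` [set - t])).
    rewrite (brownian_law t0 mB).
    have := normal_prob_dominates 0 (Num.sqrt t).
    move/null_content_dominatesP; apply => //.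
    apply/eqP; rewrite eq_le measure_ge0 andbT.
    by rewrite (le_trans (measureU2 _ _ _))//= !lebesgue_measure_set1 adde0.
  apply/seteqP; split => w /=; rewrite /xsection/= inE.
    move=> -[/= _]; rewrite path_ge0 ?ltW//; case: (ler0P (W t w)) => _ h.
      by right; apply/eqP; rewrite -eqr_oppLR; apply/eqP.
    by left.
  move=> h; split => //=; rewrite path_ge0 ?ltW//.
  by case: h => ->; rewrite ?normrN gtr0_norm.
move=> /(ae_eq_integral_abs P measurableT m1); apply: filterS => w.
by move=> /(_ Logic.I); rewrite boundary_setE.
Qed.

End brownian_occupation.

Lemma bounded_cvg_Rintegral {R : realType} {d : measure_display}
    {T : measurableType d} (P : probability T R) (f_ : nat -> T -> R)
    (f : T -> R) (M : R) :
  (forall j, measurable_fun setT (f_ j)) -> measurable_fun setT f ->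
  (forall j w, `|f_ j w| <= M) ->
  {ae P, forall w, f_ j w @[j --> \oo] --> f w} ->
  (\int[P]_w f_ j w) @[j --> \oo] --> \int[P]_w f w.
Proof.
move=> mf_ mf fM cf.
have [] := @dominated_convergence _ _ _ P setT measurableT
  (fun j => EFin \o f_ j) (EFin \o f) (fun=> M%:E).
- by move=> j; apply/measurable_EFinP.
- exact/measurable_EFinP.
- by apply: filterS cf => w cw _; apply: cvg_EFin => //; exact: nearW.
- exact: finite_measure_integrable_cst.
- by apply: aeW => w j _ /=; rewrite lee_fin.
- move=> i _ c; apply: fine_cvg => /=.
  by rewrite /Rintegral fineK//; exact: integrable_fin_num i.
Qed.

(** * Passage to the limit *)

Section riemann_sum.
Context {R : realType}.
Local Notation mu := (@lebesgue_measure R).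
Variables (phi : R -> R) (lo hi : R).
Hypotheses (cphi : continuous phi) (phi0 : forall t, 0 <= phi t)
  (phi2 : forall t, phi t <= 2) (lo0 : 0 <= lo) (hi0 : 0 <= hi).

(** The indices from [first_index] up to, but excluding, [last_index] are those with lo < e^2 n <=
    hi. The strict inequality at [lo] keeps n = 0 out. *)
Definition first_index (lo e : R) : nat := (Num.truncn (lo / e ^+ 2)).+1.
Definition last_index (hi e : R) : nat := (Num.truncn (hi / e ^+ 2)).+1.

Lemma first_indexP e n : 0 < e -> (first_index lo e <= n)%N = (lo < e ^+ 2 * n%:R).
Proof.
move=> e0; have h0 : 0 < e ^+ 2 by rewrite exprn_gt0.
rewrite /first_index Num.Theory.truncn_lt_nat; last by rewrite divr_ge0// ltW.
by rewrite ltr_pdivrMr// mulrC.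
Qed.

Lemma last_indexP e n : 0 < e -> (n < last_index hi e)%N = (e ^+ 2 * n%:R <= hi).
Proof.
move=> e0; have h0 : 0 < e ^+ 2 by rewrite exprn_gt0.
rewrite /last_index ltnS Num.Theory.truncn_ge_nat; last by rewrite divr_ge0// ltW.
by rewrite ler_pdivlMr// mulrC.
Qed.

Variable u : nat -> R.
Hypotheses (u0 : forall j, 0 < u j) (u1 : forall j, u j <= 1)
  (ucvg : u j @[j --> \oo] --> 0).

Let h j := u j ^+ 2.
Let h0 j : 0 < h j. Proof. by rewrite exprn_gt0. Qed.
Let h1 j : h j <= 1. Proof. by rewrite expr_le1// ltW. Qed.
Let hcvg : h j @[j --> \oo] --> 0.
Proof. by rewrite -(mulr0 0); rewrite /h; under eq_fun do rewrite expr2; exact: cvgM. Qed.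

Let cell j n : set (measurableTypeR R) := `[h j * n%:R, h j * n.+1%:R[%classic.
(** A step function whose integral is the Riemann sum, so that convergence of the sums becomes an
    instance of dominated convergence. *)
Let f j (t : R) := \sum_(first_index lo (u j) <= n < last_index hi (u j))
  phi (h j * n%:R) * \1_(cell j n) t.

Let cellP j n t : 0 <= t -> (t \in cell j n) = (n == Num.truncn (t / h j)).
Proof.
move=> t0; rewrite mem_setE in_itv [RHS]eq_sym.
rewrite (Num.Theory.truncn_eq _ (divr_ge0 t0 (ltW (h0 j)))).
by rewrite (ler_pdivlMr _ _ (h0 j)) (ltr_pdivrMr _ _ (h0 j)) ![_%:R * _]mulrC.
Qed.

Let fE j t : f j t = if [&& 0 <= t, lo < h j * (Num.truncn (t / h j))%:R &
   h j * (Num.truncn (t / h j))%:R <= hi] then phi (h j * (Num.truncn (t / h j))%:R) else 0.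
Proof.
rewrite /f; have [t0|t0] /= := leP 0 t; last first.
  rewrite big1// => n _; rewrite indicE memNset ?mulr0// /cell /= in_itv/= => /andP[+ _].
  by rewrite leNgt => /negP; apply; rewrite (lt_le_trans t0)// mulr_ge0// ltW.
set nu := Num.truncn _.
rewrite -first_indexP// -last_indexP//.
under eq_bigr do rewrite indicE cellP//.
case: ifPn => [/andP[a b]|].
  rewrite (@bigD1_seq _ _ _ _ _ nu)/= ?mem_index_iota ?a// ?iota_uniq//.
  by rewrite eqxx mulr1 big1 ?addr0// => n /negPf ->; rewrite mulr0.
rewrite negb_and => hn; rewrite big_nat_cond big1// => n /andP[/andP[a b] _].
case: eqP => [nE|]; last by rewrite mulr0.
by move: hn; rewrite /nu -nE a b.
Qed.

Let trunc_bounds j t : 0 <= t -> t - h j < h j * (Num.truncn (t / h j))%:R <= t.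
Proof.
move=> t0; have := Num.Theory.truncn_itv (divr_ge0 t0 (ltW (h0 j))).
rewrite -natr1 ler_pdivlMr// ltr_pdivrMr// => /andP[a b]; rewrite mulrC a andbT.
by move: b; rewrite mulrDl mul1r; lra.
Qed.

Let f_cvg t : f j t @[j --> \oo] --> phi t * \1_(`]lo, hi]%classic) t.
Proof.
have [tlo|lot] := leP t lo.
  rewrite (_ : (fun j => f j t) = fun=> 0).
    by rewrite indicE memNset/= ?mulr0; [exact: cvg_cst|rewrite in_itv/= ltNge tlo].
  apply/funext => j; rewrite fE; case: (leP 0 t) => //= t0.
  have /andP[_ a] := trunc_bounds j t0.
  by rewrite ltNge (le_trans a).
have t0 : 0 <= t by rewrite ltW// (le_lt_trans lo0).
have [thi|hit] := leP t hi.
  rewrite indicE mem_set/= ?in_itv/= ?lot ?thi// mulr1.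
  have sc : (h j * (Num.truncn (t / h j))%:R) @[j --> \oo] --> t.
    have c1 : (t - h j) @[j --> \oo] --> t.
      by rewrite -[X in _ --> X]subr0; apply: cvgB => //; exact: cvg_cst.
    apply: (squeeze_cvgr _ c1 (cvg_cst t)).
    by apply: nearW => j; have /andP[a ->] := trunc_bounds j t0; rewrite (ltW a).
  have c2 : phi (h j * (Num.truncn (t / h j))%:R) @[j --> \oo] --> phi t.
    by apply: continuous_cvg; [exact: cphi|exact: sc].
  apply: cvg_trans c2; apply: near_eq_cvg; near=> j.
  rewrite fE t0/=; have /andP[a b] := trunc_bounds j t0.
  rewrite (le_trans b thi) andbT ifT// (lt_trans _ a)// ltrBrDr -ltrBrDl.
  near: j; apply: (cvgr_lt 0) => //; by rewrite subr_gt0.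
rewrite indicE memNset/= ?mulr0; last by rewrite in_itv/= lot/= leNgt hit.
apply: cvg_near_cst; near=> j.
rewrite fE t0/=; have /andP[a b] := trunc_bounds j t0.
rewrite ifF//; apply/negbTE; rewrite negb_and orbC -ltNge (lt_trans _ a)// ltrBrDr -ltrBrDl.
near: j; apply: (cvgr_lt 0) => //; by rewrite subr_gt0.
Unshelve. all: by end_near. Qed.

Let mcell j n : measurable (cell j n). Proof. exact: measurable_itv. Qed.

Let mf j : measurable_fun setT (f j : measurableTypeR R -> R).
Proof.
by apply: measurable_sum => n; apply: measurable_funM.
Qed.

Let integral_f j : (\int[mu]_t (f j t)%:E =
  (\sum_(first_index lo (u j) <= n < last_index hi (u j)) h j * phi (h j * n%:R))%:E)%E.
Proof.
under eq_integral do rewrite -sumEFin.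
rewrite ge0_integral_sum//; last 2 first.
- by move=> n; apply/measurable_EFinP; apply: measurable_funM.
- by move=> n t _; rewrite lee_fin mulr_ge0.
rewrite -sumEFin; apply: eq_bigr => n _.
under eq_integral do rewrite EFinM.
rewrite ge0_integralZl//; last 2 first.
- exact/measurable_EFinP/measurable_indic.
- by rewrite lee_fin.
rewrite integral_indic// setIT.
rewrite [RHS]EFinM [RHS]muleC; congr (_ * _)%E.
apply: (etrans (lebesgue_measure_itv _)); rewrite /= lte_fin ltr_pM2l// ltr_nat ltnSn.
by rewrite -EFinB -mulrBr -natr1 [_%:R + 1]addrC addrK mulr1.
Qed.

Lemma riemann_sum_cvg :
  (\sum_(first_index lo (u j) <= n < last_index hi (u j)) u j ^+ 2 * phi (u j ^+ 2 * n%:R))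
     @[j --> \oo] --> \int[mu]_t (phi t * \1_(`]lo, hi]%classic) t).
Proof.
(* A cell whose left end is at most [hi] stays below hi + 1, because the mesh is at most 1. *)
pose D : set (measurableTypeR R) := `[0, hi + 1]%classic.
have [] := @dominated_convergence _ _ _ mu setT measurableT
  (fun j t => (f j t)%:E) (fun t => (phi t * \1_(`]lo, hi]%classic) t)%:E)
  (fun t => (2%:E * (\1_D t)%:E)%E).
- by move=> j; apply/measurable_EFinP; exact: mf.
- apply/measurable_EFinP; apply: measurable_funM; first exact: continuous_measurable_fun.
  exact: measurable_indic.
- by apply: aeW => t _; apply: cvg_EFin; [exact: nearW|exact: f_cvg].
- apply: integrableZl => //; exact: integrable_indic_itv.
- apply: aeW => t j _ /=; rewrite -EFinM lee_fin fE.
  case: ifPn => [/and3P[t0 _ b]|_]; last by rewrite normr0 mulr_ge0.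
  rewrite ger0_norm// indicE mem_set/= ?mulr1//.
  rewrite /D/= in_itv/= t0/=; have /andP[a _] := trunc_bounds j t0.
  by have := h1 j; lra.
- move=> i _ c.
  have {}c : (\int[mu]_t (f j t)%:E)%E @[j --> \oo] -->
      (\int[mu]_t (phi t * \1_(`]lo, hi]%classic) t))%:E.
    by rewrite /Rintegral fineK//; exact: integrable_fin_num i.
  apply: cvg_trans; last exact: (fine_cvg c).
  by apply: near_eq_cvg; apply: nearW => j /=; rewrite integral_f.
Qed.

End riemann_sum.

(** * From smoothed occupation sums to the occupation time *)

Section occupation_limit.
Context {R : realType} {d : measure_display} {T : measurableType d}.
Variables (P : probability T R) (W : R -> {RV P >-> R}).
Hypothesis bm : standard_brownian_motion P W.
Local Notation mu := (@lebesgue_measure R).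
Variables (b c : R).
Hypotheses (b0 : 0 <= b) (c2 : c <= 2).

(** One index drives all three parameters. The eighth in [margin] ensures that, for t > lag k,
    lowering the barrier by at most 2 * margin k keeps it above t / 2. *)
Definition lag (k : nat) : R := k.+1%:R^-1.
Definition margin (k : nat) : R := lag k / 8.
Definition horizon (k : nat) : R := b + k.+1%:R.

Lemma lag_gt0 k : 0 < lag k. Proof. by rewrite invr_gt0. Qed.
Lemma margin_gt0 k : 0 < margin k. Proof. by rewrite divr_gt0// lag_gt0. Qed.
Lemma horizon_gt0 k : 0 < horizon k. Proof. by rewrite ltr_wpDl. Qed.

Lemma lag_lt k (t : R) : b + lag k < t -> 0 < t /\ b < t.
Proof.
move=> h; suff bt : b < t by split => //; exact: le_lt_trans b0 bt.
by apply: lt_trans h; rewrite ltrDl lag_gt0.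
Qed.

Lemma lag_cvg : lag k @[k --> \oo] --> 0. Proof. exact: cvg_harmonic. Qed.

Lemma margin_cvg : margin k @[k --> \oo] --> 0.
Proof. by rewrite -(mul0r 8^-1); apply: cvgMl; exact: lag_cvg. Qed.

Definition soft_occupation k w : R := \int[mu]_t
  (soft c (margin k) t (path W t w) * \1_(`]b + lag k, horizon k]%classic) t).

Let soft_path_continuous k w : continuous (fun t => soft c (margin k) t (path W t w)).
Proof. by move=> t; apply: continuous_soft; exact: continuous_path. Qed.

Let g k w t := soft c (margin k) t (path W t w) * \1_(`]b + lag k, horizon k]%classic) t.

Let g_ge0 k w t : 0 <= g k w t.
Proof. by rewrite mulr_ge0// soft_ge0. Qed.

(** The dominating function does not depend on [k], although the horizon grows with [k]; it is
    almost surely integrable by [ae_occupation_finite] at slope 1 / 2. *)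
Let g_dom k w t : `|g k w t| <= 2 * \1_(exceed W b 2^-1 w) t.
Proof.
rewrite ger0_norm// /g [X in X * _ <= _]/= [\1_(`]_, _]%classic) _]indicE.
case: (boolP (t \in _)) => [|_]; last by rewrite mulr0 mulr_ge0.
rewrite mem_setE in_itv/= mulr1 => /andP[lt _].
have [t0 bt] := lag_lt lt.
have [xt|tx] := ltP `|path W t w| (2^-1 * t).
  rewrite soft_small ?margin_gt0 ?mulr_ge0//.
  have : c * margin k <= 2 * margin k by rewrite ler_wpM2r// ltW// margin_gt0.
  have : lag k < t by rewrite (le_lt_trans _ lt)// lerDr.
  by rewrite /margin; move: (lag k) => l; lra.
by rewrite indicE mem_set ?mulr1 ?soft_le2//; split => //; exact: ltW.
Qed.

Let g_cvg w t : t != b -> `|path W t w| != t \/ t <= 0 ->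
  g k w t @[k --> \oo] --> (\1_(exceed W b 1 w) t : R).
Proof.
move=> tb xt; have [t0|t0] := leP t 0.
  rewrite (_ : (fun k => g k w t) = fun=> 0).
    by rewrite indicE memNset; [exact: cvg_cst|move=> [/(le_lt_trans t0)]; rewrite ltxx].
  apply/funext => k; rewrite /g indicE memNset ?mulr0//= in_itv/= => /andP[/lag_lt[]].
  by rewrite ltNge t0.
have {}xt : `|path W t w| != t by case: xt => //; rewrite leNgt t0.
case: (ltgtP t b) tb => // tb _.
  rewrite (_ : (fun k => g k w t) = fun=> 0).
    by rewrite indicE memNset; [exact: cvg_cst|move=> [_ /(lt_le_trans tb)]; rewrite ltxx].
  apply/funext => k; rewrite /g indicE memNset ?mulr0//= in_itv/= => /andP[/lag_lt[_]].
  by rewrite ltNge (ltW tb).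
have inw : \forall k \near \oo, t \in (`]b + lag k, horizon k]%classic : set R).
  near=> k; rewrite mem_setE in_itv/=; apply/andP; split.
    rewrite -ltrBrDl; near: k; apply: (cvgr_lt 0); [exact: lag_cvg|by rewrite subr_gt0].
  rewrite /horizon -lerBlDl; near: k.
  by apply: filterS (nbhs_infty_ger (t - b)) => n /= h; rewrite (le_trans h)// ler_nat.
have cm a : a * margin k @[k --> \oo] --> 0.
  by rewrite -(mulr0 a); apply: cvgMr; exact: margin_cvg.
case: (ltgtP `|path W t w| t) xt => // xt _.
  rewrite indicE memNset; last by move=> [_ _]; rewrite mul1r leNgt xt.
  apply: cvg_near_cst; near=> k; rewrite /g soft_small ?mul0r ?margin_gt0//.
  rewrite lerBrDl -lerBrDr; apply/ltW; near: k; apply: (cvgr_lt 0); first exact: cm.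
  by rewrite subr_gt0.
rewrite indicE mem_set; last by split=> //; [exact: ltW|rewrite mul1r ltW].
apply: cvg_near_cst; near=> k.
rewrite /g soft_large ?margin_gt0//; last 2 first.
- rewrite -lerBrDl; apply/ltW; near: k; apply: (cvgr_lt 0); first exact: cm.
  by rewrite subr_gt0.
- by apply/ltW; near: k; apply: (cvgr_lt 0); first exact: cm.
by rewrite mul1r indicE (near inw k).
Unshelve. all: by end_near. Qed.

Lemma soft_occupation_cvg : {ae P, forall w,
  soft_occupation k w @[k --> \oo] --> fine (mu (exceed W b 1 w))}.
Proof.
have h2 : 0 < (2^-1 : R) by [].
apply: filterS2 (ae_occupation_finite bm b0 h2) (ae_boundary_null bm) => w fin bdry.
have mE a : measurable (exceed W b a w) by exact: measurable_exceed.
have [] := @dominated_convergence _ _ _ mu setT measurableT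
  (fun k t => (g k w t)%:E) (fun t => (\1_(exceed W b 1 w) t)%:E)
  (fun t => (2%:E * (\1_(exceed W b 2^-1 w) t)%:E)%E).
- move=> k; apply/measurable_EFinP; apply: measurable_funM.
    by apply: continuous_measurable_fun.
  by apply: measurable_indic.
- by apply/measurable_EFinP; exact: measurable_indic.
(* Pointwise convergence can fail only at t = b, where the time window opens, and at the times when
   the path lies exactly on the barrier. *)
- exists ([set t : measurableTypeR R | 0 < t /\ `|path W t w| = t] `|` [set b]); split.
  + apply: measurableU => //.
    exact: measurable_boundary.
  + apply/eqP; rewrite eq_le measure_ge0 andbT.
    rewrite (le_trans (measureU2 _ _ _))//; first exact: measurable_boundary.
    have e1 : (mu [set t : measurableTypeR R | (0 < t)%R /\ `|path W t w|%R = t] <= 0)%E.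
      by rewrite bdry.
    have e2 : (mu [set b] <= 0)%E by rewrite lebesgue_measure_set1.
    by apply: (le_trans (leeD e1 e2)); rewrite adde0.
  + move=> t /= h; apply: contrapT => h'; apply: h => _.
    apply: cvg_EFin; first exact: nearW.
    apply: g_cvg.
      by apply/eqP => tb; apply: h'; right.
    have [t0|t0] := leP t 0; [by right|left].
    by apply/eqP => xt; apply: h'; left.
- apply: integrableZl => //; apply/integrableP; split.
    by apply/measurable_EFinP; exact: measurable_indic.
  under eq_integral do rewrite gee0_abs//.
  by rewrite integral_indic// setIT.
- by apply: aeW => t k _ /=; rewrite lee_fin; exact: g_dom.
- move=> i _ h; apply: fine_cvg.
  have {}h : (\int[mu]_t (g k w t)%:E)%E @[k --> \oo] --> mu (exceed W b 1 w).
    by move: h; rewrite integral_indic// setIT.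
  rewrite fineK//; rewrite ge0_fin_numE// (le_lt_trans _ fin)// le_measure ?inE//.
  by move=> t [t0 bt xt]; split => //; lra.
Qed.

Definition soft_count (x : nat -> R) k e : R :=
  occ e (fun n => soft c (margin k) (e ^+ 2 * n%:R))
    (first_index (b + lag k) e) (last_index (horizon k) e) x.

Section along_sequence.
Variable u : nat -> R.
Hypotheses (u0 : forall j, 0 < u j) (u1 : forall j, u j <= 1)
  (ucvg : u j @[j --> \oo] --> 0).

Lemma soft_count_cvg k w :
  soft_count (increment W (u j) ^~ w) k (u j) @[j --> \oo] --> soft_occupation k w.
Proof.
have [] := (lag_gt0 k, horizon_gt0 k) => l0 h0.
have h := riemann_sum_cvg (@soft_path_continuous k w) (fun t => soft_ge0 _ _ _ _)
  (fun t => soft_le2 _ _ _ _) (addr_ge0 b0 (ltW l0)) (ltW h0) u0 u1 ucvg.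
apply: cvg_trans h.
apply: near_eq_cvg; apply: nearW => j; apply: eq_bigr => n _.
by rewrite (psum_increment bm)// path_ge0// mulr_ge0// sqr_ge0.
Qed.

Lemma measurable_soft_count k j :
  measurable_fun setT (fun w => soft_count (increment W (u j) ^~ w) k (u j)).
Proof.
apply: measurable_occ; first by move=> n; exact: measurable_soft.
by move=> i; exact: measurable_increment.
Qed.

(** Measurability of an integral over time is read off from the Riemann sums that converge to it. *)
Lemma measurable_soft_occupation k : measurable_fun setT (soft_occupation k).
Proof.
apply: (@measurable_fun_cvg _ _ _ _
  (fun j w => soft_count (increment W (u j) ^~ w) k (u j))) => [j|w _].
  exact: measurable_soft_count.
exact: soft_count_cvg.
Qed.

Variables (F : R -> R) (M : R).
Hypotheses (cF : continuous F) (FM : forall y, `|F y| <= M).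

Lemma expectation_soft_count_cvg k :
  \int[P]_w F (soft_count (increment W (u j) ^~ w) k (u j)) @[j --> \oo] -->
  \int[P]_w F (soft_occupation k w).
Proof.
have mF := continuous_measurable_fun cF.
apply: (@bounded_cvg_Rintegral _ _ _ _ _ _ M).
- by move=> j; apply: measurableT_comp => //; exact: measurable_soft_count.
- by apply: measurableT_comp => //; exact: measurable_soft_occupation.
- by move=> j w; exact: FM.
- by apply: aeW => w; apply: continuous_cvg; [exact: cF|exact: soft_count_cvg].
Qed.

Lemma expectation_soft_occupation_cvg :
  \int[P]_w F (soft_occupation k w) @[k --> \oo] -->
  \int[P]_w F (fine (mu (exceed W b 1 w))).
Proof.
have mF := continuous_measurable_fun cF.
apply: (@bounded_cvg_Rintegral _ _ _ _ _ _ M).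
- by move=> j; apply: measurableT_comp => //; exact: measurable_soft_occupation.
- apply: measurableT_comp => //; apply: measurableT_comp => //.
  exact: measurable_occupation.
- by move=> j w; exact: FM.
- apply: filterS soft_occupation_cvg => w h.
  by apply: continuous_cvg; [exact: cF|exact: h].
Qed.

End along_sequence.

End occupation_limit.

Lemma same_law_Rintegral {R : realType} {d : measure_display} {T : measurableType d}
    (P : probability T R) (X Y : T -> R) (f : R -> R) :
  measurable_fun setT X -> measurable_fun setT Y ->
  (forall B, measurable B -> P (X @^-1` B) = P (Y @^-1` B)) ->
  measurable_fun setT f -> (forall x, 0 <= f x) ->
  \int[P]_w f (X w) = \int[P]_w f (Y w).
Proof.
move=> mX mY XY mf f0.
pose rY : {mfun T >-> measurableTypeR R} :=
  HB.pack (Y : T -> measurableTypeR R) (isMeasurableFun.Build _ _ T (measurableTypeR R) Y mY).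
pose nu : probability (measurableTypeR R) R := distribution P rY.
have mf' : measurable_fun setT (EFin \o f) by exact/measurable_EFinP.
have f0' x : (0 <= (EFin \o f) x)%E by rewrite lee_fin.
rewrite /Rintegral; congr fine.
rewrite -[LHS]/(\int[P]_w (EFin \o f) (X w))%E -[RHS]/(\int[P]_w (EFin \o f) (Y w))%E.
rewrite (@ge0_integral_law _ _ _ P X nu)// (@ge0_integral_law _ _ _ P Y nu)//.
Qed.

Lemma measurable_cub {R : realType} : measurable_fun setT (@cub R).
Proof.
apply: measurable_minr; first exact: measurable_funX.
by apply: measurable_funX; exact: normr_measurable.
Qed.

(** * Vanishing of the replacement error *)

Section swap_limit.
Context {R : realType} {d d' : measure_display}
  {T : measurableType d} {T' : measurableType d'}.
Variables (P : probability T R) (P' : probability T' R).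
Variables (Z : nat -> T -> R) (W : R -> {RV P' >-> R}).
Hypothesis bm : standard_brownian_motion P' W.
Hypotheses (mZ : forall i, measurable_fun setT (Z i))
  (indZ : mutually_independent P Z) (idZ : identically_distributed P Z)
  (iZ : forall i, P.-integrable setT (EFin \o Z i))
  (iZ2 : forall i, P.-integrable setT (EFin \o (fun w => Z i w ^+ 2)))
  (EZ : forall i, \int[P]_w Z i w = 0) (EZ2 : forall i, \int[P]_w Z i w ^+ 2 = 1).
Variable u : nat -> R.
Hypotheses (u0 : forall j, 0 < u j) (u1 : forall j, u j <= 1)
  (ucvg : u j @[j --> \oo] --> 0).

(** This is the role of Lindeberg's condition. The integrand is at most u |Z|^3, so it tends to 0
    pointwise, and at most Z^2, so dominated convergence applies with second moments alone. *)
Lemma cub_moment_cvg : (u j ^- 2 * \int[P]_w cub (u j * Z 0%N w)) @[j --> \oo] --> 0.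
Proof.
have mc j : measurable_fun setT (fun w => cub (u j * Z 0%N w)).
  by apply: measurableT_comp; [exact: measurable_cub|exact: measurable_funM].
have cle j w : u j ^- 2 * cub (u j * Z 0%N w) <= Z 0%N w ^+ 2.
  by rewrite ler_pdivrMl ?exprn_gt0// -exprMn cub_le2.
have [] := @dominated_convergence _ _ _ P setT measurableT
  (fun j w => (u j ^- 2 * cub (u j * Z 0%N w))%:E) (fun=> 0%E)
  (EFin \o (fun w => Z 0%N w ^+ 2)).
- by move=> j; apply/measurable_EFinP; exact: measurable_funM.
- exact: measurable_cst.
- apply: aeW => w _; apply: cvg_EFin; first exact: nearW.
  have c : u j * `|Z 0%N w| ^+ 3 @[j --> \oo] --> 0.
    by rewrite -(mul0r (`|Z 0%N w| ^+ 3)); apply: cvgMl.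
  apply: (squeeze_cvgr _ (cvg_cst 0) c); apply: nearW => j.
  rewrite -[X in _ <= X <= _]/(u j ^- 2 * cub (u j * Z 0%N w)).
  apply/andP; split; first by rewrite mulr_ge0 ?cub_ge0 ?invr_ge0 ?sqr_ge0.
  rewrite ler_pdivrMl ?exprn_gt0//.
  apply: (le_trans (cub_le3 _)).
  by rewrite normrM exprMn (gtr0_norm (u0 j)) [leRHS]mulrA -exprSr.
- exact: iZ2.
- apply: aeW => w j _ /=; rewrite lee_fin ger0_norm ?cle//.
  by rewrite mulr_ge0 ?cub_ge0 ?invr_ge0 ?sqr_ge0.
- move=> _ _; rewrite integral0 => h.
  have {}h : (\int[P]_w (u j ^- 2 * cub (u j * Z 0%N w))%:E)%E @[j --> \oo] --> 0%:E by [].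
  apply: cvg_trans; last exact: (fine_cvg h).
  apply: near_eq_cvg; apply: nearW => j /=.
  rewrite /= -/(Rintegral P setT (fun w => u j ^- 2 * cub (u j * Z 0%N w))).
  rewrite RintegralZl//.
  apply: (@le_integrable _ _ _ P setT measurableT _ (EFin \o (fun w => u j ^+ 2 * Z 0%N w ^+2))).
  + by apply/measurable_EFinP; exact: mc.
  + move=> w _ /=; rewrite lee_fin -exprMn !ger0_norm ?cub_ge0 ?sqr_ge0//.
    exact: cub_le2.
  + have := integrableZl measurableT (u j ^+ 2) (iZ2 0%N).
    exact: eq_integrable.
Qed.

Variables (b c : R).
Hypotheses (b0 : 0 <= b).
Variables (CF M : R) (F F1 F2 : R -> R).
Hypotheses (CF0 : 0 <= CF) (FC : taylor2 CF F F1 F2) (FM : forall y, `|F y| <= M).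
Hypotheses (mF : measurable_fun setT F) (mF1 : measurable_fun setT F1)
  (mF2 : measurable_fun setT F2).

(** About horizon / u^2 summands are replaced, each at the cost of E cub(u Z) + 33 u^3 up to a
    constant. In total this is u^-2 E cub(u Z) + 33 u up to a constant. The added 1 in [L] covers
    the rounding of [last_index], as u^2 <= 1. *)
Lemma swap_cvg k : (\int[P]_w F (soft_count b c (Z ^~ w) k (u j)) -
  \int[P']_w F (soft_count b c (increment W (u j) ^~ w) k (u j))) @[j --> \oo] --> 0.
Proof.
pose L := horizon b k + 1.
have h0 : 0 < horizon b k by exact: horizon_gt0.
have L0 : 0 <= L by rewrite addr_ge0// ltW.
have uN j : u j ^+ 2 * (last_index (horizon b k) (u j))%:R <= L.
  have := (leqnn (Num.truncn (horizon b k / u j ^+ 2)).+1).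
  rewrite -[X in (X <= _)%N -> _]/_.+1 -[X in (_ < X)%N]/(last_index _ _).
  rewrite last_indexP ?(ltW h0)// => h.
  rewrite /last_index -natr1 mulrDr mulr1 lerD// expr_le1// ltW//.
pose K := taylor_cst (soft_cst (margin k)) L CF.
have K0 : 0 <= K by apply: taylor_cst_ge0 => //; exact: soft_cst_ge0.
have key j : `|\int[P]_w F (soft_count b c (Z ^~ w) k (u j)) -
  \int[P']_w F (soft_count b c (increment W (u j) ^~ w) k (u j))| <=
  K * (L * (u j ^- 2 * \int[P]_w cub (u j * Z 0%N w) + 33 * u j)).
  have epsL : u j ^+ 2 * (last_index (horizon b k) (u j) -
      first_index (b + lag k) (u j))%:R <= L.
    by rewrite (le_trans _ (uN j))// ler_wpM2l ?sqr_ge0// ler_nat leq_subr.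
  have uj := u0 j.
  apply: le_trans (lindeberg mZ (measurable_increment W (u j))
    indZ (increment_indep bm uj) iZ (increment_integrable bm uj) iZ2
    (increment_integrable2 bm uj) EZ (increment_mean bm uj) EZ2
    (increment_second_moment bm uj) (soft_cst_ge0 (margin k)) L0 epsL
    (fun n => taylor2_soft c (margin k) (u j ^+ 2 * n%:R)) CF0 FC FM
    (fun n => measurable_soft _ _ _) (fun n => measurable_soft1 _ _ _)
    (fun n => measurable_soft2 _ _ _) mF mF1 mF2) _.
  rewrite ler_wpM2l//.
  pose m := \int[P]_w cub (u j * Z 0%N w).
  apply: (@le_trans _ _ (\sum_(i < last_index (horizon b k) (u j)) (m + 33 * u j ^+ 3))).
    apply: ler_sum => i _; apply: lerD; last exact: increment_cub.
    rewrite le_eqVlt; apply/orP; left; apply/eqP.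
    apply: (@same_law_Rintegral _ _ _ P (Z i) (Z 0%N) (fun x => cub (u j * x))) => //.
    - by move=> B mB; exact: idZ.
    - by apply: measurableT_comp; [exact: measurable_cub|exact: measurable_funM].
    - by move=> x; exact: cub_ge0.
  have e : m + 33 * u j ^+ 3 = u j ^+ 2 * (u j ^- 2 * m + 33 * u j).
    by field; rewrite gt_eqF.
  rewrite sumr_const card_ord e -mulrnAl -[_ *+ last_index _ _]mulr_natr.
  rewrite ler_wpM2r//.
  rewrite addr_ge0 ?mulr_ge0 ?(ltW uj)// ?invr_ge0 ?sqr_ge0//.
  by apply: Rintegral_ge0 => w _; exact: cub_ge0.
have c0 : K * (L * (u j ^- 2 * \int[P]_w cub (u j * Z 0%N w) + 33 * u j))
    @[j --> \oo] --> 0.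
  rewrite -(mulr0 K) -(mulr0 L) -(addr0 0) -[X in _ + X](mulr0 33).
  apply: cvgMr; apply: cvgMr; apply: cvgD; first exact: cub_moment_cvg.
  exact: cvgMr.
apply/cvgr0Pnorm_le => e e0; near=> j; apply: le_trans (key j) _.
near: j; exact: (cvgr_le 0).
Unshelve. all: by end_near. Qed.

End swap_limit.

Lemma counting_bounded {R : realType} (A : set nat) N : (forall n, A n -> (n < N)%N) ->
  counting A = (\sum_(0 <= n < N) \1_A n : R)%:E.
Proof.
move=> AN; rewrite counting_dirac (nneseries_split 0 N)// add0n.
rewrite eseries0; last first.
  by move=> n Nn _; rewrite diracE memNset// => /AN; rewrite ltnNge Nn.
by rewrite adde0 -sumEFin; apply: eq_bigr => n _; rewrite diracE indicE.
Qed.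

(** * Comparison with the count of exceedances *)

Section hits.
Context {R : realType}.
Implicit Types (b e : R) (x r : nat -> R) (k n : nat).

Definition hits b e x r : set nat :=
  [set n | [/\ (1 <= n)%N, b / e ^+ 2 <= n%:R & e <= `|psum x n / n%:R + r n|]].

Lemma hitE e x r n : 0 < e -> (0 < n)%N ->
  (e <= `|psum x n / n%:R + r n|) =
  (e ^+ 2 * n%:R <= `|e * psum x n + e * n%:R * r n|).
Proof.
move=> e0 n0; have nR : (0 : R) < n%:R by rewrite ltr0n.
have en0 : 0 < e * n%:R by rewrite mulr_gt0.
have -> : e * psum x n + e * n%:R * r n = e * n%:R * (psum x n / n%:R + r n).
  by field; rewrite gt_eqF.
by rewrite normrM (gtr0_norm en0) expr2 mulrAC ler_pM2l.
Qed.

Variables (b e : R) (x r : nat -> R) (k : nat).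
Hypotheses (b0 : 0 <= b) (e0 : 0 < e).
Let first := first_index (b + lag k) e.
Let last := last_index (horizon b k) e.
Hypotheses
  (small : forall n, (first <= n)%N -> `|r n| <= margin k * e / horizon b k)
  (tail : forall n, (last <= n)%N -> `|psum x n| < e / 2 * n%:R).

Let A := hits b e x r.

Let l0 : 0 < lag k :> R. Proof. exact: lag_gt0. Qed.
Let m0 : 0 < margin k :> R. Proof. exact: margin_gt0. Qed.
Let h0 : 0 < horizon b k. Proof. exact: horizon_gt0. Qed.
Let e20 : 0 < e ^+ 2. Proof. exact: exprn_gt0. Qed.
Let bl0 : 0 <= b + lag k. Proof. by rewrite addr_ge0// ltW. Qed.

Let lag_le1 : lag k <= 1 :> R.
Proof. by rewrite invf_le1// ler1n. Qed.

Let horizon_ge : b + 1 <= horizon b k.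
Proof. by rewrite lerD2l ler1n. Qed.

Let first_le_last : (first <= last)%N.
Proof.
rewrite leqNgt; apply/negP => h; have := leqnn last.
have : (last < last)%N = false by rewrite ltnn.
rewrite {2}/last last_indexP ?(ltW h0)// => /negbT; rewrite -ltNge => h1 _.
have : (first <= last)%N.
  by rewrite first_indexP// (le_lt_trans _ h1)// (le_trans _ horizon_ge)// lerD2l.
by rewrite leqNgt h.
Qed.

Let hits_lt n : A n -> (n < last)%N.
Proof.
move=> [n0 _ en]; rewrite ltnNge; apply/negP => ln.
have nR : (0 : R) < n%:R by rewrite ltr0n.
have h1 : `|psum x n / n%:R| < e / 2.
  by rewrite normrM normfV (gtr0_norm nR) ltr_pdivrMr// tail.
have h2 : `|r n| <= e / 2.
  apply: (le_trans (small (leq_trans first_le_last ln))).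
  rewrite ler_pdivrMr// mulrC -mulrA ler_wpM2l ?(ltW e0)//.
  rewrite /margin; have := b0; move: horizon_ge lag_le1.
  by move: (lag k) (horizon b k) => l h hb l1 b0'; lra.
have := le_lt_trans (le_trans en (ler_normD _ _)) (ltr_leD h1 h2).
by rewrite -splitr ltxx.
Qed.

(** In the time window e^2 n is at most the horizon, so a remainder of size margin * e / horizon
    moves the rescaled walk by at most [margin]. *)
Let drift n : (first <= n)%N -> (n < last)%N -> `|e * n%:R * r n| <= margin k.
Proof.
move=> fn; rewrite last_indexP ?(ltW h0)// => nl.
rewrite normrM ger0_norm ?mulr_ge0 ?(ltW e0)//.
apply: (le_trans (ler_wpM2l _ (small fn))); first by rewrite mulr_ge0 ?(ltW e0).
rewrite [leLHS](_ : _ = margin k * (e ^+ 2 * n%:R / horizon b k)); last by ring.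
by rewrite ler_piMr ?(ltW m0)// ler_pdivrMr// mul1r.
Qed.

Let lower n : (first <= n)%N -> (n < last)%N ->
  soft (-1) (margin k) (e ^+ 2 * n%:R) (e * psum x n) <= \1_A n.
Proof.
move=> fn nl; have n0 : (0 < n)%N by rewrite (leq_trans _ fn).
have t0 : 0 <= e ^+ 2 * n%:R by rewrite mulr_ge0// ltW.
have [nA|nA] := pselect (A n); first by rewrite indicE mem_set// softN1_le1.
rewrite indicE memNset// softN1_eq0//.
have bt : b / e ^+ 2 <= n%:R.
  rewrite ler_pdivrMr// mulrC ltW//; move: fn; rewrite first_indexP//.
  by apply: lt_trans; rewrite ltrDl.
have : e ^+ 2 * n%:R > `|e * psum x n + e * n%:R * r n|.
  by rewrite ltNge -hitE//; apply/negP => h; apply: nA.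
have := drift fn nl; have := ler_normB (e * psum x n + e * n%:R * r n) (e * n%:R * r n).
by rewrite addrK; lra.
Qed.

Let upper n : (first <= n)%N -> (n < last)%N ->
  \1_A n <= soft 2 (margin k) (e ^+ 2 * n%:R) (e * psum x n).
Proof.
move=> fn nl; have n0 : (0 < n)%N by rewrite (leq_trans _ fn).
have [nA|nA] := pselect (A n); last by rewrite indicE memNset// soft_ge0.
rewrite indicE mem_set// soft2_ge1//; case: nA => _ _; rewrite hitE//.
have := drift fn nl; have := ler_normD (e * psum x n) (e * n%:R * r n).
by lra.
Qed.

(** Beyond [last] nothing is counted, and from [first] to [last] the indicator lies between the two
    smoothed ones. The indices with b <= e^2 n <= b + lag k are ignored below and all counted above:
    there are at most lag k / e^2 + 2 of them. *)
Lemma hits_sandwich : exists y : R, [/\ counting A = y%:E,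
  soft_count b (-1) x k e <= e ^+ 2 * y &
  e ^+ 2 * y <= soft_count b 2 x k e + (lag k + 2 * e ^+ 2)].
Proof.
exists (\sum_(0 <= n < last) \1_A n); split; first exact: (counting_bounded hits_lt).
- rewrite (big_cat_nat _ first_le_last)//= mulrDr ler_wpDl//.
    by rewrite mulr_ge0 ?(ltW e20)// sumr_ge0.
  rewrite mulr_sumr; apply: ler_sum_nat => n /andP[fn nl].
  by rewrite ler_wpM2l ?(ltW e20)// lower.
- pose p := Num.truncn (b / e ^+ 2).
  have pf : (p <= first)%N.
    rewrite /first /first_index (leq_trans _ (leqnSn _))//.
    by rewrite Num.Theory.le_truncn// ler_pM2r ?invr_gt0// lerDl ltW.
  rewrite (big_cat_nat _ first_le_last)//= mulrDr addrC lerD//.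
    rewrite mulr_sumr; apply: ler_sum_nat => n /andP[fn nl].
    by rewrite ler_wpM2l ?(ltW e20)// upper.
  rewrite (big_cat_nat _ pf)//= big_nat_cond big1 ?add0r; last first.
    move=> n /andP[/andP[_ np] _]; rewrite indicE memNset// => -[_ bn _].
    move: np; rewrite ltnNge => /negP; apply.
    rewrite -(ler_nat R) (le_trans _ bn)// Num.Theory.truncn_le//.
    by rewrite divr_ge0// ltW.
  apply: (@le_trans _ _ (e ^+ 2 * \sum_(p <= n < first) 1)).
    rewrite ler_wpM2l ?(ltW e20)//; apply: ler_sum => n _.
    by rewrite indicE; case: (_ \in _).
  rewrite sumr_const_nat natrB//.
  have h1 : first%:R <= (b + lag k) / e ^+ 2 + 1.
    by rewrite /first /first_index -natr1 lerD2r Num.Theory.truncn_le// divr_ge0// ltW.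
  have h2 : b / e ^+ 2 <= p%:R + 1.
    have /andP[_ +] := Num.Theory.truncn_itv (divr_ge0 b0 (ltW e20)).
    by rewrite -natr1 => /ltW.
  apply: (@le_trans _ _ (e ^+ 2 * ((b + lag k) / e ^+ 2 + 1 - (b / e ^+ 2 - 1)))).
    by rewrite ler_wpM2l ?(ltW e20)// lerB// lerBlDr.
  rewrite le_eqVlt; apply/orP; left; apply/eqP; field.
  by rewrite gt_eqF.
Qed.

End hits.

(** * Convergence of the count for nondecreasing smooth test functions *)

Section counting_limit.
Context {R : realType} {d d' : measure_display}
  {T : measurableType d} {T' : measurableType d'}.
Variables (P : probability T R) (P' : probability T' R).
Variables (Z rho : nat -> T -> R) (W : R -> {RV P' >-> R}).
Hypothesis bm : standard_brownian_motion P' W.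
Hypotheses (mZ : forall i, measurable_fun setT (Z i))
  (mrho : forall i, measurable_fun setT (rho i))
  (indZ : mutually_independent P Z) (idZ : identically_distributed P Z)
  (iZ : forall i, P.-integrable setT (EFin \o Z i))
  (iZ2 : forall i, P.-integrable setT (EFin \o (fun w => Z i w ^+ 2)))
  (EZ : forall i, \int[P]_w Z i w = 0) (EZ2 : forall i, \int[P]_w Z i w ^+ 2 = 1).

(** An existential replaces the supremum over n >= m, which makes the event a countable union. The
    scale is the square root of the starting index m, as in the assumption on the remainder. *)
Definition bad_remainder (delta : R) (m : nat) : set T :=
  [set w | exists2 n, (m <= n)%N & delta < Num.sqrt (m%:R : R) * `|rho n w|].

Hypothesis rho_small : forall delta, 0 < delta ->
  P (bad_remainder delta m) @[m --> \oo] --> 0%E.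

Definition bad_walk (c : R) (m : nat) : set T :=
  [set w | exists2 n, (m <= n)%N & c * n%:R <= `|psum (Z ^~ w) n|].

Variable b : R.
Hypothesis b0 : 0 <= b.

Definition hit_count e w : \bar R := counting (hits b e (Z ^~ w) (rho ^~ w)).

Lemma measurable_hit_count e : measurable_fun setT (hit_count e).
Proof.
rewrite /hit_count; under eq_fun do rewrite counting_dirac.
apply: (@ge0_emeasurable_sum _ _ _ _
  (fun n w => \d_n (hits b e (Z ^~ w) (rho ^~ w)) : \bar R) xpredT) => // n _.
have mh : measurable [set w | hits b e (Z ^~ w) (rho ^~ w) n].
  case: (boolP ((1 <= n)%N && (b / e ^+ 2 <= n%:R))) => h; last first.
    rewrite [X in measurable X](_ : _ = set0)//; apply/seteqP; split => w //= [h1 h2 _].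
    by rewrite h1 h2 in h.
  rewrite [X in measurable X](_ : _ =
    (fun w => e <= `|psum (Z ^~ w) n / n%:R + rho n w|) @^-1` [set true]).
    rewrite -[X in measurable X]setTI.
    apply: measurable_fun_ler => //; apply: measurableT_comp => //.
    by apply: measurable_funD => //; apply: measurable_funM => //; exact: measurable_psum.
  by apply/seteqP; split => w /=; [move=> []|move: h => /andP[h1 h2] h3].
have -> : (fun w => \d_n (hits b e (Z ^~ w) (rho ^~ w)) : \bar R) =
    EFin \o \1_[set w | hits b e (Z ^~ w) (rho ^~ w) n].
  apply/funext => w; rewrite diracE /= indicE; congr (_%:R%:E).
by apply/measurable_EFinP; exact: measurable_indic.
Qed.

Lemma measurable_bad_remainder delta m : measurable (bad_remainder delta m).
Proof.
have -> : bad_remainder delta m = \bigcup_(n in [set n | (m <= n)%N])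
    ((fun w => delta < Num.sqrt (m%:R : R) * `|rho n w|) @^-1` [set true]).
  by apply/seteqP; split => w /= [n mn h]; exists n.
apply: bigcup_measurable => n _; rewrite -[X in measurable X]setTI.
apply: measurable_fun_ltr => //; apply: measurable_funM => //.
exact: measurableT_comp.
Qed.

Lemma measurable_bad_walk (c : R) m : measurable (bad_walk c m).
Proof.
have -> : bad_walk c m = \bigcup_(n in [set n | (m <= n)%N])
    ((fun w => c * n%:R <= `|psum (Z ^~ w) n|) @^-1` [set true]).
  by apply/seteqP; split => w /= [n mn h]; exists n.
apply: bigcup_measurable => n _; rewrite -[X in measurable X]setTI.
by apply: measurable_fun_ler => //; apply: measurableT_comp => //; exact: measurable_psum.
Qed.

Lemma bad_walk_le (c : R) m : 0 < c -> (0 < m)%N ->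
  (P (bad_walk c m) <= (2 / (c ^+ 2 * m%:R))%:E)%E.
Proof. by move=> c0 m0; have [] := hajek_renyi mZ indZ iZ iZ2 EZ EZ2 c0 m0. Qed.

Lemma hits_tail e m w : 0 < e -> (0 < m)%N ->
  ~ (bad_remainder (e / 2) m `|` bad_walk (e / 2) m) w ->
  (hit_count e w < +oo)%E.
Proof.
move=> e0 m0 /not_orP[nr nw]; rewrite /hit_count (@counting_bounded _ _ m) ?ltry//.
move=> n [n0 _ en]; rewrite ltnNge; apply/negP => mn.
have nR : (0 : R) < n%:R by rewrite ltr0n.
have h1 : `|psum (Z ^~ w) n / n%:R| < e / 2.
  rewrite normrM normfV (gtr0_norm nR) ltr_pdivrMr// ltNge.
  by apply/negP => h; apply: nw; exists n.
have h2 : `|rho n w| <= e / 2.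
  apply: le_trans (_ : Num.sqrt (m%:R : R) * `|rho n w| <= _).
    by apply: ler_peMl => //; rewrite -[leLHS]sqrtr1 ler_wsqrtr// ler1n.
  by rewrite leNgt; apply/negP => h; apply: nr; exists n.
have := le_lt_trans (le_trans en (ler_normD _ _)) (ltr_leD h1 h2).
by rewrite -splitr ltxx.
Qed.

Lemma bad_walk_cvg (c : R) : 0 < c -> P (bad_walk c m) @[m --> \oo] --> 0%E.
Proof.
move=> c0.
have h : (2 / c ^+ 2 * m.+1%:R^-1)%:E @[m --> \oo] --> 0%:E.
  apply: cvg_EFin; first exact: nearW.
  rewrite -(mulr0 (2 / c ^+ 2)); apply: cvgMr; exact: cvg_harmonic.
rewrite -cvg_shiftS; apply: (squeeze_cvge _ (cvg_cst 0%E) h).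
apply: nearW => m; rewrite measure_ge0/=.
by rewrite (le_trans (bad_walk_le c0 _))// lee_fin invfM mulrA.
Qed.

(** For each m > 0 an infinite count forces one of the two bad events from m on; their probabilities
    tend to 0 as m grows, while e stays fixed. *)
Lemma ae_hit_count_finite e : 0 < e -> {ae P, forall w, (hit_count e w < +oo)%E}.
Proof.
move=> e0; have e2 : 0 < e / 2 by rewrite divr_gt0.
pose B := [set w | hit_count e w = +oo%E].
have mB : measurable B.
  rewrite -[B]setTI; exact: (measurable_hit_count e measurableT (emeasurable_set1 +oo)).
exists B; split => //; last first.
  move=> w /= h; rewrite /B/=; apply: contrapT => h'; apply: h.
  by rewrite ltey; exact/eqP.
apply/eqP; rewrite eq_le measure_ge0 andbT.
have c : (P (bad_remainder (e / 2) m) + P (bad_walk (e / 2) m))%E @[m --> \oo] --> 0%E.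
  rewrite -(adde0 0%E); apply: cvgeD => //; [exact: rho_small|exact: bad_walk_cvg].
have cc : lim ((P (bad_remainder (e / 2) m) + P (bad_walk (e / 2) m))%E @[m --> \oo]) = 0%E.
  exact: cvg_lim.
rewrite -cc; apply: lime_ge; first by apply/cvg_ex; exists 0%E.
near=> m; have m0 : (0 < m)%N by near: m; exact: nbhs_infty_gt.
have mr := measurable_bad_remainder (e / 2) m.
have mw := measurable_bad_walk (e / 2) m.
apply: (@le_trans _ _ (P (bad_remainder (e / 2) m `|` bad_walk (e / 2) m))); last first.
  exact: measureU2.
apply: le_measure; rewrite ?inE//; first exact: measurableU.
move=> w Bw; apply: contrapT => /(hits_tail e0 m0).
by rewrite Bw ltxx.
Unshelve. all: by end_near. Qed.

Variable u : nat -> R.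
Hypotheses (u0 : forall j, 0 < u j) (u1 : forall j, u j <= 1)
  (ucvg : u j @[j --> \oo] --> 0).
Variables (CF : R) (F F1 F2 : R -> R).
Hypotheses (CF0 : 0 <= CF) (FC : taylor2 CF F F1 F2)
  (F0 : forall y, 0 <= F y) (Fle1 : forall y, F y <= 1)
  (Fhomo : {homo F : y z / y <= z}) (cF : continuous F)
  (mF1 : measurable_fun setT F1) (mF2 : measurable_fun setT F2).

Let mF : measurable_fun setT F. Proof. exact: continuous_measurable_fun. Qed.

Let X j w := (u j) ^+ 2 * fine (hit_count (u j) w).

(* The first index m has m e^2 > lag k, so that sqrt m |rho n| <= remainder_level k
   gives |rho n| <= margin k * e / horizon k. *)
Definition remainder_level k : R := margin k * Num.sqrt (lag k) / horizon b k.

Definition bad k e : set T :=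
  bad_remainder (remainder_level k) (first_index (b + lag k) e) `|`
  bad_walk (e / 2) (last_index (horizon b k) e).

Lemma measurable_bad k e : measurable (bad k e).
Proof. by apply: measurableU; [exact: measurable_bad_remainder|exact: measurable_bad_walk]. Qed.

Lemma hit_count_sandwich k e w : 0 < e -> ~ bad k e w ->
  soft_count b (-1) (Z ^~ w) k e <= e ^+ 2 * fine (hit_count e w) <=
  soft_count b 2 (Z ^~ w) k e + (lag k + 2 * e ^+ 2).
Proof.
move=> e0 /not_orP[nr nw].
have l0 : 0 < lag k :> R by exact: lag_gt0.
have [y [-> h1 h2]] : exists y : R, [/\ hit_count e w = y%:E,
    soft_count b (-1) (Z ^~ w) k e <= e ^+ 2 * y &
    e ^+ 2 * y <= soft_count b 2 (Z ^~ w) k e + (lag k + 2 * e ^+ 2)].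
  apply: hits_sandwich => // n mn.
    set m := first_index _ _ in mn nr.
    have m0 : 0 < (m%:R : R) by rewrite ltr0n.
    have s0 : 0 < Num.sqrt (m%:R : R) by rewrite sqrtr_gt0.
    have h : Num.sqrt (m%:R : R) * `|rho n w| <= remainder_level k.
      by rewrite leNgt; apply/negP => h; apply: nr; exists n.
    have lm : Num.sqrt (lag k) <= e * Num.sqrt (m%:R : R).
      have : (m <= m)%N by [].
      rewrite {1}/m first_indexP// ?addr_ge0 ?(ltW l0)// => lm.
      rewrite -[e]gtr0_norm// -sqrtr_sqr -sqrtrM ?sqr_ge0// ler_wsqrtr//.
      by rewrite (le_trans _ (ltW lm))// lerDr.
    rewrite -(ler_pM2l s0) (le_trans h)// /remainder_level.
    rewrite [leRHS](_ : _ = margin k * (e * Num.sqrt (m%:R : R)) / horizon b k); last by ring.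
    by rewrite ler_wpM2r ?invr_ge0 ?(ltW (horizon_gt0 b0 _))// ler_wpM2l ?(ltW (margin_gt0 _)).
  by rewrite ltNge; apply/negP => h; apply: nw; exists n.
by rewrite /= h1 h2.
Qed.

Let mX j : measurable_fun setT (X j).
Proof.
apply: measurable_funM => //; apply: measurableT_comp => //.
exact: measurable_hit_count.
Qed.

Let FM y : `|F y| <= 1. Proof. by rewrite ger0_norm. Qed.

Let mS (c e : R) k : measurable_fun setT (fun w => soft_count b c (Z ^~ w) k e).
Proof. by apply: measurable_occ => // n; exact: measurable_soft. Qed.

Let iF (f : T -> R) : measurable_fun setT f -> P.-integrable setT (EFin \o (F \o f)).
Proof.
move=> mf; apply: (@bounded_integrable _ _ _ P (F \o f) 1); [exact: measurableT_comp mF mf|move=> w; exact: FM].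
Qed.

(** The Hajek-Renyi inequality at slope e / 2 gives 8 / (e^2 m), and e^2 m exceeds the horizon at m
    = [last_index]. The bound for the walk is thus uniform in [j] and small for large [k]. *)
Let pbad k j : fine (P (bad k (u j))) <=
  fine (P (bad_remainder (remainder_level k) (first_index (b + lag k) (u j)))) +
  8 / horizon b k.
Proof.
have h0 := horizon_gt0 b0 k.
have mr := measurable_bad_remainder (remainder_level k) (first_index (b + lag k) (u j)).
have mw := measurable_bad_walk (u j / 2) (last_index (horizon b k) (u j)).
rewrite -lee_fin EFinD !fineK ?fin_num_measure//; last exact: measurable_bad.
apply: (le_trans (measureU2 _ mr mw)); apply: leeD => //.
apply: (le_trans (bad_walk_le _ _)); rewrite ?divr_gt0// lee_fin.
set m := last_index _ _.
have : (m < m)%N = false by rewrite ltnn.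
rewrite {2}/m last_indexP ?(ltW h0)// => /negbT; rewrite -ltNge => hm.
have m0 : (0 : R) < m%:R by rewrite ltr0n.
rewrite [leLHS](_ : _ = 8 / (u j ^+ 2 * m%:R)).
  by rewrite ler_pM2l// lef_pV2 ?posrE ?mulr_gt0 ?exprn_gt0// ltW.
by field; rewrite !gt_eqF.
Qed.

Let ind_bad k j : \int[P]_w (\1_(bad k (u j)) w) = fine (P (bad k (u j))).
Proof. by rewrite /Rintegral integral_indic ?setIT//; exact: measurable_bad. Qed.

Let i_bad k j : P.-integrable setT (EFin \o \1_(bad k (u j))).
Proof.
apply: (@bounded_integrable _ _ _ P _ 1).
  by apply: measurable_indic; exact: measurable_bad.
by move=> w; rewrite indicE ger0_norm//; case: (_ \in _).
Qed.

(** Off the bad event the sandwich passes through [F] by monotonicity; on it the error is at most 1,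
    since [F] takes values in [0, 1]. For [upper] the slack in the sandwich is further absorbed by
    the Lipschitz constant [CF]. *)
Let lower k j : \int[P]_w F (soft_count b (-1) (Z ^~ w) k (u j)) -
  fine (P (bad k (u j))) <= \int[P]_w F (X j w).
Proof.
rewrite lerBlDr -ind_bad -RintegralD//; last exact: iF.
apply: le_Rintegral => //.
- exact: iF.
- by apply: eq_integrable (integrableD measurableT (iF (mX j)) (i_bad k j)).
move=> w _; have [hb|hb] := pselect (bad k (u j) w).
  by rewrite /= indicE mem_set// (le_trans (Fle1 _))// lerDr.
rewrite /= indicE memNset// addr0; apply: Fhomo.
by have /andP[] := hit_count_sandwich (u0 j) hb.
Qed.

Let upper k j : \int[P]_w F (X j w) <=
  \int[P]_w F (soft_count b 2 (Z ^~ w) k (u j)) + CF * (lag k + 2 * u j ^+ 2) +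
  fine (P (bad k (u j))).
Proof.
set K := CF * _; have K0 : 0 <= K.
  by rewrite mulr_ge0// addr_ge0 ?mulr_ge0 ?sqr_ge0// ltW// lag_gt0.
have iK : P.-integrable setT (EFin \o cst K) by exact: finite_measure_integrable_cst.
have iFK : P.-integrable setT
    (EFin \o (fun w => F (soft_count b 2 (Z ^~ w) k (u j)) + K)).
  by apply: eq_integrable (integrableD measurableT (iF (mS 2 (u j) k)) iK).
rewrite -ind_bad -(Rintegral_probability_cst P K) -RintegralD//; last exact: iF.
rewrite -RintegralD//.
apply: le_Rintegral => //.
- exact: iF.
- by apply: eq_integrable (integrableD measurableT iFK (i_bad k j)).
move=> w _; have [hb|hb] := pselect (bad k (u j) w).
  by rewrite /= indicE mem_set// (le_trans (Fle1 _))// lerDr addr_ge0.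
rewrite /= indicE memNset// addr0.
have /andP[_ h] := hit_count_sandwich (u0 j) hb.
apply: (le_trans (Fhomo h)).
have [_ _ lip _] := FC.
have := lip (soft_count b 2 (Z ^~ w) k (u j)) (lag k + 2 * u j ^+ 2).
rewrite [X in CF * X]ger0_norm; last first.
  by rewrite addr_ge0 ?mulr_ge0 ?sqr_ge0// ltW// lag_gt0.
by rewrite -/K => /(le_trans (ler_norm _)); rewrite lerBlDl addrC.
Qed.

Let first_index_cvg (lo : R) : 0 < lo -> first_index lo (u j) @[j --> \oo] --> \oo.
Proof.
move=> lo0; apply/cvgnyPge => A.
have c : u j ^+ 2 * A%:R @[j --> \oo] --> 0.
  rewrite -(mul0r A%:R) -[X in X * _](mulr0 0); apply: cvgMl.
  by under eq_fun do rewrite expr2; exact: cvgM.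
near=> j; rewrite ltnW// ltnNge.
apply/negP; rewrite first_indexP ?ltW//; apply/negP; rewrite -leNgt.
near: j; exact: (cvgr_le 0).
Unshelve. all: by end_near. Qed.

Let soft_cvg c k : c <= 2 ->
  \int[P]_w F (soft_count b c (Z ^~ w) k (u j)) @[j --> \oo] -->
  \int[P']_w F (soft_occupation W b c k w).
Proof.
move=> c2.
have h1 := swap_cvg bm mZ indZ idZ iZ iZ2 EZ EZ2 u0 u1 ucvg c b0 CF0 FC FM mF mF1 mF2 k.
have h2 : \int[P']_w F (soft_count b c (increment W (u j) ^~ w) k (u j)) @[j --> \oo] -->
    \int[P']_w F (soft_occupation W b c k w).
  by apply: (expectation_soft_count_cvg bm b0 u0 u1 ucvg cF FM).
pose A j := \int[P]_w F (soft_count b c (Z ^~ w) k (u j)).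
pose B j := \int[P']_w F (soft_count b c (increment W (u j) ^~ w) k (u j)).
rewrite -[X in X @ _]/A.
have -> : A = (A \- B) \+ B by apply/funext => j /=; rewrite subrK.
by rewrite -[X in _ --> X]add0r; exact: (cvgD (f := A \- B) h1 h2).
Qed.

Lemma expectation_hit_count_cvg :
  \int[P]_w F (X j w) @[j --> \oo] -->
  \int[P']_w F (fine (@lebesgue_measure R (exceed W b 1 w))).
Proof.
set L := \int[P']_w _.
have soft_limit c : c <= 2 -> exists I : nat -> R, I k @[k --> \oo] --> L /\
    forall k, \int[P]_w F (soft_count b c (Z ^~ w) k (u j)) @[j --> \oo] --> I k.
  move=> c2; exists (fun k => \int[P']_w F (soft_occupation W b c k w)); split.
    exact: (expectation_soft_occupation_cvg bm b0 c2 u0 u1 ucvg cF FM).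
  by move=> k; exact: soft_cvg.
have [|I1 [I1L I1cvg]] := soft_limit (-1); first by lra.
have [|I2 [I2L I2cvg]] := soft_limit 2; first by [].
apply/cvgrPdist_le => e e0.
pose de : R := e / 8; have de0 : 0 < de by rewrite divr_gt0.
have lag0 (C : R) : C * lag k @[k --> \oo] --> 0.
  by rewrite -(mulr0 C); apply: cvgMr; exact: lag_cvg.
(* First [k] is fixed, large enough for the errors that do not involve [j]; only then does [j] grow.
   At most six errors of size [de] add up on either side. *)
near \oo => k.
have k1 : `|L - I1 k| <= de.
  by near: k; move/cvgrPdist_le : I1L; exact.
have k2 : `|L - I2 k| <= de.
  by near: k; move/cvgrPdist_le : I2L; exact.
have k3 : CF * lag k <= de by near: k; exact: (cvgr_le 0).
have k4 : 8 / horizon b k <= de.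
  apply: (@le_trans _ _ (8 * lag k)); last by near: k; exact: (cvgr_le 0).
  by rewrite ler_pM2l// lef_pV2 ?posrE ?horizon_gt0// lerDr.
have l0 : 0 < remainder_level k.
  by rewrite divr_gt0 ?horizon_gt0// mulr_gt0 ?sqrtr_gt0 ?margin_gt0 ?lag_gt0.
have rcvg : fine (P (bad_remainder (remainder_level k) (first_index (b + lag k) (u j))))
    @[j --> \oo] --> 0.
  apply: fine_cvg.
  have := cvg_comp _ _ (first_index_cvg (_ : 0 < b + lag k)) (rho_small l0).
  by apply; rewrite ltr_wpDl// lag_gt0.
have u2 : CF * (2 * u j ^+ 2) @[j --> \oo] --> 0.
  rewrite -(mulr0 CF) -[X in _ * X](mulr0 2) -[X in _ * (_ * X)](mulr0 0).
  apply: cvgMr; apply: cvgMr.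
  by under eq_fun do rewrite expr2; exact: cvgM.
near=> j.
have j1 : `|I1 k - \int[P]_w F (soft_count b (-1) (Z ^~ w) k (u j))| <= de.
  by near: j; move/cvgrPdist_le : (I1cvg k); exact.
have j2 : `|I2 k - \int[P]_w F (soft_count b 2 (Z ^~ w) k (u j))| <= de.
  by near: j; move/cvgrPdist_le : (I2cvg k); exact.
have j3 : CF * (2 * u j ^+ 2) <= de by near: j; exact: (cvgr_le 0).
have j4 : fine (P (bad_remainder (remainder_level k) (first_index (b + lag k) (u j)))) <= de.
  by near: j; exact: (cvgr_le 0).
have := lower k j; have := upper k j; have := pbad k j.
move: k1 k2 j1 j2; rewrite mulrDr !ler_norml.
have -> : e = 8 * de by rewrite /de mulrC divfK.
by do 4 move=> /andP[? ?]; move=> ? ? ?; apply/andP; split; lra.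
Unshelve. all: by end_near. Qed.

End counting_limit.

Lemma uniform_modulus {R : realType} (f : R -> R) (B e : R) : continuous f -> 0 < e ->
  exists m : nat, forall y z, 0 <= y <= B -> `|z - y| <= m.+1%:R^-1 -> `|f z - f y| <= e.
Proof.
move=> cf e0; have e2 : 0 < e / 2 by rewrite divr_gt0.
have /compact_near_coveringP /(_ nat (nbhs \oo)
    (fun m y => forall z, `|z - y| <= m.+1%:R^-1 -> `|f z - f y| <= e)) :=
  @segment_compact R 0 B.
case=> [y _|n _ h]; last first.
  exists n => y z yB; apply: (h n (leqnn n)).
  by rewrite /= in_itv.
have /cvgrPdist_le /(_ _ e2) /nbhs_ballP[/= r r0 hr] := cf y.
have r2 : 0 < r / 2 by rewrite divr_gt0.
exists (ball y (r / 2), [set n | n.+1%:R^-1 < r / 2]).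
  split => /=; first exact: nbhsx_ballx.
  have := @cvg_harmonic R; move/cvgrPdist_lt => /(_ _ r2).
  by apply: filterS => n /=; rewrite sub0r normrN gtr0_norm.
move=> [x n] /= [yx nr] z zx.
have hx : `|f y - f x| <= e / 2.
  by apply: hr; apply: le_ball yx; rewrite ler_pdivrMr// ler_pMr// ler1n.
have hz : `|f y - f z| <= e / 2.
  apply: hr; rewrite /ball/=; move: yx; rewrite /ball/= => yx.
  have := ler_distD x y z; rewrite (distrC x z) => /le_lt_trans; apply.
  by rewrite [r]splitr ltrD// (le_lt_trans zx).
by rewrite [e]splitr (le_trans (ler_distD (f y) _ _))// (distrC (f z)) lerD.
Qed.

(** * Approximation of continuous functions by sums of smooth steps *)

Section staircase.
Context {R : realType}.
Variables (f : R -> R) (m N : nat).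
Let a i := f (i%:R / m.+1%:R).

(* Equal to f at the nodes i / (m+1), i <= N, and constant beyond the last one. *)
Definition staircase y : R :=
  a 0 + \sum_(0 <= i < N) (a i.+1 - a i) * step (m.+1%:R * y - i%:R).

Lemma staircase_large y : N%:R <= m.+1%:R * y -> staircase y = a N.
Proof.
move=> Ny; rewrite /staircase -[RHS](subrKC (a 0%N)).
rewrite -(telescope_sumr a (leq0n N)); congr (_ + _); apply: eq_big_nat => i /andP[_ iN].
rewrite step_ge1 ?mulr1// lerBrDl (le_trans _ Ny)// -[X in _ + X]/(1%:R) -natrD ler_nat.
by rewrite addn1.
Qed.

(** On a cell between two nodes only one step is in transition: the earlier ones equal 1 and
    telescope to the value at the left node, the later ones vanish. *)
Lemma staircase_small y e : 0 <= y -> m.+1%:R * y < N%:R ->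
  (forall x z, 0 <= x <= N%:R / m.+1%:R -> `|z - x| <= m.+1%:R^-1 -> `|f z - f x| <= e) ->
  `|f y - staircase y| <= 2 * e.
Proof.
move=> y0 yN hf.
have m0 : (0 : R) < m.+1%:R by rewrite ltr0n.
set q := Num.truncn (m.+1%:R * y).
have /andP[q1 q2] : q%:R <= m.+1%:R * y < q.+1%:R.
  by apply: Num.Theory.truncn_itv; rewrite mulr_ge0.
have qN : (q < N)%N by rewrite -(ltr_nat R) (le_lt_trans q1).
have -> : staircase y = a q + (a q.+1 - a q) * step (m.+1%:R * y - q%:R).
  rewrite /staircase (big_cat_nat _ (ltnW qN))//= [X in _ + (_ + X)]big_ltn// addrA.
  rewrite [X in _ + (_ + X)](_ : _ = 0) ?addr0; last first.
    rewrite big_nat_cond big1// => i /andP[/andP[qi _] _].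
    by rewrite step_le0 ?mulr0// subr_le0 (le_trans (ltW q2))// ler_nat.
  congr (_ + _); rewrite -[RHS](subrKC (a 0%N)).
  rewrite -(telescope_sumr a (leq0n q)); congr (_ + _); apply: eq_big_nat => i /andP[_ iq].
  rewrite step_ge1 ?mulr1// lerBrDl (le_trans _ q1)// -[X in _ + X]/(1%:R) -natrD ler_nat.
  by rewrite addn1.
have qI : 0 <= (q%:R / m.+1%:R : R) <= N%:R / m.+1%:R.
  by apply/andP; split; [rewrite divr_ge0|rewrite ler_pM2r ?invr_gt0// ler_nat ltnW].
have h1 : `|f y - a q| <= e.
  apply: hf => //; rewrite ger0_norm ?subr_ge0 ?ler_pdivrMr//; last by rewrite mulrC.
  by rewrite lerBlDr -[X in X + _]mul1r -mulrDl ler_pdivlMr// mulrC (le_trans (ltW q2))// -natr1 addrC.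
have h2 : `|a q.+1 - a q| <= e.
  apply: hf => //; rewrite -mulrBl -natrB ?leqnSn// subSnn mul1r ger0_norm//.
rewrite opprD addrA; apply: (le_trans (ler_normB _ _)).
rewrite [leRHS]mulr_natl [leRHS]mulr2n lerD//.
rewrite normrM (le_trans _ h2)// ler_piMr// ger0_norm ?step_ge0//.
exact: step_le1.
Qed.

End staircase.

(** * From steps to bounded continuous test functions *)

Section portmanteau.
Context {R : realType} {d d' : measure_display}
  {T : measurableType d} {T' : measurableType d'}.
Variables (P : probability T R) (P' : probability T' R).
Variables (X : nat -> T -> R) (Y : T' -> R).
Hypotheses (mX : forall j, measurable_fun setT (X j)) (mY : measurable_fun setT Y)
  (X0 : forall j w, 0 <= X j w) (Y0 : forall w, 0 <= Y w).
Hypothesis step_cvg : forall k a : R, 0 < k ->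
  \int[P]_w step (k * X j w + a) @[j --> \oo] --> \int[P']_w step (k * Y w + a).

(** Integrability is carried along to make the property stable under linear combinations. *)
Definition transfers (g : R -> R) : Prop :=
  [/\ forall j, P.-integrable setT (EFin \o (g \o X j)),
      P'.-integrable setT (EFin \o (g \o Y)) &
      \int[P]_w g (X j w) @[j --> \oo] --> \int[P']_w g (Y w)].

Lemma transfers_cst c : transfers (fun=> c).
Proof.
split; [move=> j| |].
- exact: finite_measure_integrable_cst.
- exact: finite_measure_integrable_cst.
- by under eq_fun do rewrite Rintegral_probability_cst; rewrite Rintegral_probability_cst; exact: cvg_cst.
Qed.

Lemma transfersZ c g : transfers g -> transfers (fun y => c * g y).
Proof.
move=> [i1 i2 h]; split; [move=> j| |].
- by apply: eq_integrable (integrableZl measurableT c (i1 j)).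
- by apply: eq_integrable (integrableZl measurableT c i2).
- rewrite RintegralZl// (_ : (fun j => _) = fun j => c * \int[P]_w g (X j w)).
    exact: cvgMr.
  by apply/funext => j; rewrite RintegralZl//; exact: i1.
Qed.

Lemma transfersD g h : transfers g -> transfers h -> transfers (fun y => g y + h y).
Proof.
move=> [i1 i2 gc] [j1 j2 hc]; split; [move=> j| |].
- by apply: eq_integrable (integrableD measurableT (i1 j) (j1 j)).
- by apply: eq_integrable (integrableD measurableT i2 j2).
- rewrite RintegralD//.
  rewrite (_ : (fun j => _) = fun j => \int[P]_w g (X j w) + \int[P]_w h (X j w)).
    exact: cvgD.
  by apply/funext => j; rewrite RintegralD//; [exact: i1|exact: j1].
Qed.

Lemma transfers_sum N (g : nat -> R -> R) : (forall i, transfers (g i)) ->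
  transfers (fun y => \sum_(0 <= i < N) g i y).
Proof.
move=> tg; elim: N => [|N ih].
  by under [X in transfers X]eq_fun do rewrite big_geq//; exact: transfers_cst.
by under [X in transfers X]eq_fun do rewrite big_nat_recr//=; exact: transfersD.
Qed.

Lemma transfers_step (k a : R) : 0 < k -> transfers (fun y => step (k * y + a)).
Proof.
move=> k0.
have ms : measurable_fun setT (fun y : R => step (k * y + a)).
  apply: measurableT_comp; first exact: measurable_step.
  by apply: measurable_funD => //; exact: measurable_funM.
have s1 y : `|step (k * y + a)| <= 1 by rewrite ger0_norm ?step_ge0 ?step_le1.
split; [move=> j| |exact: step_cvg].
- by apply: (@bounded_integrable _ _ _ P _ 1); [exact: (measurableT_comp ms (mX j))|move=> w; exact: s1].
- by apply: (@bounded_integrable _ _ _ P' _ 1); [exact: (measurableT_comp ms mY)|move=> w; exact: s1].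
Qed.

Lemma transfers_staircase (f : R -> R) m N : transfers (staircase f m N).
Proof.
apply: transfersD; first exact: transfers_cst.
by apply: transfers_sum => i; apply: transfersZ; exact: transfers_step.
Qed.

Lemma transfers_continuous (f : R -> R) M : continuous f -> (forall y, `|f y| <= M) ->
  \int[P]_w f (X j w) @[j --> \oo] --> \int[P']_w f (Y w).
Proof.
move=> cf fM; have M0 : 0 <= M by rewrite (le_trans _ (fM 0)).
have mf := continuous_measurable_fun cf.
apply/cvgrPdist_le => eps eps0.
(* Replacing f by the staircase costs 2 e + 2 M e on the limit side and 2 e + 4 M e on the other;
   convergence for the staircase costs e. *)
pose e := eps / (5 + 6 * M).
have D0 : 0 < 5 + 6 * M by rewrite ltr_wpDr// mulr_ge0.
have e0 : 0 < e by rewrite divr_gt0.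
have epsE : eps = 5 * e + 6 * (M * e).
  by rewrite /e; field; rewrite gt_eqF.
(* Tightness is not assumed: a step starting at a high level K bounds the mass beyond K + 1. Its
   expectation is small for the limit, hence also for large [j], since steps transfer. *)
have tail : \int[P']_w step (1 * Y w - K%:R) @[K --> \oo] --> 0.
  rewrite -[X in _ --> X](Rintegral_probability_cst P' 0).
  apply: (@bounded_cvg_Rintegral _ _ _ _ _ _ 1).
  - move=> K; apply: measurableT_comp; first exact: measurable_step.
    by apply: measurable_funD => //; exact: measurable_funM.
  - exact: measurable_cst.
  - by move=> K w; rewrite ger0_norm ?step_ge0 ?step_le1.
  - apply: aeW => w; apply: cvg_near_cst.
    apply: filterS (nbhs_infty_ger (Y w)) => K YK.
    by rewrite step_le0// mul1r subr_le0.
have [K tK] : exists K : nat, \int[P']_w step (1 * Y w - K%:R) <= e.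
  near \oo => K; exists K; near: K; exact: (cvgr_le 0).
have [m hm] := uniform_modulus K.+1%:R cf e0.
pose N := (m.+1 * K.+1)%N.
have m0 : (0 : R) < m.+1%:R by rewrite ltr0n.
have NE : N%:R = m.+1%:R * K.+1%:R :> R by rewrite natrM.
pose g := staircase f m N.
have near_f y : 0 <= y -> `|f y - g y| <= 2 * e + 2 * M * step (1 * y - K%:R).
  move=> y0; have [yN|Ny] := ltP (m.+1%:R * y) N%:R.
    apply: ler_wpDr; first exact: mulr_ge0 (mulr_ge0 _ M0) (step_ge0 _).
    apply: staircase_small => // x z; rewrite NE mulrAC divff ?mul1r ?gt_eqF//.
    exact: hm.
  rewrite /g staircase_large// step_ge1.
    rewrite mulr1; apply: ler_wpDl; first by rewrite mulr_ge0// ltW.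
    by apply: (le_trans (ler_normB _ _)); rewrite [leRHS]mulr_natl [leRHS]mulr2n lerD.
  by move: Ny; rewrite NE ler_pM2l// mul1r -natr1 lerBrDl.
have [ig1 ig2 gc] := transfers_staircase f m N.
have [is1 is2 sc] := transfers_step (- K%:R) (ltr01 : 0 < 1).
have approx (D : measure_display) (S : measurableType D) (Q : probability S R)
    (V : S -> R) : measurable_fun setT V -> (forall w, 0 <= V w) ->
    Q.-integrable setT (EFin \o (g \o V)) ->
    Q.-integrable setT (EFin \o (fun w => step (1 * V w - K%:R))) ->
    `|\int[Q]_w f (V w) - \int[Q]_w g (V w)| <=
    2 * e + 2 * M * \int[Q]_w step (1 * V w - K%:R).
  move=> mV V0 ig is_.
  have if_ : Q.-integrable setT (EFin \o (f \o V)).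
    apply: (@bounded_integrable _ _ _ Q (f \o V) M); first exact: (measurableT_comp mf mV).
    by move=> w; exact: fM.
  have ifg : Q.-integrable setT (EFin \o (fun w => f (V w) - g (V w))).
    by apply: eq_integrable (integrableB measurableT if_ ig).
  have ic : Q.-integrable setT (EFin \o (fun=> 2 * e)).
    exact: finite_measure_integrable_cst.
  have isM : Q.-integrable setT (EFin \o (fun w => 2 * M * step (1 * V w - K%:R))).
    by apply: eq_integrable (integrableZl measurableT (2 * M) is_).
  rewrite -RintegralB// (le_trans (le_normr_Rintegral measurableT ifg))//.
  rewrite -(Rintegral_probability_cst Q (2 * e)) -RintegralZl// -RintegralD//.
  apply: le_Rintegral => //.
  - by apply: eq_integrable (integrable_norm ifg).
  - by apply: eq_integrable (integrableD measurableT ic isM).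
  - by move=> w _; exact: near_f.
have aY := approx _ _ P' Y mY Y0 ig2 is2.
near=> j.
have aX := approx _ _ P (X j) (mX j) (X0 j) (ig1 j) (is1 j).
have h1 : `|\int[P']_w g (Y w) - \int[P]_w g (X j w)| <= e.
  by near: j; move/cvgrPdist_le : gc; exact.
have h2 : `|\int[P']_w step (1 * Y w - K%:R) - \int[P]_w step (1 * X j w - K%:R)| <= e.
  by near: j; move/cvgrPdist_le : sc; exact.
have s2 : \int[P]_w step (1 * X j w - K%:R) <= 2 * e.
  by move: h2; rewrite ler_distlC => /andP[_]; move: tK; lra.
have b1 : 2 * M * \int[P']_w step (1 * Y w - K%:R) <= 2 * (M * e).
  by rewrite -mulrA ler_pM2l// ler_wpM2l.
have b2 : 2 * M * \int[P]_w step (1 * X j w - K%:R) <= 4 * (M * e).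
  rewrite -mulrA [leRHS](_ : _ = 2 * (M * (2 * e))); last by ring.
  by rewrite ler_pM2l// ler_wpM2l.
rewrite epsE; move: aX aY h1 b1 b2; rewrite !ler_norml.
by do 3 move=> /andP[? ?]; move=> ? ?; apply/andP; split; lra.
Unshelve. all: by end_near. Qed.

End portmanteau.

(** As the expectation is 0, the variance is the extended integral of X^2; its being 1 yields square
    integrability, and |x| <= 1 + x^2 then yields integrability. *)
Lemma standardized_moments {R : realType} {d : measure_display} {T : measurableType d}
    (P : probability T R) (X : T -> R) : measurable_fun setT X ->
  ('E_P[X] = 0)%E -> ('V_P[X] = 1)%E ->
  [/\ P.-integrable setT (EFin \o X),
      P.-integrable setT (EFin \o (fun w => X w ^+ 2)),
      \int[P]_w X w = 0 & \int[P]_w X w ^+ 2 = 1].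
Proof.
move=> mX EX VX.
have mX2 : measurable_fun setT (fun w => X w ^+ 2) by exact: measurable_funX.
have X2 : (\int[P]_w (X w ^+ 2)%:E = 1)%E.
  rewrite -VX /variance unlock EX unlock; apply: eq_integral => w _.
  by transitivity ((X w - 0) * (X w - 0))%:E; first by rewrite subr0 expr2.
have iX2 : P.-integrable setT (EFin \o (fun w => X w ^+ 2)).
  apply/integrableP; split; first exact/measurable_EFinP.
  under eq_integral do rewrite /= ger0_norm ?sqr_ge0//.
  by rewrite X2 ltry.
have i1 : P.-integrable setT (EFin \o (fun=> 1 : R)).
  exact: finite_measure_integrable_cst.
split => //.
- have := integrableD measurableT i1 iX2.
  apply: le_integrable => //; first exact/measurable_EFinP.
  move=> w _ /=; rewrite lee_fin [leRHS]ger0_norm ?addr_ge0 ?sqr_ge0//.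
  have := sqr_ge0 (`|X w| - 1); rewrite sqrrB real_normK ?num_real// mulr1 expr1n.
  have := normr_ge0 (X w); have := sqr_ge0 (X w).
  by move: `|X w| (X w ^+ 2) => x y *; lra.
- by move: EX; rewrite unlock /Rintegral => ->.
- by rewrite /Rintegral X2.
Qed.

Lemma fine_scale {R : realType} (c : R) (x : \bar R) : 0 < c ->
  fine (c%:E * x)%E = c * fine x.
Proof.
move=> c0; case: x => [x| |]; first by [].
  by rewrite gt0_muley ?lte_fin//= mulr0.
by rewrite gt0_muleNy ?lte_fin//= mulr0.
Qed.

Lemma expectation_bounded {R : realType} {d : measure_display} {T : measurableType d}
    (P : probability T R) (f : T -> R) (M : R) : measurable_fun setT f ->
  (forall w, `|f w| <= M) -> 'E_P[f]%E = (\int[P]_w f w)%:E.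
Proof.
move=> mf fM; rewrite unlock /Rintegral fineK//.
exact: integrable_fin_num (bounded_integrable P mf fM).
Qed.

(** * Reduction to unit variance and passage to sequences *)

Section standardized.
Context {R : realType} {d d' : measure_display}
  {T : measurableType d} {T' : measurableType d'}.
Variables (P : probability T R) (P' : probability T' R).
Variables (theta0 sigma0 : R) (theta Z Rem : nat -> {RV P >-> R}).
Hypotheses (sigma0_gt0 : 0 < sigma0)
  (thetaE : forall (n : nat) (w : T), (1 <= n)%N ->
    theta n w - theta0 = sigma0 * (n%:R^-1 * \sum_(i < n) Z i w) + Rem n w)
  (Z_indep : mutually_independent P (fun (i : nat) (w : T) => Z i w))
  (Z_ident : identically_distributed P (fun (i : nat) (w : T) => Z i w))
  (Z_mean : forall i : nat, ('E_P[Z i] = 0)%E)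
  (Z_var : forall i : nat, ('V_P[Z i] = 1)%E)
  (Rem_small : cvg_to0_in_probability P (fun (m : nat) (w : T) =>
    ((Num.sqrt (m%:R : R))%:E *
     ereal_sup [set (`|Rem n w|)%:E | n in [set n : nat | (m <= n)%N]])%E)).
Variables (W : R -> {RV P' >-> R}) (W_bm : standard_brownian_motion P' W).
Variable a : R.
Hypothesis a0 : 0 <= a.

(** Deviations divided by [sigma0] are compared with eps / sigma0, and b / (eps / sigma0)^2 = a /
    eps^2. *)
Let b := a / sigma0 ^+ 2.
Let b0 : 0 <= b. Proof. by rewrite divr_ge0// sqr_ge0. Qed.
Let z (i : nat) (w : T) : R := Z i w.
Let rho (n : nat) (w : T) : R := Rem n w / sigma0.

Let mz i : measurable_fun setT (z i). Proof. exact: measurable_funPT. Qed.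
Let mrho i : measurable_fun setT (rho i).
Proof. by apply: measurable_funM => //; exact: measurable_funPT. Qed.

Let moments i := standardized_moments (mz i) (Z_mean i) (Z_var i).
Let iz i : P.-integrable setT (EFin \o z i). Proof. by have [] := moments i. Qed.
Let iz2 i : P.-integrable setT (EFin \o (fun w => z i w ^+ 2)).
Proof. by have [] := moments i. Qed.
Let Ez i : \int[P]_w z i w = 0. Proof. by have [] := moments i. Qed.
Let Ez2 i : \int[P]_w z i w ^+ 2 = 1. Proof. by have [] := moments i. Qed.

Let rho_small delta : 0 < delta ->
  P (bad_remainder rho delta m) @[m --> \oo] --> 0%E.
Proof.
move=> delta0; have sd0 : 0 < sigma0 * delta by rewrite mulr_gt0.
apply: (squeeze_cvge _ (cvg_cst 0%E) (Rem_small sd0)).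
apply: nearW => m; rewrite measure_ge0/=; apply: le_measure; rewrite ?inE.
- exact: measurable_bad_remainder.
- rewrite -[X in measurable X]setTI.
  apply: emeasurable_fun_c_infty => //; apply: measurableT_comp => //.
  apply: emeasurable_funM => //.
  apply: (@measurable_fun_esups _ _ _ _ (fun n w => (`|Rem n w|)%:E)) => n.
  by apply/measurable_EFinP; apply: measurableT_comp => //; exact: measurable_funPT.
- move=> w [n mn h] /=; set S := ereal_sup _.
  have h1 : ((`|Rem n w|)%:E <= S)%E by apply: ereal_sup_ubound; exists n.
  have s0 : 0 <= Num.sqrt (m%:R : R) by exact: sqrtr_ge0.
  apply: (@le_trans _ _ ((Num.sqrt (m%:R : R))%:E * (`|Rem n w|)%:E)%E).
    rewrite -EFinM lee_fin; move: h; rewrite /rho normrM normfV (gtr0_norm sigma0_gt0).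
    by rewrite mulrA ltr_pdivlMr// mulrC => /ltW.
  apply: (le_trans (lee_wpmul2l _ h1)); first by rewrite lee_fin.
  exact: lee_abs.
Qed.

Let countE eps w : 0 < eps ->
  exceedance_count (fun n w => theta n w) theta0 a eps w =
  hit_count z rho b (eps / sigma0) w.
Proof.
move=> eps0; congr counting.
have bE : b / (eps / sigma0) ^+ 2 = a / eps ^+ 2.
  by rewrite /b; field; rewrite !gt_eqF.
have key n : (1 <= n)%N -> (eps <= `|theta n w - theta0|) =
    (eps / sigma0 <= `|psum (z ^~ w) n / n%:R + rho n w|).
  move=> n1; rewrite thetaE// ler_pdivrMr// -[X in _ = (_ <= _ * X)](gtr0_norm sigma0_gt0).
  rewrite -normrM; congr (_ <= `|_|).
  rewrite mulrDl /rho divfK ?gt_eqF//; congr (_ + _).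
  by rewrite mulrC [n%:R^-1 * _]mulrC.
apply/seteqP; split => n /= [n1 an h]; split => //.
- by rewrite bE.
- by rewrite -key.
- by rewrite -bE.
- by rewrite key.
Qed.

Let timeE w : exceedance_time (fun t w => W t w) b w =
  @lebesgue_measure R (exceed W b 1 w).
Proof.
congr lebesgue_measure; apply/seteqP; split => t /=.
(* At t = 0 the inverse of 0 is 0, so the quotient is 0 and this time is not counted. *)
- move=> [t0 bt h]; have [tE|tn] := eqVneq t 0.
    by move: h; rewrite tE invr0 mulr0 normr0 ler10.
  have tp : 0 < t by rewrite lt_neqAle eq_sym tn.
  split => //; rewrite path_ge0// mul1r.
  by move: h; rewrite normrM normfV (gtr0_norm tp) ler_pdivlMr// mul1r.
- move=> [tp bt h]; split => //; first exact: ltW.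
  rewrite normrM normfV (gtr0_norm tp) ler_pdivlMr// mul1r.
  by move: h; rewrite mul1r path_ge0//; exact: ltW.
Qed.

Let Y (w : T') : R := fine (@lebesgue_measure R (exceed W b 1 w)).

Let mY : measurable_fun setT Y.
Proof. by apply: measurableT_comp => //; exact: measurable_occupation. Qed.

Let unit_cvg (v : nat -> R) (f : R -> R) (M : R) :
  (forall j, 0 < v j) -> (forall j, v j <= 1) -> v j @[j --> \oo] --> 0 ->
  continuous f -> (forall y, `|f y| <= M) ->
  \int[P]_w f (v j ^+ 2 * fine (hit_count z rho b (v j) w)) @[j --> \oo] -->
  \int[P']_w f (Y w).
Proof.
move=> v0 v1 vcvg cf fM.
apply: (transfers_continuous (X := fun j w => v j ^+ 2 * fine (hit_count z rho b (v j) w))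
  _ mY _ _ _ cf fM).
- move=> j; apply: measurable_funM => //; apply: measurableT_comp => //.
  exact: measurable_hit_count.
- by move=> j w; rewrite mulr_ge0 ?sqr_ge0// fine_ge0.
- by move=> w; rewrite fine_ge0.
move=> k c k0.
have h100 : (0 : R) <= 100 by [].
(* A step after an increasing affine map is nondecreasing, valued in [0, 1] and has Taylor bounds,
   which is what the sandwich and Lindeberg's replacement ask of a test function. *)
apply: (expectation_hit_count_cvg W_bm mz mrho Z_indep Z_ident iz iz2 Ez Ez2
  rho_small b0 v0 v1 vcvg _ (taylor2_affine k c h100 taylor2_step)).
- by rewrite mulr_ge0// exprn_ge0// addr_ge0.
- by move=> y; exact: step_ge0.
- by move=> y; exact: step_le1.
- by move=> y y' yy'; apply: step_homo; rewrite lerD2r ler_pM2l.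
- move=> y; apply: continuous_cvg; first exact: continuous_step.
  by apply: cvgD; [apply: cvgMr|exact: cvg_cst].
- apply: measurable_funM => //; apply: measurableT_comp; first exact: measurable_step1.
  by apply: measurable_funD => //; exact: measurable_funM.
- apply: measurable_funM => //; apply: measurableT_comp; first exact: measurable_step2.
  by apply: measurable_funD => //; exact: measurable_funM.
Qed.

Lemma exceedance_count_cvg :
  cvg_in_distribution (0 : R)^'+
    P (fun (eps : R) (w : T) =>
         ((eps ^+ 2)%:E *
          exceedance_count (fun n w => theta n w) theta0 a eps w)%E)
    P' (fun w : T' =>
          ((sigma0 ^+ 2)%:E *
           exceedance_time (fun t w => W t w) (a / sigma0 ^+ 2) w)%E).
Proof.
have s2 : 0 < sigma0 ^+ 2 by rewrite exprn_gt0.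
split.
- apply: filterS (nbhs_right_gt 0) => eps eps0.
  have E : (fun w => ((eps ^+ 2)%:E *
      exceedance_count (fun n w => theta n w) theta0 a eps w)%E) =
      fun w => ((eps ^+ 2)%:E * hit_count z rho b (eps / sigma0) w)%E.
    by apply/funext => w; rewrite countE.
  rewrite E; split.
    by apply: emeasurable_funM => //; exact: measurable_hit_count.
  have es0 : 0 < eps / sigma0 by rewrite divr_gt0.
  have := ae_hit_count_finite mz mrho Z_indep iz iz2 Ez Ez2 rho_small b es0.
  by apply: filterS => w h; rewrite fin_numM// ge0_fin_numE.
- have E : (fun w => ((sigma0 ^+ 2)%:E *
      exceedance_time (fun t w => W t w) (a / sigma0 ^+ 2) w)%E) =
      fun w => ((sigma0 ^+ 2)%:E * @lebesgue_measure R (exceed W b 1 w))%E.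
    by apply/funext => w; rewrite timeE.
  rewrite E; split.
    by apply: emeasurable_funM => //; exact: measurable_occupation.
  apply: filterS (ae_occupation_finite W_bm b0 ltr01) => w h.
  by rewrite fin_numM// ge0_fin_numE.
move=> f cf [M' [_ fM']].
have [M fM] : exists M : R, forall y, `|f y| <= M.
  by exists (M' + 1) => y; apply: fM' => //; rewrite ltrDl.
pose g y := f (sigma0 ^+ 2 * y).
have cg : continuous g.
  by move=> y; apply: continuous_comp; [exact: cvgMr|exact: cf].
have gM y : `|g y| <= M by exact: fM.
have mg := continuous_measurable_fun cg.
have -> : 'E_P'[fun w => f (fine ((sigma0 ^+ 2)%:E *
    exceedance_time (fun t w => W t w) (a / sigma0 ^+ 2) w)%E)]%E =
    (\int[P']_w g (Y w))%:E.
  rewrite -(expectation_bounded P' (measurableT_comp mg mY) (fun w => gM (Y w))).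
  by congr expectation; apply/funext => w; rewrite timeE fine_scale.
apply/cvge_at_rightP => u [u0 ucvg].
(* Truncating at 1 meets the bound on mesh sizes for every [j]; it changes nothing for large [j]. *)
pose v j := Num.min (u j / sigma0) 1.
have us0 j : 0 < u j / sigma0 by rewrite divr_gt0.
have uscvg : u j / sigma0 @[j --> \oo] --> 0.
  by rewrite -(mul0r sigma0^-1); exact: cvgMl.
have vE : \forall j \near \oo, v j = u j / sigma0.
  near=> j; rewrite /v min_l//; near: j; exact: (cvgr_le 0).
have vcvg : v j @[j --> \oo] --> 0.
  apply: cvg_trans uscvg; apply: near_eq_cvg.
  by apply: filterS vE => j ->.
have v0 j : 0 < v j by rewrite /v lt_min us0 ltr01.
have v1 j : v j <= 1 by rewrite /v ge_min lexx orbT.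
have h := unit_cvg v0 v1 vcvg cg gM.
have {}h : (\int[P]_w g (v j ^+ 2 * fine (hit_count z rho b (v j) w)))%:E @[j --> \oo] -->
    (\int[P']_w g (Y w))%:E by apply: cvg_EFin => //; exact: nearW.
apply: cvg_trans h; apply: near_eq_cvg; near=> j.
have -> : v j = u j / sigma0 by near: j; exact: vE.
have mc : measurable_fun setT
    (fun w => (u j / sigma0) ^+ 2 * fine (hit_count z rho b (u j / sigma0) w)).
  apply: measurable_funM => //; apply: measurableT_comp => //.
  exact: measurable_hit_count.
rewrite -(expectation_bounded P (measurableT_comp mg mc) (fun w => gM _)).
congr expectation; apply/funext => w; rewrite countE// fine_scale ?exprn_gt0//= /g.
congr f; rewrite mulrA; congr (_ * _); field.
by rewrite gt_eqF.
Unshelve. all: by end_near. Qed.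

End standardized.

(* [Z i] is the (i+1)-st summand; [theta 0] and [Rem 0] are unconstrained. *)
Theorem mainTheorem5 (R : realType)
  (d : measure_display) (T : measurableType d) (P : probability T R)
  (theta0 sigma0 : R) (theta Z Rem : nat -> {RV P >-> R})
  (sigma0_gt0 : 0 < sigma0)
  (thetaE : forall (n : nat) (w : T), (1 <= n)%N ->
    theta n w - theta0 = sigma0 * (n%:R^-1 * \sum_(i < n) Z i w) + Rem n w)
  (Z_indep : mutually_independent P (fun (i : nat) (w : T) => Z i w))
  (Z_ident : identically_distributed P (fun (i : nat) (w : T) => Z i w))
  (Z_mean : forall i : nat, ('E_P[Z i] = 0)%E)
  (Z_var : forall i : nat, ('V_P[Z i] = 1)%E)
  (Rem_small : cvg_to0_in_probability P (fun (m : nat) (w : T) =>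
    ((Num.sqrt (m%:R : R))%:E *
     ereal_sup [set (`|Rem n w|)%:E | n in [set n : nat | (m <= n)%N]])%E))
  (d' : measure_display) (T' : measurableType d') (P' : probability T' R)
  (W : R -> {RV P' >-> R}) (W_bm : standard_brownian_motion P' W) :
  (forall a : R, 0 <= a ->
    cvg_in_distribution (0 : R)^'+
      P (fun (eps : R) (w : T) =>
           ((eps ^+ 2)%:E *
            exceedance_count (fun n w => theta n w) theta0 a eps w)%E)
      P' (fun w : T' =>
            ((sigma0 ^+ 2)%:E *
             exceedance_time (fun t w => W t w) (a / sigma0 ^+ 2) w)%E)) /\
  cvg_in_distribution (0 : R)^'+
    P (fun (eps : R) (w : T) =>
         ((eps ^+ 2)%:E *
          counting [set n : nat | (1 <= n)%N /\
                                  (eps <= `|theta n w - theta0|)%R])%E)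
    P' (fun w : T' =>
          ((sigma0 ^+ 2)%:E * exceedance_time (fun t w => W t w) 0 w)%E).
Proof.
have main a (a0 : 0 <= a) := exceedance_count_cvg sigma0_gt0 thetaE Z_indep Z_ident
  Z_mean Z_var Rem_small W_bm a0.
split; first exact: main.
have := main 0 (lexx 0); rewrite mul0r.
rewrite [X in cvg_in_distribution _ _ X _ _ -> _](_ : _ = fun (eps : R) (w : T) =>
    ((eps ^+ 2)%:E * counting [set n : nat | (1 <= n)%N /\
      (eps <= `|theta n w - theta0|)%R])%E); first by [].
apply/funext => eps; apply/funext => w; congr (_ * _)%E.
congr counting; apply/seteqP; split => n /= [n1].
  by rewrite mul0r.
by split => //; rewrite mul0r.
Qed.
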